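(* Fix constants $k\ge1$, $\beta>-1$, $\gamma>0$, and a probability measure $\pi$ on $\mathbb{R}^k$ supported on a bounded set with $\mathbb{E}[\pi]=0$ and $\|\mathrm{Cov}(\pi)\|=1$ (not depending on $n$). Consider the general spiked Wishart model with spike prior $\mathcal X(\pi)$, signal-to-noise ratio $\beta$, and any number of samples $N=N_n$ satisfying $n/N\to\gamma$ as $n\to\infty$. If $\beta^2<\gamma$ then $\|L^{\le D}\|=O(1)$ for any $D=o(n/\log n)$.
   Context: Spike prior $\mathcal X(\pi)$: $\mathbf X=\frac1n\mathbf U\mathbf U^\top$ with $\mathbf U$ an $n\times k$ matrix with i.i.d. rows distributed as $\pi$. General spiked Wishart model, observations $(\mathbf y_1,\dots,\mathbf y_N)\in(\mathbb R^n)^N$: under $\mathbb Q$, $\mathbf y_u\sim\mathcal N(0,I_n)$ i.i.d.; under $\mathbb P$, draw $\widetilde{\mathbf X}\sim\mathcal X(\pi)$, set $\mathbf X=\widetilde{\mathbf X}$ if $\beta\widetilde{\mathbf X}\succ -I_n$ and $\mathbf X=0$ otherwise, then draw $\mathbf y_u\sim\mathcal N(0,I_n+\beta\mathbf X)$ i.i.d. $L=d\mathbb P/d\mathbb Q$ and $L^{\le D}$ is the orthogonal projection of $L$ in $L^2(\mathbb Q)$ onto polynomials of degree $\le D$ in the $nN$ coordinates; $\|\cdot\|$ is the $L^2(\mathbb Q)$ norm. *)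

(* Defs.v *)
From HB Require Import structures.
From mathcomp Require Import all_boot all_order all_algebra.
From mathcomp Require mpoly.
(* The notations of mpoly clash with those of MathComp-Analysis. *)
Import -(notations) mpoly.
From mathcomp Require Import all_classical all_reals all_analysis.
From mathcomp Require Import measurable_realfun ring lra.

Set Implicit Arguments.
Unset Strict Implicit.
Unset Printing Implicit Defensive.

Import Order.TTheory GRing.Theory Num.Theory.
Import numFieldNormedType.Exports.

Local Open Scope classical_set_scope.
Local Open Scope ring_scope.

Section iid.
Context d (T : measurableType d) (R : realType).

Definition tcons n (x : T * n.-tuple T) : n.+1.-tuple T := [tuple of x.1 :: x.2].

Lemma measurable_tcons n : measurable_fun [set: T * n.-tuple T] (@tcons n).
Proof. exact: measurable_cons. Qed.

HB.instance Definition _ n :=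
  isMeasurableFun.Build _ _ _ _ (@tcons n) (@measurable_tcons n).

(* Law of n independent draws from P: the n-fold product measure. *)
Fixpoint iid (P : probability T R) n : probability (n.-tuple T) R :=
  match n with
  | 0 => dirac [tuple]
  | n'.+1 => distribution (P \x iid P n')%E (@tcons n')
  end.

End iid.

Lemma iid_distribution d1 d2 (T1 : measurableType d1) (T2 : measurableType d2)
    (R : realType) (P : probability T1 R) (f : {mfun T1 >-> T2}) n
    (A : set (n.-tuple T2)) : measurable A ->
  iid (distribution P f) n A = iid P n (map_tuple f @^-1` A).
Proof.
elim: n => [|n IH] in A *.
  move=> mA; rewrite /= !diracE.
  suff -> : ([tuple] \in A) = ([tuple] \in map_tuple f @^-1` A) by [].
  by apply/idP/idP; rewrite !inE /preimage/= [map_tuple _ _]tuple0.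
move=> mA; pose g (x : T1 * n.-tuple T1) := (f x.1, map_tuple f x.2).
have mmap : measurable_fun [set: n.-tuple T1] (map_tuple f).
  apply/measurable_fun_tnthP => i.
  rewrite (_ : _ \o _ = f \o (@tnth _ T1 ^~ i)); last first.
    by apply/funext => x /=; rewrite tnth_map.
  by apply: measurableT_comp => //; exact: measurable_tnth.
have mg : measurable_fun [set: T1 * n.-tuple T1] g.
  by apply: measurable_fun_pair; apply: measurableT_comp.
pose G : {mfun (T1 * n.-tuple T1)%type >-> (T2 * n.-tuple T2)%type} :=
  HB.pack g (isMeasurableFun.Build _ _ _ _ g mg).
rewrite /= /distribution /pushforward.
have mA' : measurable (@tcons _ T2 n @^-1` A).
  by rewrite -[X in measurable X]setTI; exact: measurable_tcons.
transitivity (distribution (P \x iid P n)%E G (@tcons _ T2 n @^-1` A)).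
  apply: (@product_measure_unique _ _ T2 (n.-tuple T2) R (distribution P f)
    (iid (distribution P f) n) (distribution (P \x iid P n)%E G)) => // B C mB mC.
  transitivity (distribution P f B * iid P n (map_tuple f @^-1` C))%E.
    rewrite /distribution /pushforward -product_measure1E//.
    + by rewrite -[X in measurable X]setTI; exact: measurable_funP.
    + by rewrite -[X in measurable X]setTI; exact: mmap.
  by congr (_ * _)%E; exact/esym/IH.
have E x : tcons (g x) = map_tuple f (tcons x) by exact: val_inj.
rewrite /distribution /pushforward; congr ((_ \x _)%E _).
by apply/funext => x; rewrite /preimage/=; exact: congr1 (E x).
Qed.

Section gaussian.
Context (R : realType).

(* N(0, 1) on R, seen as a measurableType with its own display. *)
Definition std_normal : set R -> \bar R := normal_prob (0 : R) 1.

Let std_normal0 : std_normal set0 = 0%E.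
Proof. exact: measure0. Qed.

Let std_normal_ge0 A : (0 <= std_normal A)%E.
Proof. exact: measure_ge0. Qed.

Let std_normal_sigma_additive : semi_sigma_additive std_normal.
Proof. exact: (@measure_semi_sigma_additive _ _ _ (normal_prob (0 : R) 1)). Qed.

HB.instance Definition _ := isMeasure.Build _ _ _ std_normal
  std_normal0 std_normal_ge0 std_normal_sigma_additive.

Let std_normal_setT : std_normal [set: R] = 1%E.
Proof. exact: (@probability_setT _ _ _ (normal_prob (0 : R) 1)). Qed.

HB.instance Definition _ :=
  Measure_isProbability.Build _ _ _ std_normal std_normal_setT.

Definition posdef n (M : 'M[R]_n) : Prop :=
  M^T = M /\ forall v : 'cV[R]_n, v != 0 -> 0 < (v^T *m M *m v) 0 0.

Definition schur n (M : 'M[R]_(1 + n)) : 'M[R]_n :=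
  drsubmx M - (M 0 0)^-1 *: (dlsubmx M *m (dlsubmx M)^T).

(* Cholesky factor: chol M is lower triangular with chol M *m (chol M)^T = M
   whenever M is positive definite, see cholK below. *)
Fixpoint chol n : 'M[R]_n -> 'M[R]_n :=
  match n with
  | 0 => fun=> 0
  | n'.+1 => fun M : 'M[R]_(1 + n') =>
      block_mx (Num.sqrt (M 0 0))%:M 0
               ((Num.sqrt (M 0 0))^-1 *: dlsubmx M) (chol (schur M))
  end.

Fixpoint posdefb n : 'M[R]_n -> bool :=
  match n with
  | 0 => xpredT
  | n'.+1 => fun M : 'M[R]_(1 + n') => (0 < M 0 0) && posdefb (schur M)
  end.

Lemma sym_block n (M : 'M[R]_(1 + n)) : M^T = M ->
  M = block_mx (M 0 0)%:M (dlsubmx M)^T (dlsubmx M) (drsubmx M).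
Proof.
move=> sM; rewrite -[LHS]submxK; congr block_mx.
  by rewrite [LHS]mx11_scalar !mxE; congr (M _ _)%:M; exact: val_inj.
by rewrite trmx_dlsub sM.
Qed.

Lemma schur_sym n (M : 'M[R]_(1 + n)) : M^T = M -> (schur M)^T = schur M.
Proof.
move=> sM; rewrite /schur linearB/= linearZ/= trmx_mul trmxK.
by rewrite trmx_drsub sM.
Qed.

Lemma quad_block n (a x : R) (b w : 'cV[R]_n) (C : 'M[R]_n) : a != 0 ->
  ((col_mx x%:M w)^T *m block_mx a%:M b^T b C *m col_mx x%:M w) 0 0 =
  a * (x + a^-1 * (b^T *m w) 0 0) ^+ 2
  + (w^T *m (C - a^-1 *: (b *m b^T)) *m w) 0 0.
Proof.
move=> a0; have wb : (w^T *m b) = (b^T *m w).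
  by rewrite [LHS]mx11_scalar -tr_scalar_mx -mx11_scalar trmx_mul trmxK.
set p := (b^T *m w) 0 0; have Ep : b^T *m w = p%:M by exact: mx11_scalar.
rewrite tr_col_mx tr_scalar_mx mul_row_block mul_row_col !mulmxDl.
rewrite mulmxBr mulmxBl -scalemxAr -scalemxAl !mulmxA wb Ep.
rewrite -!scalar_mxM -[x%:M *m b^T *m w]mulmxA -[p%:M *m b^T *m w]mulmxA Ep.
rewrite -!scalar_mxM !mxE/= !mulr1n.
set q := \sum_(j < n) _.
by field.
Qed.

Lemma posdef_schur n (M : 'M[R]_(1 + n)) : M^T = M ->
  posdef M <-> 0 < M 0 0 /\ posdef (schur M).
Proof.
move=> sM; split=> [[_ pM]|[a0 [_ pS]]].
  have a0 : 0 < M 0 0.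
    have := pM (col_mx 1%:M 0); rewrite [X in _ *m X *m _](sym_block sM).
    rewrite tr_col_mx tr_scalar_mx trmx0 mul_row_block mul_row_col.
    rewrite !mul0mx !mulmx0 !addr0 mul1mx mulmx1 mxE eqxx mulr1n; apply.
    apply/eqP => /(congr1 usubmx); rewrite col_mxKu linear0 => /matrixP/(_ 0 0).
    by rewrite !mxE; apply/eqP; exact: oner_neq0.
  split=> //; split=> [|w w0]; first exact: schur_sym.
  pose p := ((dlsubmx M)^T *m w) 0 0.
  have := pM (col_mx (- ((M 0 0)^-1 * p))%:M w).
  rewrite [X in _ *m X *m _](sym_block sM) quad_block ?gt_eqF//.
  rewrite addNr expr0n mulr0 add0r; apply.
  by apply: contra w0 => /eqP/(congr1 dsubmx); rewrite col_mxKd linear0 => ->.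
split=> // v v0; rewrite -[v]vsubmxK [usubmx v]mx11_scalar.
rewrite [X in _ *m X *m _](sym_block sM) quad_block ?gt_eqF//.
set x := usubmx v 0 0; have [w0|w0] := eqVneq (dsubmx v) 0.
  rewrite w0 !mulmx0 [in X in _ + X]mxE addr0 [in X in _ * X]mxE mulr0 addr0.
  rewrite mulr_gt0// exprn_even_gt0//=; apply: contra v0 => /eqP x0.
  rewrite -[v]vsubmxK w0 [usubmx v]mx11_scalar -/x x0.
  by rewrite -scalemx1 scale0r col_mx0.
by rewrite ltr_wpDl ?pS// mulr_ge0 ?sqr_ge0// ltW.
Qed.

Lemma posdefbP n (M : 'M[R]_n) : M^T = M -> reflect (posdef M) (posdefb M).
Proof.
elim: n => [|n IH] in M * => sM /=.
  by apply: ReflectT; split=> // v; rewrite [v]flatmx0 eqxx.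
apply: (iffP andP) => [[a0 /(IH _ (schur_sym sM)) pS]|].
  exact/(posdef_schur sM).
by move/(posdef_schur sM) => [a0 pS]; split=> //; exact/(IH _ (schur_sym sM)).
Qed.

Lemma cholK n (M : 'M[R]_n) : posdef M -> chol M *m (chol M)^T = M.
Proof.
elim: n => [|n IH] in M * => pM; first by rewrite [RHS]flatmx0 [LHS]flatmx0.
change 'M[R]_(1 + n) in M.
have sM := pM.1; have [a0 pS] := (posdef_schur sM).1 pM.
set a := M 0 0 in a0 *; have s0 : Num.sqrt a != 0 by rewrite gt_eqF ?sqrtr_gt0.
have ss : Num.sqrt a * Num.sqrt a = a by rewrite -expr2 sqr_sqrtr ?ltW.
pose B : 'M[R]_(1 + n) := block_mx (Num.sqrt a)%:M 0
  ((Num.sqrt a)^-1 *: dlsubmx M) (chol (schur M)).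
suff: B *m B^T = M by [].
rewrite tr_block_mx trmx0 tr_scalar_mx linearZ/= mulmx_block.
rewrite !mulmx0 !mul0mx !addr0 IH// [RHS](sym_block sM) -/a.
rewrite -scalar_mxM ss mul_scalar_mx mul_mx_scalar; congr block_mx.
- by rewrite scalerA divff// scale1r.
- by rewrite scalerA divff// scale1r.
- rewrite -scalemxAl -scalemxAr scalerA -invfM ss /schur -/a.
  by rewrite addrC subrK.
Qed.

Definition mulmx_tuple n (A : 'M[R]_n) (z : n.-tuple R) : n.-tuple R :=
  [tuple \sum_j A i j * tnth z j | i < n].

Lemma measurable_mulmx_tuple n (A : 'M[R]_n) :
  measurable_fun [set: n.-tuple R] (mulmx_tuple A).
Proof.
apply/measurable_fun_tnthP => i.
rewrite (_ : _ \o _ = fun z => \sum_j A i j * tnth z j); last first.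
  by apply/funext => z /=; rewrite tnth_mktuple.
apply: measurable_sum => j; apply: measurable_funM => //.
exact: measurable_tnth.
Qed.

HB.instance Definition _ n (A : 'M[R]_n) :=
  isMeasurableFun.Build _ _ _ _ (mulmx_tuple A) (@measurable_mulmx_tuple n A).

(* N(0, S) for S positive definite: the law of A z where A A^T = S and z has
   i.i.d. standard normal coordinates. *)
Definition mvnormal n (S : 'M[R]_n) : probability (n.-tuple R) R :=
  distribution (iid std_normal n) (mulmx_tuple (chol S)).

Section measurable_chol.
Context d (X : measurableType d).

Let mxmeas m n (F : X -> 'M[R]_(m, n)) :=
  forall i j, measurable_fun [set: X] (fun x => F x i j).

Lemma measurable_inv (f : X -> R) :
  measurable_fun [set: X] f -> measurable_fun [set: X] (fun x => (f x)^-1).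
Proof.
move=> mf; rewrite (_ : (fun _ => _) = fun x => f x * (f x ^+ 2) `^ (-1)).
  apply: measurable_funM => //.
  apply: (@measurableT_comp _ _ _ _ _ _ (@powR R ^~ (-1))) => //.
  exact: measurable_funX.
apply/funext => x; rewrite powR_inv1 ?sqr_ge0//.
have [->|f0] := eqVneq (f x) 0; first by rewrite invr0 mul0r.
by rewrite expr2 invfM mulrA divff// mul1r.
Qed.

Let measurable_schur n (F : X -> 'M[R]_(1 + n)) : mxmeas F ->
  mxmeas (fun x => schur (F x)).
Proof.
move=> mF i j; rewrite (_ : (fun _ => _) = fun x =>
  F x (rshift 1 i) (rshift 1 j)
  - (F x 0 0)^-1 * (F x (rshift 1 i) 0 * F x (rshift 1 j) 0)).
  apply: measurable_funB; first exact: mF.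
  by apply: measurable_funM; [exact/measurable_inv/mF|
    apply: measurable_funM; exact: mF].
apply/funext => x; rewrite !mxE big_ord1 !mxE.
by congr (_ - _ * (F x _ _ * F x _ _)); exact: val_inj.
Qed.

Let measurable_posdefb n (F : X -> 'M[R]_n) : mxmeas F ->
  measurable_fun [set: X] (fun x => posdefb (F x)).
Proof.
elim: n => [|n IH] in F *; first by move=> _; exact: measurable_cst.
move=> mF /=; apply: measurable_and; first exact: measurable_fun_ltr.
by apply: IH; exact: measurable_schur.
Qed.

Let measurable_chol n (F : X -> 'M[R]_n) : mxmeas F ->
  mxmeas (fun x => chol (F x)).
Proof.
elim: n => [|n IH] in F *; first by move=> _ [].
have msqrt (f : X -> R) : measurable_fun [set: X] f ->
    measurable_fun [set: X] (fun x => Num.sqrt (f x)).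
  move=> mf; apply: measurableT_comp mf.
  by apply: continuous_measurable_fun; exact: sqrt_continuous.
change (X -> 'M[R]_(1 + n)) in F.
move=> mF i j.
rewrite (_ : (fun _ => _) = fun x => (block_mx (Num.sqrt (F x 0 0))%:M 0
  ((Num.sqrt (F x 0 0))^-1 *: dlsubmx (F x)) (chol (schur (F x)))
    : 'M[R]_(1 + n)) i j)//.
case: (splitP (m := 1) i) => i' ii'; case: (splitP (m := 1) j) => j' jj'.
- have -> : i = lshift n i' by exact: val_inj.
  have -> : j = lshift n j' by exact: val_inj.
  rewrite (_ : (fun _ => _) = fun x => Num.sqrt (F x 0 0)); last first.
    by apply/funext => x; rewrite block_mxEul mxE [i']ord1 [j']ord1 eqxx mulr1n.
  exact/msqrt/mF.
- have -> : i = lshift n i' by exact: val_inj.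
  have -> : j = rshift 1 j' by exact: val_inj.
  rewrite (_ : (fun _ => _) = cst 0); first exact: measurable_cst.
  by apply/funext => x; rewrite block_mxEur mxE.
- have -> : i = rshift 1 i' by exact: val_inj.
  have -> : j = lshift n j' by exact: val_inj.
  rewrite (_ : (fun _ => _) = fun x => (Num.sqrt (F x 0 0))^-1 *
      F x (rshift 1 i') (lshift n j')).
    by apply: measurable_funM; [exact/measurable_inv/msqrt/mF|exact: mF].
  by apply/funext => x; rewrite block_mxEdl !mxE.
- have -> : i = rshift 1 i' by exact: val_inj.
  have -> : j = rshift 1 j' by exact: val_inj.
  rewrite (_ : (fun _ => _) = fun x => chol (schur (F x)) i' j').
    by apply: IH; exact: measurable_schur.
  by apply/funext => x; rewrite block_mxEdr.
Qed.

Lemma measurable_asbool_posdef n (F : X -> 'M[R]_n) :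
  (forall x, (F x)^T = F x) -> mxmeas F ->
  measurable_fun [set: X] (fun x => `[< posdef (F x) >]).
Proof.
move=> sF mF; rewrite (_ : (fun _ => _) = fun x => posdefb (F x)).
  exact: measurable_posdefb.
by apply/funext => x; apply/asboolP/(posdefbP (sF x)).
Qed.

Lemma measurable_iid_mvnormal n (F : X -> 'M[R]_n) N (A : set (N.-tuple (n.-tuple R))) :
  mxmeas F -> measurable A ->
  measurable_fun [set: X] (fun x => iid (mvnormal (F x)) N A).
Proof.
move=> mF mA.
pose G (z : X * N.-tuple (n.-tuple R)) :=
  map_tuple (mulmx_tuple (chol (F z.1))) z.2.
have mG : measurable_fun [set: X * N.-tuple (n.-tuple R)] G.
  apply/measurable_fun_tnthP => u; apply/measurable_fun_tnthP => i.
  rewrite (_ : _ \o _ = fun z =>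
    \sum_j chol (F z.1) i j * tnth (tnth z.2 u) j); last first.
    by apply/funext => z /=; rewrite tnth_map tnth_mktuple.
  apply: measurable_sum => j; apply: measurable_funM.
    apply: (@measurableT_comp _ _ _ _ _ _ (fun x => chol (F x) i j)) => //.
    exact: measurable_chol.
  apply: (@measurableT_comp _ _ _ _ _ _ (@tnth _ R ^~ j)).
    exact: measurable_tnth.
  apply: (@measurableT_comp _ _ _ _ _ _ (@tnth _ (n.-tuple R) ^~ u)) => //.
  exact: measurable_tnth.
rewrite (_ : (fun _ => _) =
    iid (iid std_normal n) N \o xsection (G @^-1` A)); last first.
  apply/funext => x; rewrite /mvnormal iid_distribution//=.
  congr (iid _ _ _); apply/seteqP; split=> z; rewrite /xsection/= inE//.
apply: (@measurable_fun_xsection _ _ X _ R (iid (iid std_normal n) N)).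
by rewrite -[X in measurable X]setTI; exact: mG.
Qed.

End measurable_chol.

End gaussian.

Section spiked_wishart.
Context (R : realType) (k : nat).

Definition mx_of_rows m n (y : m.-tuple (n.-tuple R)) : 'M[R]_(m, n) :=
  \matrix_(i, j) tnth (tnth y i) j.

Definition spike n (U : n.-tuple (k.-tuple R)) : 'M[R]_n :=
  n%:R^-1 *: (mx_of_rows U *m (mx_of_rows U)^T).

(* I + beta X, where X is the spike if beta * spike > - I in the Loewner order
   and X = 0 otherwise. *)
Definition spiked_cov (beta : R) n (U : n.-tuple (k.-tuple R)) : 'M[R]_n :=
  1%:M + beta *: (if `[< posdef (beta *: spike U + 1%:M) >] then spike U else 0).

Lemma measurable_iid_spiked_cov (beta : R) n N
    (A : set (N.-tuple (n.-tuple R))) : measurable A ->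
  measurable_fun [set: n.-tuple (k.-tuple R)]
    (fun U => iid (mvnormal (spiked_cov beta U)) N A).
Proof.
apply: measurable_iid_mvnormal => i j.
have mspike i' j' :
    measurable_fun [set: n.-tuple (k.-tuple R)] (fun U => spike U i' j').
  rewrite (_ : (fun _ => _) = fun U : n.-tuple (k.-tuple R) =>
      n%:R^-1 * \sum_l tnth (tnth U i') l * tnth (tnth U j') l); last first.
    apply/funext => U; rewrite !mxE; congr (_ * _).
    by apply: eq_bigr => l _; rewrite !mxE.
  apply: measurable_funM => //; apply: measurable_sum => l.
  by apply: measurable_funM; apply: (@measurableT_comp _ _ _ _ _ _
    (@tnth _ R ^~ l)); exact: measurable_tnth.
rewrite (_ : (fun _ => _) = fun U => (1%:M : 'M[R]_n) i j + beta *
    (if `[< posdef (beta *: spike U + 1%:M) >] then spike U i j else 0)).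
  apply: measurable_funD => //; apply: measurable_funM => //.
  apply: measurable_fun_ifT => //; apply: measurable_asbool_posdef => [U|i' j'].
    by rewrite linearD/= linearZ/= linearZ/= trmx_mul trmxK tr_scalar_mx.
  rewrite (_ : (fun _ => _) = fun U => beta * spike U i' j'
    + (1%:M : 'M[R]_n) i' j'); last by apply/funext => U; rewrite !mxE.
  by apply: measurable_funD => //; exact: measurable_funM.
have E (B : 'M[R]_n) : (1%:M + beta *: B) i j = (1%:M : 'M[R]_n) i j + beta * B i j.
  by rewrite !mxE.
apply/funext => U; rewrite /spiked_cov E; congr (_ + _ * _).
by case: ifP => // _; rewrite mxE.
Qed.

Definition wishart_null n N : probability (N.-tuple (n.-tuple R)) R :=
  iid (mvnormal 1%:M) N.

(* Draw the n rows of U i.i.d. from prior, then y_1, ..., y_N i.i.d. from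
   N(0, spiked_cov beta U). *)
Definition wishart_planted (prior : probability (k.-tuple R) R) (beta : R) n N
    (A : set (N.-tuple (n.-tuple R))) : \bar R :=
  (\int[iid prior n]_U iid (mvnormal (spiked_cov beta U)) N A)%E.

Section wishart_planted_probability.
Context (prior : probability (k.-tuple R) R) (beta : R) (n N : nat).
Let P := @wishart_planted prior beta n N.

Let P0 : P set0 = 0%E.
Proof. by rewrite /P /wishart_planted integral0_eq// => U _; rewrite measure0. Qed.

Let P_ge0 A : (0 <= P A)%E.
Proof. exact: integral_ge0. Qed.

Let P_sigma_additive : semi_sigma_additive P.
Proof.
move=> F mF tF mUF.
rewrite [X in _ --> X](_ : _ = \sum_(i <oo) P (F i))%E.
  apply/cvg_closeP; split; last by rewrite closeE.
  by apply: is_cvg_nneseries => *; exact: P_ge0.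
rewrite /P /wishart_planted -integral_nneseries//; last first.
  by move=> i; exact: measurable_iid_spiked_cov.
by apply: eq_integral => U _; rewrite measure_semi_bigcup.
Qed.

HB.instance Definition _ := isMeasure.Build _ _ _ P P0 P_ge0 P_sigma_additive.

Let P_setT : P [set: _] = 1%E.
Proof.
transitivity (\int[iid prior n]_U cst 1 U)%E.
  by apply: eq_integral => U _; exact: probability_setT.
by rewrite integral_cst// mul1e; exact: probability_setT.
Qed.

HB.instance Definition _ := Measure_isProbability.Build _ _ _ P P_setT.

End wishart_planted_probability.

Definition likelihood_ratio (prior : probability (k.-tuple R) R) (beta : R) n N :
    N.-tuple (n.-tuple R) -> \bar R :=
  Radon_Nikodym (charge_of_finite_measure (@wishart_planted prior beta n N))
                (wishart_null n N).

End spiked_wishart.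
Arguments wishart_planted {R k} prior beta n N A.
Arguments likelihood_ratio {R k} prior beta n N y : rename.

Section low_degree.
Context (R : realType) (n N : nat).
Implicit Types (mu : {measure set (N.-tuple (n.-tuple R)) -> \bar R})
  (L : N.-tuple (n.-tuple R) -> \bar R) (p q : mpoly (N * n) R).

(* p as a function of the N * n coordinates of y. *)
Definition poly_fun p (y : N.-tuple (n.-tuple R)) : R :=
  meval (fun i => mxvec (mx_of_rows y) 0 i) p.

(* p is the orthogonal projection of L in L^2(mu) onto the polynomials of degree
   at most D (msize is 1 + the degree): L - p is orthogonal to all of them.
   This only involves the moments of L against polynomials, so it also makes
   sense when these are finite but L is not square integrable, as happens for
   the likelihood ratio when beta is large. *)
Definition is_low_degree_projection mu L (D : nat) p : Prop :=
  (msize p <= D.+1)%N /\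
  forall q, (msize q <= D.+1)%N ->
    let f y := ((L y - (poly_fun p y)%:E) * (poly_fun q y)%:E)%E in
    mu.-integrable [set: _] f /\ (\int[mu]_y f y = 0)%E.

End low_degree.

Section prior.
Context (R : realType) (k : nat).

Definition bounded_support (prior : probability (k.-tuple R) R) : Prop :=
  exists M : R, prior [set u | forall i, `|tnth u i| <= M] = 1%E.

Definition centered (prior : probability (k.-tuple R) R) : Prop :=
  forall i, ('E_prior[fun u : k.-tuple R => tnth u i] = 0)%E.

Definition cov_mx (prior : probability (k.-tuple R) R) : 'M[R]_k :=
  \matrix_(i, j) fine (covariance prior (fun u => tnth u i) (fun u => tnth u j)).

Definition l2norm (v : 'cV[R]_k) : R := Num.sqrt (\sum_i v i 0 ^+ 2).

Definition opnorm (A : 'M[R]_k) : R :=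
  sup [set l2norm (A *m v) | v in [set v | l2norm v <= 1]].

End prior.

(* Main.v *)
(**
Let H_c be the Hermite polynomial of a word c in the N n coordinates.  The
projection of L is the sum over words c of length at most D of
E_P[H_c] H_c / |c|!, and its squared norm is the sum of E_P[H_c]^2 / |c|!; only
the moments of P enter, so L need not be square integrable.

Stein's identity gives E H_c = beta^(|c|/2) E w_c for y of law N(0, 1 + beta X)
and w of law N(0, X), and both sides vanish when |c| is odd.  Averaging over two
replicas U, U' of the prior and summing over the words of length 2 d yields
(2 d - 1)!! beta^(2 d) E |B^T z|^(2 d), where z is standard Gaussian and B is N
diagonal copies of U^T U' / n.  Since B has squared Frobenius norm N |U^T U' / n|^2
and squared operator norm at most |U^T U' / n|^2, Stein's identity again bounds the
last expectation by N (N + 2) ... (N + 2 d - 2) |U^T U' / n|^(2 d).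

By a finite net of matrices G of norm at most 1 and
x^(2 d) <= (2 d)! s^(-2 d) (e^(s x) + e^(-s x)), the moment of |U^T U'| reduces to
the moment generating function of sum_i <u_i G, u'_i>.  As Cov(prior) has norm 1,
it is at most exp(n s^2 (1 + o(1)) / 2) as s -> 0.  The choice s^2 = 2 d / n,
small because D = o(n), makes the part of degree 2 d at most a constant times
d (beta^2 / gamma + o(1))^d, where the o(1) is arbitrarily small for a fine net
and n large; this is summable as beta^2 < gamma.
*)

Require Import Defs.
From HB Require Import structures.
From mathcomp Require Import all_boot all_order all_algebra.
From mathcomp Require mpoly.
Import -(notations) mpoly.
From mathcomp Require Import all_classical all_reals all_analysis.
From mathcomp Require Import measurable_realfun ring lra zify.

Set Implicit Arguments.
Unset Strict Implicit.
Unset Printing Implicit Defensive.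

Import Order.TTheory GRing.Theory Num.Theory.
Import numFieldNormedType.Exports.

Local Open Scope classical_set_scope.
Local Open Scope ring_scope.

(** * Hermite polynomials and the low-degree projection *)

(** Gaussian laws enter as linear functionals on polynomials, known only through Stein's identity
    and, where inequalities are integrated, positivity. This suits a [beta] of either sign, for
    which beta X may have no real square root, and a clipped spike that is only positive
    semidefinite. Clipping costs nothing: it can only replace the overlap of two replicas by 0.
    Measure theory serves to identify E_Q[L q] with E_P[q], which rests on the absolute continuity
    of P with respect to Q; that follows from the triangular shape and positive diagonal of Cholesky
    factors. The net linearizes |U^T U'|: the exponential of a linear form in U^T U' factors over
    rows, and the size of the net depends on k and on the mesh, not on n or d. The value s^2 = 2 d /
    n minimizes s^(-2 d) e^(n s^2 / 2); the minimum (e n / 2 d)^d meets (2 d - 1)!!, of order (2 d /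
    e)^d, so the exponential rates cancel, the weight 1 / (2 d)! cancels (2 d)!, and beta^2 N / n is
    left as the ratio. *)

Section words.
Context (I : finType).

(** Words replace multi-indices: a multi-index alpha of weight m is spelled by m! / alpha! words, so
    the factor 1 / m! restores the usual weights 1 / alpha!. Operators indexed by a coordinate then
    act by prepending a letter. *)
Fixpoint sum_words (V : nmodType) (m : nat) (F : seq I -> V) : V :=
  match m with
  | 0 => F [::]
  | m'.+1 => \sum_i sum_words m' (fun c => F (i :: c))
  end.

Lemma eq_sum_words (V : nmodType) m (F G : seq I -> V) :
  (forall c, size c = m -> F c = G c) -> sum_words m F = sum_words m G.
Proof.
elim: m => [|m IH] in F G * => FG /=; first exact: FG.
by apply: eq_bigr => i _; apply: IH => c sc; apply: FG; rewrite /= sc.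
Qed.

Lemma sum_words_morph (V W : nmodType) (f : V -> W) m (F : seq I -> V) :
  f 0 = 0 -> {morph f : x y / x + y} ->
  f (sum_words m F) = sum_words m (f \o F).
Proof.
move=> f0 fD; elim: m => [//|m IH] in F *.
by rewrite /= (big_morph f fD f0); apply: eq_bigr => i _; rewrite IH.
Qed.

Lemma sum_words_pow (R : comNzRingType) m (v : I -> R) :
  sum_words m (fun c => \prod_(i <- c) v i) = (\sum_i v i) ^+ m.
Proof.
elim: m => [|m IH] /=; first by rewrite big_nil.
rewrite exprS mulr_suml; apply: eq_bigr => i _; rewrite -IH.
rewrite (@sum_words_morph _ _ (fun x => v i * x)) ?mulr0//; last first.
  by move=> x y; rewrite mulrDr.
by apply: eq_sum_words => c _; rewrite /= big_cons.
Qed.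

End words.

Section hermite.
Context (R : realFieldType) (K : nat).
Local Notation poly := (mpoly K R).
Local Notation Xv i := (@mpolyX K R (mnm1 i)).
Implicit Types (p q : poly) (c : seq 'I_K) (S : 'M[R]_K).

Definition functional (W : poly -> R) : Prop :=
  forall a p q, W (a *: p + q) = a * W p + W q.

(* Stein's identity, which characterizes the moments of N(0, S). *)
Definition stein (S : 'M[R]_K) (W : poly -> R) : Prop :=
  forall i q, W (Xv i * q) = \sum_j S i j * W (mderiv j q).

Section functional_theory.
Context (W : poly -> R) (linW : functional W).

Lemma functional0 : W 0 = 0.
Proof.
have := linW 1 0 0; rewrite scaler0 add0r mul1r => /eqP.
by rewrite addrC -subr_eq subrr eq_sym => /eqP.
Qed.

Lemma functionalD : {morph W : p q / p + q}.
Proof. by move=> p q; rewrite -[p in LHS]scale1r linW mul1r. Qed.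

Lemma functionalZ a p : W (a *: p) = a * W p.
Proof. by rewrite -[a *: p]addr0 linW functional0 addr0. Qed.

Lemma functionalB : {morph W : p q / p - q}.
Proof. by move=> p q; rewrite functionalD -scaleN1r functionalZ mulN1r. Qed.

Lemma functional_sum (J : Type) (r : seq J) P (F : J -> poly) :
  W (\sum_(j <- r | P j) F j) = \sum_(j <- r | P j) W (F j).
Proof. exact: (big_morph W functionalD functional0). Qed.

Lemma functional_words (I : finType) m (F : seq I -> poly) :
  W (sum_words m F) = sum_words m (W \o F).
Proof. exact: (sum_words_morph m F functional0 functionalD). Qed.

End functional_theory.

(* The creation operator, adjoint to mderiv i for the standard Gaussian. *)
Definition creation (i : 'I_K) (q : poly) : poly := Xv i * q - mderiv i q.

(** A product of monic probabilists' Hermite polynomials, one per coordinate, of degree the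
    multiplicity of that letter in [c]. The order of the letters is immaterial because the creation
    operators commute. *)
Definition herm (c : seq 'I_K) : poly := foldr creation 1 c.

Definition monom (c : seq 'I_K) : poly := foldr (fun i q => Xv i * q) 1 c.

Lemma creationD i : {morph creation i : p q / p + q}.
Proof. by move=> p q; rewrite /creation mulrDr mderivD opprD addrACA. Qed.

Lemma creationZ i a q : creation i (a *: q) = a *: creation i q.
Proof. by rewrite /creation mderivZ -scalerAr scalerBr. Qed.

Lemma creation0 i : creation i 0 = 0.
Proof. by rewrite -[in LHS](scale0r (0 : poly)) creationZ scale0r. Qed.

Lemma creation_sum i (J : Type) (r : seq J) P (F : J -> poly) :
  creation i (\sum_(j <- r | P j) F j) = \sum_(j <- r | P j) creation i (F j).
Proof. exact: (big_morph _ (creationD i) (creation0 i)). Qed.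

Lemma mderiv1 j : mderiv j (1 : poly) = 0.
Proof. by rewrite -mpolyC1 mderivC. Qed.

Lemma mderiv_sum j (J : Type) (r : seq J) P (F : J -> poly) :
  mderiv j (\sum_(i <- r | P i) F i) = \sum_(i <- r | P i) mderiv j (F i).
Proof. exact: (big_morph _ (mderivD j) (mderiv0 _ j)). Qed.

Lemma mderivXU i j : mderiv j (Xv i) = (i == j)%:R :> poly.
Proof.
rewrite mderivX mnm1E; case: eqP => [->|_]; last by rewrite scale0r.
by rewrite scale1r -[X in mnm_sub X](add0m (mnm1 j)) addmK mpolyX0.
Qed.

(** The canonical commutation relation between annihilation and creation operators. *)
Lemma mderiv_creation i j q :
  mderiv j (creation i q) = (i == j)%:R * q + creation i (mderiv j q).
Proof.
by rewrite /creation mderivB mderivM mderivXU mderiv_comm addrA.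
Qed.

Lemma msize_mderiv j q D : (msize q <= D.+1)%N -> (msize (mderiv j q) <= D)%N.
Proof.
move=> sq; rewrite msizeE; apply/bigmax_leqP_seq => m + _.
rewrite mcoeff_msupp mcoeff_mderiv => nz.
have : mnm_add m (mnm1 j) \in msupp q.
  by rewrite mcoeff_msupp; apply: contra nz => /eqP->; rewrite mul0rn.
move=> /msize_mdeg_lt; rewrite mdegD mdeg1 addn1 => h.
by rewrite -ltnS (leq_trans h).
Qed.

Lemma msize_creation i q D : (msize q <= D)%N -> (msize (creation i q) <= D.+1)%N.
Proof.
move=> sq; apply: (leq_trans (mmeasureD_le _ _ _)); rewrite mmeasureN geq_max.
apply/andP; split.
  have [->|q0] := eqVneq q 0; first by rewrite mulr0 msize0.
  by rewrite msizeM ?msizeX ?mdeg1//= -(mmeasure_poly_eq0 mdeg) msizeX.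
by apply: msize_mderiv; rewrite (leq_trans sq)// ltnW.
Qed.

Lemma msize_herm c : (msize (herm c) <= (size c).+1)%N.
Proof.
by elim: c => [|i c IH] /=; [rewrite msize1|exact: msize_creation].
Qed.

(** In characteristic zero a monomial that contains the variable j keeps a nonzero coefficient under
    [mderiv j]. *)
Lemma mderiv_eq0 q : (forall j, mderiv j q = 0) -> exists a, q = mpolyC K a.
Proof.
move=> dq; exists (mcoeff (mnm0 (n:=K)) q); apply: msize1_polyC.
rewrite msizeE; apply/bigmax_leqP_seq => m mq _.
rewrite ltnS leqn0 mdeg_eq0; apply/eqP/mnmP => j; rewrite mnm0E.
apply/eqP/negPn/negP => mj; move: mq; rewrite mcoeff_msupp => /negP; apply.
have /(congr1 (mcoeff (mnm_sub m (mnm1 j)))) := dq j.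
rewrite mcoeff_mderiv mcoeff0 => /eqP; rewrite mulrn_eq0/=.
by rewrite submK//; rewrite lep1mP.
Qed.

End hermite.

Section hermite_expansion.
Context (R : realFieldType) (K : nat).
Local Notation poly := (mpoly K R).
Local Notation Xv i := (@mpolyX K R (mnm1 i)).
Local Notation herm := (@herm R K).
Local Notation monom := (@monom R K).
Implicit Types (p q : poly) (c : seq 'I_K) (S : 'M[R]_K).

Section standard.
Context (W : poly -> R) (linW : functional W) (W1 : W 1 = 1).
Context (stW : stein 1%:M W).

Lemma stein1E i q : W (Xv i * q) = W (mderiv i q).
Proof.
rewrite stW (bigD1 i)//= mxE eqxx mul1r big1 ?addr0// => j ji.
by rewrite mxE eq_sym (negbTE ji) mul0r.
Qed.

Lemma functional_creation i q : W (creation i q) = 0.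
Proof. by rewrite functionalB// stein1E subrr. Qed.

Lemma creation_adj i p q : W (creation i p * q) = W (p * mderiv i q).
Proof.
rewrite /creation mulrBl -mulrA functionalB// stein1E mderivM.
by rewrite functionalD// addrAC subrr add0r.
Qed.

(** The candidate for the component of [q] in the m-th Wiener chaos; [comp_sum] shows that these
    components add up to [q]. *)
Let comp m q : poly :=
  m`!%:R^-1 *: sum_words m (fun c => W (herm c * q) *: herm c).

(** The first letter of the word is split off, and its creation operator is moved onto [q] as a
    derivative by [creation_adj]. *)
Let compS m q : comp m.+1 q =
  m.+1%:R^-1 *: \sum_i creation i (comp m (mderiv i q)).
Proof.
rewrite /comp factS natrM invfM -scalerA; congr (_ *: _).
rewrite scaler_sumr; apply: eq_bigr => i _.
rewrite creationZ; congr (_ *: _).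
rewrite (@sum_words_morph _ _ _ (creation i)) ?creation0//; last first.
  exact: creationD.
by apply: eq_sum_words => c _; rewrite /= creationZ creation_adj.
Qed.

Let mderiv_comp j m q : mderiv j (comp m.+1 q) = comp m (mderiv j q).
Proof.
elim: m => [|m IH] in j q *; rewrite compS mderivZ mderiv_sum.
  rewrite invr1 scale1r (bigD1 j)//= big1 ?addr0.
    rewrite mderiv_creation eqxx mul1r /comp /= mderivZ mderivZ mderiv1.
    by rewrite !scaler0 creation0 addr0.
  move=> i ij; rewrite mderiv_creation (negbTE ij) mul0r /comp /= 2!mderivZ.
  by rewrite mderiv1 !scaler0 creation0 addr0.
under eq_bigr do rewrite mderiv_creation IH mderiv_comm.
rewrite big_split/= (bigD1 j)//= big1 ?addr0; last first.
  by move=> i ij; rewrite (negbTE ij) mul0r.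
rewrite eqxx mul1r.
(* The number operator multiplies the component of degree m + 1 by m + 1. With the commutator term
   the factor becomes m + 2, which cancels the weight in [compS]. *)
have -> : \sum_i creation i (comp m (mderiv i (mderiv j q))) =
   m.+1%:R *: comp m.+1 (mderiv j q).
  by rewrite compS scalerA mulfV ?pnatr_eq0// scale1r.
rewrite -{1}[comp m.+1 _]scale1r -scalerDl scalerA nat1r.
by rewrite mulVf ?scale1r// pnatr_eq0.
Qed.

Let functional_comp m q : W (comp m.+1 q) = 0.
Proof.
rewrite compS functionalZ// functional_sum// big1 ?mulr0// => i _.
exact: functional_creation.
Qed.

(** By induction on the degree: differentiation lowers the chaos by one, so all derivatives of the
    difference of the two sides vanish. The difference is thus a constant, and its mean is 0. *)
Let comp_sum D q : (msize q <= D.+1)%N -> \sum_(m < D.+1) comp m q = q.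
Proof.
have c0 q' : comp 0 q' = W q' *: 1.
  by rewrite /comp /= invr1 scale1r mul1r.
have EC a : mpolyC K a = a *: 1 :> poly by rewrite -mul_mpolyC mulr1.
elim: D => [|D IH] in q *.
  by move/msize1_polyC ->; rewrite big_ord1 c0 EC functionalZ// W1 mulr1.
move=> sq; apply/eqP; rewrite -subr_eq0; apply/eqP.
have /mderiv_eq0[a Ea] j : mderiv j (\sum_(m < D.+2) comp m q - q) = 0.
  rewrite mderivB mderiv_sum big_ord_recl c0 mderivZ mderiv1 scaler0 add0r.
  under eq_bigr do rewrite mderiv_comp.
  by rewrite IH ?subrr// msize_mderiv.
have : W (\sum_(m < D.+2) comp m q - q) = 0.
  rewrite functionalB// functional_sum// big_ord_recl c0 functionalZ// W1 mulr1.
  by rewrite big1 ?addr0 ?subrr// => i _; exact: functional_comp.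
by rewrite Ea EC functionalZ// W1 mulr1 => ->; rewrite scale0r.
Qed.

Definition low_degree_part (l : poly -> R) (D : nat) : poly :=
  \sum_(m < D.+1) m`!%:R^-1 *: sum_words m (fun c => l (herm c) *: herm c).

Lemma msize_low_degree_part l D : (msize (low_degree_part l D) <= D.+1)%N.
Proof.
have szD p q B : (msize p <= B)%N -> (msize q <= B)%N -> (msize (p + q) <= B)%N.
  by move=> pB qB; rewrite (leq_trans (mmeasureD_le _ _ _))// geq_max pB.
rewrite /low_degree_part; elim/big_ind: _ => [||m _]; first by rewrite msize0.
  by move=> p q; exact: szD.
apply: (leq_trans (msizeZ_le _ _)); apply: (@leq_trans m.+1) => //.
(* The recursion of [sum_words] fixes letters from the front, so the claim is generalized to words
   with a given prefix [d]. *)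
suff : forall (d : seq 'I_K) (F : seq 'I_K -> R) r, (size d + r = m)%N ->
   (msize (sum_words r (fun c => F c *: herm (d ++ c))) <= m.+1)%N.
  by move=> /(_ [::] _ m (add0n _)).
move=> d F r; elim: r => [|r IH] in d F *.
  move=> sd /=; rewrite (leq_trans (msizeZ_le _ _))// (leq_trans (msize_herm _ _))//.
  by rewrite cats0 -sd addn0.
move=> sd /=; elim/big_ind: _ => [||i _]; first by rewrite msize0.
  by move=> p q; exact: szD.
under eq_sum_words do rewrite -cat_rcons.
by apply: IH; rewrite size_rcons addSnnS.
Qed.

(** Once [q] is expanded by [comp_sum], both sides are the sum over words of l(H_c) W(H_c q) / |c|!.
    So [low_degree_part] represents the functional [l] on polynomials of degree at most [D]. *)
Lemma low_degree_partP l D q : functional l -> (msize q <= D.+1)%N ->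
  W (low_degree_part l D * q) = l q.
Proof.
move=> linl sq; rewrite -[in RHS](comp_sum sq) functional_sum//.
rewrite mulr_suml functional_sum//; apply: eq_bigr => m _.
rewrite -scalerAl !functionalZ// functional_words//; congr (_ * _).
rewrite (@sum_words_morph _ _ _ (fun x => x * q)) ?mul0r//; last first.
  by move=> x y; rewrite mulrDl.
rewrite functional_words//; apply: eq_sum_words => c _ /=.
by rewrite -scalerAl !functionalZ// mulrC.
Qed.

(** The representation property applied to the polynomial itself turns its square into the value of
    [l] on it. *)
Lemma low_degree_part_sqr l D : functional l ->
  W (low_degree_part l D * low_degree_part l D) =
  \sum_(m < D.+1) m`!%:R^-1 * sum_words m (fun c => l (herm c) ^+ 2).
Proof.
move=> linl; rewrite low_degree_partP ?msize_low_degree_part//.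
rewrite /low_degree_part functional_sum//; apply: eq_bigr => m _.
rewrite functionalZ// functional_words//; congr (_ * _).
by apply: eq_sum_words => c _ /=; rewrite functionalZ// expr2.
Qed.

End standard.

(* rem_words j c lists the words obtained by deleting one letter j of c, so
   that differentiating a product over c sums over them. *)
Fixpoint rem_words (j : 'I_K) (c : seq 'I_K) : seq (seq 'I_K) :=
  match c with
  | [::] => [::]
  | i :: c' => (if i == j then [:: c'] else [::]) ++
               [seq i :: d | d <- rem_words j c']
  end.

Lemma size_rem_words j c d : d \in rem_words j c -> size c = (size d).+1.
Proof.
elim: c => [//|i c IH] in d *; rewrite /= mem_cat => /orP[|/mapP[e /IH -> -> //]].
by case: ifP => // _; rewrite inE => /eqP->.
Qed.

Lemma mderiv_monom j c : mderiv j (monom c) = \sum_(d <- rem_words j c) monom d.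
Proof.
elim: c => [|i c IH] /=; first by rewrite mderiv1 big_nil.
rewrite mderivM IH mderivXU big_cat big_map/= mulr_sumr; congr (_ + _).
by case: ifP => _; rewrite ?big_seq1 ?big_nil ?mul1r ?mul0r.
Qed.

Lemma mderiv_herm j c : mderiv j (herm c) = \sum_(d <- rem_words j c) herm d.
Proof.
elim: c => [|i c IH] /=; first by rewrite mderiv1 big_nil.
rewrite mderiv_creation IH big_cat big_map/= creation_sum; congr (_ + _).
by case: ifP => _; rewrite ?big_seq1 ?big_nil ?mul1r ?mul0r.
Qed.

(** Stands for b^(m / 2) without a square root, since [b] may be negative; the value 0 at odd [m]
    matches the vanishing odd moments. *)
Definition half_power (b : R) (m : nat) : R := if odd m then 0 else b ^+ m./2.

(* Formally E[H_c(y)] = E[w_c] for w = y + sqrt(-1) z with z standard normal, a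
   centered Gaussian vector of covariance S - 1 = b S'. *)
Lemma functional_herm (b : R) (S S' : 'M[R]_K) (W W' : poly -> R) c :
  functional W -> W 1 = 1 -> stein S W ->
  functional W' -> W' 1 = 1 -> stein S' W' ->
  S = 1%:M + b *: S' ->
  W (herm c) = half_power b (size c) * W' (monom c).
Proof.
move=> linW W1 stW linW' W'1 stW' SS'.
have [m] := ubnP (size c); elim: m c => // m IH [_|i c /=].
  by rewrite /= W1 W'1 mul1r.
rewrite ltnS => cm; rewrite functionalB// stW stW'.
(* The derivative in the creation operator is Stein's sum for the identity covariance. Subtracting
   it leaves S - 1 = b S', hence one factor [b] for each two letters removed. *)
have -> : W (mderiv i (herm c)) =
    \sum_j (1%:M : 'M[R]_K) i j * W (mderiv j (herm c)).
  rewrite (bigD1 i)//= mxE eqxx mul1r big1 ?addr0// => j ji.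
  by rewrite mxE eq_sym (negbTE ji) mul0r.
rewrite -sumrB mulr_sumr; apply: eq_bigr => j _.
rewrite -mulrBl SS' mxE addrAC subrr add0r mxE.
rewrite mderiv_herm mderiv_monom !functional_sum// !mulr_sumr.
apply: eq_big_seq => d /size_rem_words sc; rewrite IH; last first.
  by rewrite -ltnS -sc ltnS ltnW.
rewrite sc /half_power /= negbK; case: ifP => _; first by rewrite !mul0r mulr0.
by rewrite exprS; ring.
Qed.

End hermite_expansion.

(** * Decoupling the moments of Gaussian vectors *)

Section linear_change.
Context (R : realFieldType) (L K : nat).
Local Notation Xv i := (@mpolyX _ R (mnm1 i)).
Implicit Types (A : 'M[R]_(L, K)) (p q : mpoly K R).

Definition linear_form M (a : 'I_M -> R) : mpoly M R := \sum_l a l *: Xv l.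

Definition linear_subst A p : mpoly L R :=
  comp_mpoly [tuple linear_form (A ^~ i) | i < K] p.

Lemma meval_linear_form M (a v : 'I_M -> R) :
  meval v (linear_form a) = \sum_l a l * v l.
Proof.
rewrite /linear_form raddf_sum; apply: eq_bigr => l _.
by rewrite /= mevalZ mevalXU.
Qed.

Lemma mderiv_linear_form M (a : 'I_M -> R) l :
  mderiv l (linear_form a) = mpolyC M (a l).
Proof.
rewrite mderiv_sum (bigD1 l)//= mderivZ mderivXU eqxx big1 ?addr0.
  by rewrite -mul_mpolyC mulr1.
by move=> j jl; rewrite mderivZ mderivXU (negbTE jl) scaler0.
Qed.

Lemma linear_substX A i : linear_subst A (Xv i) = linear_form (A ^~ i).
Proof. by rewrite /linear_subst comp_mpolyXU -tnth_nth tnth_mktuple. Qed.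

Lemma linear_substM A : {morph linear_subst A : p q / p * q}.
Proof. by move=> p q; rewrite /linear_subst rmorphM. Qed.

Lemma linear_substD A : {morph linear_subst A : p q / p + q}.
Proof. by move=> p q; rewrite /linear_subst comp_mpolyD. Qed.

Lemma linear_substZ A a p : linear_subst A (a *: p) = a *: linear_subst A p.
Proof. by rewrite /linear_subst comp_mpolyZ. Qed.

Lemma linear_subst1 A : linear_subst A 1 = 1.
Proof. by rewrite /linear_subst comp_mpoly1. Qed.

Lemma meval_linear_subst A p (v : 'rV[R]_L) :
  meval (v 0) (linear_subst A p) = meval ((v *m A) 0) p.
Proof.
rewrite /linear_subst comp_mpoly_meval; apply: meval_eq => i.
rewrite tnth_mktuple meval_linear_form mxE; apply: eq_bigr => l _.
by rewrite mulrC.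
Qed.

(** An induction principle adapted to Stein's identity, which controls multiplication by one
    variable. *)
Lemma mpoly_ind_alg (P : mpoly K R -> Prop) : P 1 ->
  (forall a p q, P p -> P q -> P (a *: p + q)) ->
  (forall i q, P q -> P (Xv i * q)) -> forall p, P p.
Proof.
move=> P1 Plin PX; have P0 : P 0 by have := Plin (-1) 1 1 P1 P1; rewrite scaleN1r addNr.
elim/mpolyind => // c m p _ _ Pp; apply: (Plin) => //.
have [n] := ubnP (mdeg m); elim: n m => // n IH m mn.
have [->|m0] := eqVneq m (mnm0 (n:=K)); first by rewrite mpolyX0.
have /existsP[i mi] : [exists i, m i != 0%N].
  rewrite -negb_forall; apply: contra m0 => /forallP m0.
  by apply/eqP/mnmP => i; rewrite mnm0E; apply/eqP.
have mE : m = mnm_add (mnm1 i) (mnm_sub m (mnm1 i)).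
  by rewrite addmC submK// lep1mP.
rewrite mE mpolyXD; apply: PX; apply: IH.
by move: mn; rewrite {1}mE mdegD mdeg1 add1n ltnS.
Qed.

Lemma mderiv_linear_subst A l p : mderiv l (linear_subst A p) =
  \sum_i A l i *: linear_subst A (mderiv i p).
Proof.
elim/mpoly_ind_alg: p => [|a p q IHp IHq|j q IHq].
- rewrite linear_subst1 mderiv1 big1// => i _.
  by rewrite mderiv1 -[0 in LHS](scale0r 0) linear_substZ scale0r scaler0.
- rewrite linear_substD linear_substZ mderivD mderivZ IHp IHq scaler_sumr.
  rewrite -big_split; apply: eq_bigr => i _/=.
  by rewrite mderivD mderivZ linear_substD linear_substZ scalerDr !scalerA mulrC.
rewrite linear_substM mderivM IHq linear_substX mderiv_linear_form.
rewrite mul_mpolyC mulr_sumr.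
under [RHS]eq_bigr do rewrite mderivM linear_substD scalerDr linear_substM.
rewrite big_split/=; congr (_ + _).
  rewrite (bigD1 j)//= mderivXU eqxx mul1r big1 ?addr0//.
  move=> i ij; rewrite mderivXU eq_sym (negbTE ij).
  by rewrite mul0r -[0 in LHS](scale0r 0) linear_substZ scale0r scaler0.
by apply: eq_bigr => i _; rewrite linear_substX scalerAr.
Qed.

Context (W : mpoly L R -> R) (linW : functional W) (stW : stein 1%:M W).

Lemma functional_linear_subst A : functional (W \o linear_subst A).
Proof. by move=> a p q /=; rewrite linear_substD linear_substZ linW. Qed.

(** For a standard Gaussian row vector z, the vector z A has covariance A^T A; the chain rule
    carries Stein's identity from z to z A. *)
Lemma stein_linear_subst A : stein (A^T *m A) (W \o linear_subst A).
Proof.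
move=> i q /=; rewrite linear_substM linear_substX /linear_form mulr_suml.
rewrite functional_sum//.
under [LHS]eq_bigr do rewrite -scalerAl functionalZ// stein1E// mderiv_linear_subst
  functional_sum// mulr_sumr.
rewrite exchange_big; apply: eq_bigr => j _ /=; rewrite mxE mulr_suml.
by apply: eq_bigr => l _; rewrite functionalZ// mxE mulrA.
Qed.

End linear_change.

(** The double factorial (2 d - 1)!!, the moment of order 2 d of a standard normal variable. *)
Definition odd_fact d : nat := \prod_(j < d) (2 * j).+1.

Section gaussian_moments.
Context (R : realFieldType) (L : nat).
Local Notation Xv i := (@mpolyX L R (mnm1 i)).
Implicit Types (p q : mpoly L R) (B C : 'M[R]_L).

(** The squared Frobenius norm, hence the squared Euclidean norm of a row vector. *)
Definition norm2 m n (A : 'M[R]_(m, n)) : R := \sum_i \sum_j A i j ^+ 2.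

Lemma norm2_ge0 m n (A : 'M[R]_(m, n)) : 0 <= norm2 A.
Proof. by apply: sumr_ge0 => i _; apply: sumr_ge0 => j _; exact: sqr_ge0. Qed.

Lemma norm2_tr m n (A : 'M[R]_(m, n)) : norm2 A = \tr (A *m A^T).
Proof.
apply: eq_bigr => i _; rewrite mxE; apply: eq_bigr => j _.
by rewrite mxE expr2.
Qed.

(** Positivity supplements Stein's identity so that pointwise inequalities between polynomials can
    be integrated. It also lets polynomials be compared as functions instead of formally. *)
Definition standard_gaussian (W : mpoly L R -> R) : Prop :=
  [/\ functional W, W 1 = 1, stein 1%:M W &
      forall p, (forall v : 'rV[R]_L, 0 <= meval (v 0) p) -> 0 <= W p].

Context (W : mpoly L R -> R) (gW : standard_gaussian W).
Let linW : functional W. Proof. by case: gW. Qed.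
Let W1 : W 1 = 1. Proof. by case: gW. Qed.
Let stW : stein 1%:M W. Proof. by case: gW. Qed.

Lemma gaussian_le p q :
  (forall v : 'rV[R]_L, meval (v 0) p <= meval (v 0) q) -> W p <= W q.
Proof.
move=> pq; rewrite -subr_ge0 -functionalB//; case: gW => _ _ _; apply=> v.
by rewrite mevalB subr_ge0.
Qed.

Lemma gaussian_eq p q :
  (forall v : 'rV[R]_L, meval (v 0) p = meval (v 0) q) -> W p = W q.
Proof.
by move=> pq; apply/eqP; rewrite eq_le !gaussian_le// => v; rewrite pq.
Qed.

Lemma mderiv_exp l p n :
  mderiv l (p ^+ n.+1) = n.+1%:R *: (p ^+ n * mderiv l p).
Proof.
elim: n => [|n IH]; first by rewrite expr1 expr0 mul1r scale1r.
rewrite exprS mderivM IH -scalerAr mulrA -exprS mulrC.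
by rewrite -[n.+2%:R]nat1r scalerDl scale1r.
Qed.

(** Stein's identity on one of the 2 d + 2 factors differentiates the other 2 d + 1, each of which
    yields the variance. *)
Lemma linear_form_moment (a : 'I_L -> R) d :
  W (linear_form a ^+ (2 * d)) = (odd_fact d)%:R * (\sum_l a l ^+ 2) ^+ d.
Proof.
elim: d => [|d IH]; first by rewrite /odd_fact big_ord0 !expr0 W1 mulr1.
have -> : (2 * d.+1 = (2 * d).+2)%N by rewrite mulnS.
rewrite exprS {1}/linear_form mulr_suml functional_sum//.
under [LHS]eq_bigr do rewrite -scalerAl functionalZ// stein1E// mderiv_exp
  mderiv_linear_form functionalZ// [_ * mpolyC _ _]mulrC mul_mpolyC
  functionalZ// IH.
rewrite /odd_fact big_ord_recr/= natrM exprSr mulr_sumr mulr_sumr.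
by apply: eq_bigr => l _; ring.
Qed.

Definition square_form B : mpoly L R := \sum_j linear_form (B ^~ j) ^+ 2.

Lemma meval_square_form B (v : 'rV[R]_L) :
  meval (v 0) (square_form B) = norm2 (v *m B).
Proof.
rewrite /square_form raddf_sum /norm2 big_ord1; apply: eq_bigr => j _ /=.
rewrite rmorphXn/= meval_linear_form mxE; congr (_ ^+ 2).
by apply: eq_bigr => l _; rewrite mulrC.
Qed.

(** For Q = |z B|^2, Stein's identity gives E Q^(d+1) = tr(B B^T) E Q^d + 2 d
    E[Q^(d-1) |z B B^T|^2]. The two hypotheses bound the terms by N t E Q^d and 2 d t E Q^d. *)
Lemma square_form_moment B (t : R) (N d : nat) :
  norm2 B <= N%:R * t ->
  (forall v : 'rV[R]_L, norm2 (v *m B *m B^T) <= t * norm2 (v *m B)) ->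
  0 <= t ->
  W (square_form B ^+ d) <= (\prod_(j < d) (N + 2 * j))%:R * t ^+ d.
Proof.
move=> trB Bt t0.
pose xi l : mpoly L R := linear_form ((B *m B^T) l).
have sE : square_form B = \sum_l Xv l * xi l.
  rewrite /square_form.
  under eq_bigr do rewrite expr2 {1}/linear_form mulr_suml.
  rewrite exchange_big; apply: eq_bigr => l _ /=.
  under eq_bigr do rewrite -scalerAl scalerAr.
  rewrite -mulr_sumr; congr (_ * _).
  rewrite /xi /linear_form; under eq_bigr do rewrite scaler_sumr.
  rewrite exchange_big; apply: eq_bigr => m _ /=.
  under eq_bigr do rewrite scalerA; rewrite -scaler_suml; congr (_ *: _).
  by rewrite mxE; apply: eq_bigr => j _; rewrite !mxE.
have dE l : mderiv l (square_form B) = 2%:R *: xi l.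
  rewrite /square_form mderiv_sum.
  under eq_bigr do rewrite mderiv_exp expr1 mderiv_linear_form mulrC mul_mpolyC.
  rewrite -scaler_sumr; congr (_ *: _).
  rewrite /xi /linear_form; under eq_bigr do rewrite scaler_sumr.
  rewrite exchange_big; apply: eq_bigr => m _ /=.
  under eq_bigr do rewrite scalerA; rewrite -scaler_suml; congr (_ *: _).
  by rewrite mxE; apply: eq_bigr => j _; rewrite !mxE.
have Q0 v : 0 <= meval (fun i => (v : 'rV[R]_L) 0 i) (square_form B).
  by rewrite meval_square_form norm2_ge0.
have WQ0 e : 0 <= W (square_form B ^+ e).
  by case: gW => _ _ _; apply => v; rewrite rmorphXn/= exprn_ge0 ?Q0.
elim: d => [|d IH]; first by rewrite big_ord0 !expr0 W1 mulr1.
have step : W (square_form B ^+ d.+1) <=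
    (N + 2 * d)%:R * t * W (square_form B ^+ d).
  rewrite exprS {1}sE mulr_suml functional_sum//.
  under eq_bigr => l _ do rewrite -mulrA stein1E// mderivM functionalD//
    mderiv_linear_form mul_mpolyC functionalZ//.
  rewrite big_split/= -mulr_suml.
  have -> : \sum_l (B *m B^T) l l = norm2 B by rewrite norm2_tr.
  rewrite natrD -mulrA mulrDl; apply: lerD.
    by rewrite mulrA ler_wpM2r.
  case: d {IH} => [|d].
    rewrite muln0 mul0r expr0 big1// => l _.
    by rewrite mderiv1 mulr0 functional0.
  under eq_bigr do rewrite mderiv_exp dE -scalerAr -scalerAr -scalerAr
    !(functionalZ linW).
  rewrite -mulr_sumr -mulr_sumr mulrA natrM [2%:R * _]mulrC -[leRHS]mulrA.
  rewrite -[leLHS]mulrA ler_wpM2l// ler_wpM2l//.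
  rewrite -functional_sum// -functionalZ//; apply: gaussian_le => v.
  rewrite [leLHS](_ : _ = meval (v 0) (square_form B ^+ d) *
      norm2 (v *m B *m B^T)).
    rewrite mevalZ exprSr rmorphM/= meval_square_form mulrCA ler_wpM2l//.
    by rewrite rmorphXn/= exprn_ge0 ?Q0.
  rewrite raddf_sum/=.
  rewrite /norm2 big_ord1 mulr_sumr; apply: eq_bigr => l _.
  rewrite !rmorphM/= mulrCA -expr2; congr (_ * _ ^+ 2).
  rewrite meval_linear_form -mulmxA mxE; apply: eq_bigr => j _.
  rewrite mulrC; congr (_ * _).
  by rewrite !mxE; apply: eq_bigr => i _; rewrite !mxE mulrC.
apply: (le_trans step); rewrite big_ord_recr/= natrM exprSr.
rewrite [leLHS]mulrC [leRHS](_ : _ = (\prod_(i < d) (N + 2 * i))%:R * t ^+ d *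
  ((N + 2 * d)%:R * t)); last by ring.
by rewrite ler_wpM2r// mulr_ge0.
Qed.

End gaussian_moments.

Section decoupling.
Context (R : realFieldType) (L K : nat) (W : mpoly L R -> R).
Context (gW : standard_gaussian W).
Implicit Types A : 'M[R]_(L, K).

Lemma linear_subst_monom A (c : seq 'I_K) :
  linear_subst A (monom R c) = \prod_(i <- c) linear_form (A ^~ i).
Proof.
elim: c => [|i c IH]; first by rewrite big_nil /= linear_subst1.
by rewrite /= linear_substM linear_substX IH big_cons.
Qed.

(** The sum over words of the products of coordinates of z A and z' A' is <z B, z'>^(2 d).
    Integrating z' and then z gives (2 d - 1)!! E |z B|^(2 d), to which [square_form_moment]
    applies. *)
Lemma gaussian_words A A' d (t : R) (N : nat) :
  let B := A *m A'^T in
  norm2 B <= N%:R * t ->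
  (forall v : 'rV[R]_L, norm2 (v *m B *m B^T) <= t * norm2 (v *m B)) ->
  0 <= t ->
  sum_words (2 * d) (fun c => W (linear_subst A (monom R c)) *
                              W (linear_subst A' (monom R c)))
  <= (odd_fact d)%:R * ((\prod_(j < d) (N + 2 * j))%:R * t ^+ d).
Proof.
move=> B trB Bt t0; have [linW W1 stW _] := gW.
pose P := sum_words (2 * d) (fun c => W (linear_subst A' (monom R c)) *:
  linear_subst A (monom R c)).
have -> : sum_words (2 * d) (fun c => W (linear_subst A (monom R c)) *
    W (linear_subst A' (monom R c))) = W P.
  rewrite /P (functional_words linW); apply: eq_sum_words => c _.
  by rewrite /= (functionalZ linW) mulrC.
(* With z frozen at a point [v], the integral over z' is a moment of a single linear form of
   variance |v B|^2. *)
have -> : W P = W ((odd_fact d)%:R *: square_form B ^+ d).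
  apply: (gaussian_eq gW) => v; rewrite /P (@sum_words_morph _ _ _ (meval (v 0)))
    ?meval0//; last exact: mevalD.
  transitivity (W (linear_form (fun l => (v *m B) 0 l) ^+ (2 * d))); last first.
    rewrite (linear_form_moment gW) mevalZ rmorphXn/= meval_square_form.
    by rewrite /norm2 big_ord1.
  have -> : linear_form (fun l => (v *m B) 0 l) =
      \sum_i (v *m A) 0 i *: linear_form (A' ^~ i).
    rewrite /linear_form; under [RHS]eq_bigr do rewrite scaler_sumr.
    rewrite exchange_big; apply: eq_bigr => l _ /=.
    under [RHS]eq_bigr do rewrite scalerA; rewrite -scaler_suml; congr (_ *: _).
    by rewrite /B mulmxA mxE; apply: eq_bigr => j _; rewrite [A'^T _ _]mxE.
  rewrite -sum_words_pow (functional_words linW); apply: eq_sum_words => c _ /=.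
  rewrite mevalZ meval_linear_subst linear_subst_monom.
  have -> : meval ((v *m A) 0) (monom R c) = \prod_(i <- c) (v *m A) 0 i.
    elim: c => [|i c IH]; first by rewrite big_nil /= meval1.
    by rewrite /= mevalM mevalXU IH big_cons.
  rewrite scaler_prod (functionalZ linW) mulrC; congr (_ * W _).
by rewrite (functionalZ linW) ler_wpM2l// (square_form_moment gW).
Qed.

End decoupling.

(** * Moments and null sets of Gaussian measures *)

Section normal_moments.
Context (R : realType).
Local Notation mu := (@lebesgue_measure R).
Local Notation pdf := (normal_pdf (0 : R) 1).
Implicit Types (a : nat) (x : R).

Lemma std_normal_pdfE x : pdf x = normal_peak 1 * expR (- (x ^+ 2) / 2).
Proof.
rewrite normal_pdfE ?oner_neq0// /normal_fun subr0 expr1n.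
by rewrite -[1 *+ 2]/(2%:R : R) mulNr.
Qed.

Lemma is_derive_normal_pdf x : is_derive x 1 pdf (- (x * pdf x)).
Proof.
rewrite (_ : pdf = fun x => normal_peak 1 * expR (- (x ^+ 2) / 2)); last first.
  by apply/funext => y; rewrite std_normal_pdfE.
have dsq : is_derive x 1 (fun x : R => - (x ^+ 2) / 2) (- x).
  apply: is_derive_eq; rewrite ?expr1 /GRing.scale /=; lra.
apply: is_derive_eq; rewrite /GRing.scale /=; ring.
Qed.

Lemma is_derive_monom_pdf a x : is_derive x 1 (fun y => y ^+ a * pdf y)
  (a%:R * x ^+ a.-1 * pdf x - x ^+ a.+1 * pdf x).
Proof.
have dp := is_derive_normal_pdf x.
case: a => [|a].
  rewrite (_ : (fun _ => _) = pdf); last by apply/funext => y; rewrite expr0 mul1r.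
  by apply: is_derive_eq; rewrite mul0r mul0r sub0r expr1.
have dX : is_derive x 1 (fun y : R => y ^+ a.+1) (a.+1%:R * x ^+ a).
  have := is_deriveX a.+1 (is_derive_id x (1 : R)).
  by rewrite exprfctE /GRing.scale /= mulr1.
apply: (@is_derive_eq _ _ _ _ _ _ _ _ (is_deriveM dX dp)).
by rewrite /GRing.scale /= !exprS; ring.
Qed.

Lemma normr_pow_le_expR a x : `|x| ^+ a <= a`!%:R * (expR x + expR (- x)).
Proof.
have h : `|x| ^+ a <= a`!%:R * expR `|x|.
  rewrite mulrC -ler_pdivrMr ?ltr0n ?fact_gt0//.
  case: a => [|a]; first by rewrite expr0 invr1 mulr1 -expR0 ler_expR.
  by apply: (le_trans _ (expR_ge1Dxn a (normr_ge0 x))); rewrite lerDr.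
apply: (le_trans h); rewrite ler_wpM2l//.
by case: (ger0P x) => _; rewrite ?lerDl ?lerDr expR_ge0.
Qed.

Lemma integrable_monom_pdf a :
  mu.-integrable setT (fun x => (x ^+ a * pdf x)%:E).
Proof.
(* The power is bounded by a! (e^x + e^(-x)); completing the square turns e^(x) and e^(-x) times the
   density into e^(1/2) times the normal densities centered at 1 and -1. *)
pose g x := a`!%:R * expR (1 / 2) * (normal_pdf 1 1 x + normal_pdf (-1) 1 x).
apply: (@le_integrable _ _ _ mu setT measurableT _ (EFin \o g)).
- apply/measurable_EFinP; apply: measurable_funM; first exact: measurable_funX.
  exact: measurable_normal_pdf.
- move=> x _ /=; rewrite lee_fin normrM normrX (ger0_norm (normal_pdf_ge0 _ _ _)).
  apply: (le_trans _ (ler_norm _)); rewrite /g.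
  apply: (le_trans (ler_wpM2r (normal_pdf_ge0 _ _ _) (normr_pow_le_expR a x))).
  rewrite -!mulrA ler_wpM2l// mulrDl mulrDr.
  rewrite !normal_pdfE ?oner_neq0// /normal_fun !expr1n subr0.
  rewrite le_eqVlt; apply/orP; left; apply/eqP; congr (_ + _);
    rewrite mulrCA [RHS]mulrCA -!expRD; congr (_ * expR _);
    rewrite -[1 *+ 2]/(2%:R : R); lra.
- rewrite (_ : EFin \o g = fun x => ((a`!%:R * expR (1 / 2))%:E *
    ((normal_pdf 1 1 x)%:E + (normal_pdf (-1) 1 x)%:E))%E)//.
  apply: integrableZl => //; apply: integrableD => //; exact: integrable_normal_pdf.
Qed.

Lemma cvg_monom_pdf a : (fun n : nat => n%:R ^+ a * pdf n%:R) @ \oo --> (0 : R).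
Proof.
(* The term of order a + 1 in the series of exp(n^2 / 2) bounds n^a pdf(n) by C / n. *)
pose C : R := normal_peak 1 * (2 ^+ a.+1 * a.+1`!%:R).
apply: (@squeeze_cvgr _ _ _ _ (cst 0) (fun n => C * n%:R^-1)).
- near=> n; have n0 : (0 < n%:R :> R) by rewrite ltr0n; near: n; exact: nbhs_infty_gt.
  rewrite mulr_ge0 ?exprn_ge0 ?normal_pdf_ge0//= /C std_normal_pdfE.
  rewrite mulrCA -!mulrA ler_wpM2l ?normal_peak_ge0// mulNr expRN.
  rewrite ler_pdivrMr ?expR_gt0//.
  have n2 : 0 <= (n%:R : R) ^+ 2 / 2 by rewrite divr_ge0 ?sqr_ge0.
  have h : (n%:R ^+ 2 / 2) ^+ a.+1 / a.+1`!%:R <= expR (n%:R ^+ 2 / 2) :> R.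
    by apply: (le_trans _ (expR_ge1Dxn a n2)); rewrite lerDr.
  have h2 : n%:R ^+ a.+1 <= (2 ^+ a.+1 * a.+1`!%:R) * expR (n%:R ^+ 2 / 2) :> R.
    move: h; rewrite expr_div_n ler_pdivrMr ?ltr0n ?fact_gt0//.
    rewrite ler_pdivrMr ?exprn_gt0// [leRHS](_ : _ =
      2 ^+ a.+1 * a.+1`!%:R * expR (n%:R ^+ 2 / 2)); last by ring.
    move=> h; apply: (le_trans _ h).
    by rewrite -exprM ler_weXn2l ?leq_pmull// ler1n -(ltr0n R).
  rewrite [leRHS](_ : _ = 2 ^+ a.+1 * a.+1`!%:R * expR (n%:R ^+ 2 / 2) / n%:R);
    last by ring.
  by rewrite ler_pdivlMr// -exprSr.
- exact: cvg_cst.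
- rewrite -(mulr0 C); apply: cvgM; first exact: cvg_cst.
  apply/gtr0_cvgV0; last exact: cvgr_idn.
  by near=> n; rewrite ltr0n; near: n; exact: nbhs_infty_gt.
Unshelve. all: by end_near.
Qed.

(** The integrand is the derivative of x^a pdf(x). The fundamental theorem on [-n, n], dominated
    convergence and the decay of the boundary terms give 0; this is Stein's identity on
    one-dimensional monomials. *)
Lemma integral_monom_deriv a :
  (\int[mu]_x (a%:R * x ^+ a.-1 * pdf x - x ^+ a.+1 * pdf x)%:E = 0)%E.
Proof.
pose h x := a%:R * x ^+ a.-1 * pdf x - x ^+ a.+1 * pdf x.
have ih : mu.-integrable setT (EFin \o h).
  rewrite (_ : EFin \o h = fun x => (a%:R%:E * (x ^+ a.-1 * pdf x)%:E
      - (x ^+ a.+1 * pdf x)%:E)%E); last first.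
    by apply/funext => x; rewrite /= -EFinM -EFinB /h; congr (_%:E); ring.
  apply: integrableB => //; last exact: integrable_monom_pdf.
  by apply: integrableZl => //; exact: integrable_monom_pdf.
have mh : measurable_fun setT h by apply/measurable_EFinP; exact: (measurable_int mu ih).
pose I (n : nat) : set R := `[- n%:R, n%:R]%classic.
have [] := @dominated_convergence _ _ _ mu setT measurableT
  (fun n => (EFin \o h) \_ (I n)) (EFin \o h) (abse \o (EFin \o h)).
- move=> n; apply/(measurable_restrict _ _ measurableT) => //.
    exact: measurable_itv.
  by apply: measurable_funTS; exact/measurable_EFinP.
- exact/measurable_EFinP.
- apply: aeW => x _; apply: cvg_near_cst; near=> n.
  rewrite patchE ifT//; apply/mem_set; rewrite /I /= in_itv/= -ler_norml.
  near: n; exact: nbhs_infty_ger.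
- exact: integrable_abse.
- by apply: aeW => x n _; rewrite patchE; case: ifP => // _; rewrite abse0 abse_ge0.
move=> _ _ cv.
apply: (cvg_unique _ cv) => //=.
pose G (x : R) := x ^+ a * pdf x.
have dG x : is_derive x (1 : R) G (h x) by exact: is_derive_monom_pdf.
have cG : continuous G.
  by move=> x; apply/differentiable_continuous/derivable1_diffP; case: (dG x).
have E : \forall n \near \oo, (G n%:R - G (- n%:R))%:E =
    (\int[mu]_x ((EFin \o h) \_ (I n)) x)%E.
  near=> n; apply: esym; rewrite -integral_mkcond EFinB; apply: continuous_FTC2.
  - have n0 : (0 < n%:R :> R) by rewrite ltr0n; near: n; exact: nbhs_infty_gt.
    by rewrite (lt_trans _ n0)// oppr_lt0.
  - apply: continuous_subspaceT => x.
    have cp b : continuous (fun y : R => y ^+ b * pdf y).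
      move=> y; apply/differentiable_continuous/derivable1_diffP.
      by case: (is_derive_monom_pdf b y).
    rewrite (_ : h = fun y => a%:R * (y ^+ a.-1 * pdf y) - y ^+ a.+1 * pdf y).
      by apply: cvgB; [apply: cvgM; [exact: cvg_cst|exact: cp]|exact: cp].
    by apply/funext => y; rewrite /h mulrA.
  - split => [x _||].
    + by case: (dG x).
    + by apply: cvg_at_right_filter; exact: cG.
    + by apply: cvg_at_left_filter; exact: cG.
  - by move=> x _; rewrite derive1E; case: (dG x).
suff : (fun n : nat => (G n%:R - G (- n%:R))%:E) @ \oo --> 0%:E.
  exact: cvg_trans (near_eq_cvg E).
have Gneg x : G (- x) = (-1) ^+ a * G x.
  by rewrite /G (exprNn x) !std_normal_pdfE sqrrN -!mulrA.
apply: cvg_EFin; first exact: nearW.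
have : (fun n : nat => G n%:R - (-1) ^+ a * G n%:R) @ \oo --> (0 - (-1) ^+ a * 0 : R).
  apply: cvgB; first exact: cvg_monom_pdf.
  by apply: cvgM; [exact: cvg_cst|exact: cvg_monom_pdf].
rewrite mulr0 subr0; apply: cvg_trans; apply: near_eq_cvg.
by apply: nearW => n /=; rewrite Gneg.
Unshelve. all: by end_near.
Qed.

End normal_moments.

Section density.
Context d (T : measurableType d) (R : realType).
Context (nu : {finite_measure set T -> \bar R}) (mu : {sigma_finite_measure set T -> \bar R}).
Context (g : T -> R) (g0 : forall x, 0 <= g x) (mug : mu.-integrable setT (EFin \o g)).
Context (nuE : forall A, measurable A -> nu A = (\int[mu]_(x in A) (g x)%:E)%E).

Let mg : measurable_fun setT g.
Proof. by apply/measurable_EFinP; exact: (measurable_int mu). Qed.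

Lemma density_dominates : nu `<< mu.
Proof.
apply/null_content_dominatesP => A mA muA0; rewrite nuE//.
by apply: null_set_integral => //; apply: measurable_funTS; exact/measurable_EFinP.
Qed.

(** The given density and the Radon-Nikodym derivative have the same integral over every measurable
    set, hence agree almost everywhere, and the change of variables for the latter applies. *)
Lemma ge0_integral_density (f : T -> \bar R) : (forall x, 0 <= f x)%E ->
  measurable_fun setT f ->
  (\int[nu]_x f x = \int[mu]_x (f x * (g x)%:E))%E.
Proof.
move=> f0 mf.
rewrite -(Radon_Nikodym_SigmaFinite.change_of_variables density_dominates)//.
apply: ae_eq_integral => //.
- apply: emeasurable_funM => //; apply: (measurable_int mu).
  exact: Radon_Nikodym_SigmaFinite.f_integrable density_dominates.
- by apply: emeasurable_funM => //; exact/measurable_EFinP.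
apply: ae_eqe_mul2l; apply: integral_ae_eq => //.
- exact: Radon_Nikodym_SigmaFinite.f_integrable density_dominates.
- exact/measurable_EFinP.
- move=> E _ mE; rewrite -Radon_Nikodym_SigmaFinite.f_integral//; last first.
    exact: density_dominates.
  exact: nuE.
Qed.

Lemma integrable_density (f : T -> R) : measurable_fun setT f ->
  mu.-integrable setT (fun x => (f x * g x)%:E) -> nu.-integrable setT (EFin \o f).
Proof.
move=> mf /integrableP[_ fg]; apply/integrableP; split; first exact/measurable_EFinP.
rewrite ge0_integral_density//; last by apply: measurableT_comp => //; exact/measurable_EFinP.
apply: le_lt_trans fg; rewrite le_eqVlt; apply/orP; left; apply/eqP.
by apply: eq_integral => x _ /=; rewrite normrM (ger0_norm (g0 x)) EFinM.
Qed.

Lemma Rintegral_density (f : T -> R) : measurable_fun setT f ->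
  mu.-integrable setT (fun x => (f x * g x)%:E) ->
  \int[nu]_x f x = \int[mu]_x (f x * g x).
Proof.
move=> mf ifg; have inf := integrable_density mf ifg.
have mEf : measurable_fun setT (EFin \o f) by exact/measurable_EFinP.
rewrite /Rintegral integralE [in RHS]integralE; congr (fine (_ - _)%E).
- rewrite ge0_integral_density//; last exact: measurable_funepos.
  by apply: eq_integral => x _; rewrite !funeposE /= -!EFin_max -EFinM maxr_pMl// mul0r.
- rewrite ge0_integral_density//; last exact: measurable_funeneg.
  by apply: eq_integral => x _; rewrite !funenegE /= -!EFin_max -EFinM maxr_pMl// mul0r mulNr.
Qed.

End density.

Section std_normal_moments.
Context (R : realType).
Local Notation mu := (@lebesgue_measure R).
Local Notation pdf := (normal_pdf (0 : R) 1).

(* std_normal and lebesgue_measure live on measurable spaces that differ by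
   their display; this identity transports integrals between them. *)
Let id_R (x : measurableTypeR R) : R := x.

Let mid_R : measurable_fun setT id_R.
Proof. by move=> _ A mA; rewrite setTI; exact: mA. Qed.

Let std_normalE (A : set R) : measurable A ->
  std_normal A = pushforward (normal_prob (0 : R) 1) id_R A.
Proof. by []. Qed.

Lemma integrable_std_normal (f : R -> \bar R) : measurable_fun [set: R] f ->
  (normal_prob (0 : R) 1).-integrable [set: measurableTypeR R] f ->
  (@std_normal R).-integrable [set: R] f.
Proof.
move=> mf inf; apply/integrableP; split => //.
rewrite (eq_measure_integral (pushforward (normal_prob (0 : R) 1) id_R)); last first.
  by move=> A mA _; exact: std_normalE.
have := @integrable_pushforward _ _ _ _ R id_R mid_R (normal_prob 0 1) setT f mf inf
  measurableT.
by move=> /integrableP[].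
Qed.

Lemma integral_std_normal (f : R -> \bar R) : measurable_fun [set: R] f ->
  (normal_prob (0 : R) 1).-integrable [set: measurableTypeR R] f ->
  (\int[@std_normal R]_x f x =
   \int[normal_prob (0 : R) 1]_(x in [set: measurableTypeR R]) f x)%E.
Proof.
move=> mf inf.
rewrite (eq_measure_integral (pushforward (normal_prob (0 : R) 1) id_R)); last first.
  by move=> A mA _; exact: std_normalE.
exact: (@integral_pushforward _ _ _ _ R id_R mid_R (normal_prob 0 1) setT f mf inf).
Qed.

Let integrable_normal_monom a :
  (normal_prob (0 : R) 1).-integrable [set: measurableTypeR R] (fun x => (x ^+ a)%:E).
Proof.
apply: (@integrable_density _ _ R (normal_prob 0 1) mu pdf) => //.
- exact: normal_pdf_ge0.
- exact: integrable_normal_pdf.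
- exact: integrable_monom_pdf.
Qed.

Lemma integrable_std_normal_monom a :
  (@std_normal R).-integrable setT (fun x => (x ^+ a)%:E).
Proof.
by apply: integrable_std_normal => //; apply/measurable_EFinP; exact: measurable_funX.
Qed.

Lemma Rintegral_std_normal_monom a :
  \int[@std_normal R]_x (x ^+ a.+1) = a%:R * \int[@std_normal R]_x (x ^+ a.-1).
Proof.
have E b : \int[@std_normal R]_x (x ^+ b) = \int[mu]_x (x ^+ b * pdf x).
  rewrite -(@Rintegral_density _ _ R (normal_prob 0 1) mu pdf) //.
  - rewrite /Rintegral integral_std_normal//.
    by apply/measurable_EFinP; exact: measurable_funX.
  - exact: normal_pdf_ge0.
  - exact: integrable_normal_pdf.
  - exact: integrable_monom_pdf.
rewrite !E -RintegralZl//; last exact: integrable_monom_pdf.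
apply/eqP; rewrite -subr_eq0 -opprB oppr_eq0 -RintegralB//; last 2 first.
- rewrite (_ : EFin \o _ = fun x => (a%:R%:E * (x ^+ a.-1 * pdf x)%:E)%E)//.
  by apply: integrableZl => //; exact: integrable_monom_pdf.
- exact: integrable_monom_pdf.
rewrite /Rintegral; under eq_integral do rewrite mulrA.
by rewrite integral_monom_deriv.
Qed.

(* Both std_normal and its affine image are equivalent to Lebesgue measure. *)
Lemma std_normal_affine_null (A : set R) (a b : R) : 0 < a -> measurable A ->
  std_normal A = 0%E -> std_normal [set x | A (a * x + b)] = 0%E.
Proof.
move=> a0 mA A0.
have maff : measurable_fun [set: measurableTypeR R] (fun x : measurableTypeR R => a * x + b).
  by apply: measurable_funD => //; exact: measurable_funM.
have muA : mu (A : set (measurableTypeR R)) = 0%E.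
  have mpdf := measurable_normal_pdf (0 : R) 1.
  have : ae_eq mu (A : set (measurableTypeR R)) (fun x => (pdf x)%:E) (cst 0%E).
    apply/ae_eq_integral_abs => //.
      by apply: measurable_funTS; exact/measurable_EFinP.
    rewrite -[RHS]A0; apply: eq_integral => x _.
    by rewrite gee0_abs// lee_fin normal_pdf_ge0.
  move=> h; apply: measure_negligible => //; apply: negligibleS h => x Ax /=.
  move/(_ Ax) => /= -[]; apply/eqP; rewrite std_normal_pdfE gt_eqF//.
  by rewrite mulr_gt0 ?expR_gt0 ?normal_peak_gt0.
pose affine (x : measurableTypeR R) : measurableTypeR R := a * x + b.
have maff' : measurable_fun [set: measurableTypeR R] affine.
  by move=> _ B mB; exact: maff.
(* The image of Lebesgue measure under the affine map, scaled by a, is Lebesgue measure, by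
   uniqueness on half-open intervals. So affine preimages of null sets are null. *)
pose m0 : {measure set (measurableTypeR R) -> \bar R} :=
  mscale (NngNum (ltW a0)) (pushforward mu affine).
pose m' := m0 maff'.
have m'E : mu A = m' A.
  apply: (@lebesgue_measure_unique _ m') => // X -[[x y] _ <-] /=.
  rewrite /m' /m0 /mscale /pushforward/=.
  rewrite [X in _ = (_ * mu X)%E](_ : _ = `](x - b) / a, (y - b) / a]%classic); last first.
    apply/seteqP; split => z /=; rewrite !in_itv/= /affine.
      by rewrite ltr_pdivrMr// ler_pdivlMr// ltrBlDr lerBrDr mulrC.
    by rewrite ltr_pdivrMr// ler_pdivlMr// ltrBlDr lerBrDr mulrC.
  rewrite !lebesgue_measure_itv/= !lte_fin ltr_pM2r ?invr_gt0// ltrD2r.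
  case: ifP => _; last by rewrite mule0.
  by rewrite -!EFinB -EFinM; congr (_%:E); field; rewrite gt_eqF.
have : mu ([set x | A (a * x + b)] : set (measurableTypeR R)) = 0%E.
  move: m'E; rewrite muA /m' /m0 /mscale /pushforward/= => /esym/eqP.
  by rewrite mule_eq0 eqe gt_eqF//= => /eqP.
move=> B0; have /null_content_dominatesP := @normal_prob_dominates R 0 1; apply=> //.
by have := maff measurableT A mA; rewrite setTI.
Qed.

End std_normal_moments.

(** * Product measures: integrals and null sets *)

Section product_integral.
Context d1 d2 (T1 : measurableType d1) (T2 : measurableType d2) (R : realType).
Context (P1 : probability T1 R) (P2 : probability T2 R).

Lemma integrable_tensor (f : T1 -> R) (g : T2 -> R) :
  P1.-integrable setT (EFin \o f) -> P2.-integrable setT (EFin \o g) ->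
  (P1 \x P2)%E.-integrable setT (fun z => (f z.1 * g z.2)%:E).
Proof.
move=> fi gi.
have mf : measurable_fun setT f by apply/measurable_EFinP; exact: (measurable_int P1).
have mg : measurable_fun setT g by apply/measurable_EFinP; exact: (measurable_int P2).
apply/integrable12ltyP.
  by apply/measurable_EFinP; apply: measurable_funM; exact: measurableT_comp.
under eq_integral => x _.
  under eq_integral => y _ do rewrite /= normrM EFinM.
  rewrite integralZl//; last exact: (integrable_norm gi).
  over.
have gfin : (\int[P2]_y `|g y|%:E \is a fin_num)%E.
  by rewrite ge0_fin_numE ?integral_ge0//; case/integrableP: gi.
under eq_integral do rewrite -(fineK gfin).
rewrite integralZr//; last exact: (integrable_norm fi).
rewrite fineK//.
rewrite lte_mul_pinfty//.
- exact: integral_ge0.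
- by rewrite ge0_fin_numE ?integral_ge0//; case/integrableP: fi.
- by case/integrableP: gi.
Qed.

Lemma Rintegral_tensor (f : T1 -> R) (g : T2 -> R) :
  P1.-integrable setT (EFin \o f) -> P2.-integrable setT (EFin \o g) ->
  \int[(P1 \x P2)%E]_z (f z.1 * g z.2) = \int[P1]_x f x * \int[P2]_y g y.
Proof.
move=> fi gi; have fgi := integrable_tensor fi gi.
rewrite /Rintegral -integral12_prod_meas1// /fubini_F.
under [X in fine X = _]eq_integral => x _.
  under eq_integral => y _ do rewrite /= EFinM.
  rewrite integralZl//; over.
have gfin : (\int[P2]_y (g y)%:E \is a fin_num)%E by exact: integrable_fin_num.
under [X in fine X = _]eq_integral do rewrite -(fineK gfin).
rewrite integralZr//= fineM//; exact: integrable_fin_num.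
Qed.

End product_integral.

Section iid_integral.
Context d (T : measurableType d) (R : realType) (P : probability T R).

Lemma iid_prod n (f : 'I_n -> T -> R) :
  (forall i, P.-integrable setT (EFin \o f i)) ->
  (iid P n).-integrable setT (fun t => (\prod_i f i (tnth t i))%:E) /\
  \int[iid P n]_t (\prod_i f i (tnth t i)) = \prod_i \int[P]_x f i x.
Proof.
elim: n => [|n IH] in f *.
  move=> _; rewrite big_ord0; split.
    rewrite (_ : (fun _ => _) = EFin \o cst 1); first exact: finite_measure_integrable_cst.
    by apply/funext => t; rewrite /= big_ord0.
  under eq_Rintegral do rewrite big_ord0.
  rewrite Rintegral_cst// mul1r -[RHS]/(fine 1%:E); congr fine.
  exact: (@probability_setT _ _ _ (iid P 0)).
move=> fi; have [IH1 IH2] := IH (fun i => f (lift ord0 i)) (fun i => fi _).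
pose F (t : n.+1.-tuple T) := \prod_i f i (tnth t i).
have mF : measurable_fun setT F.
  apply: measurable_prod => i _; apply: measurableT_comp.
    by apply/measurable_EFinP; exact: (measurable_int P).
  exact: measurable_tnth.
have E z : F (tcons z) = f ord0 z.1 * \prod_i f (lift ord0 i) (tnth z.2 i).
  rewrite /F big_ord_recl; congr (f _ _ * _).
  by apply: eq_bigr => i _; congr (f _ _); rewrite !(tnth_nth z.1).
have Fi : (P \x iid P n)%E.-integrable setT ((EFin \o F) \o @tcons _ T n).
  rewrite (_ : _ \o _ = fun z => (f ord0 z.1 * \prod_i f (lift ord0 i) (tnth z.2 i))%:E).
    exact: (integrable_tensor (fi ord0) IH1).
  by apply/funext => z /=; rewrite E.
have mEF : measurable_fun setT (EFin \o F) by exact/measurable_EFinP.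
split.
  exact: (integrable_pushforward (@measurable_tcons _ T n) mEF Fi).
rewrite big_ord_recl -IH2 -(Rintegral_tensor (fi _) IH1) /Rintegral; congr fine.
rewrite [LHS](integral_pushforward (@measurable_tcons _ T n) mEF Fi)//.
by apply: eq_integral => z _; rewrite /= E.
Qed.

End iid_integral.

(** Says that [f] is measurable and that the image of [mu] under [f] is absolutely continuous with
    respect to [mu]. *)
Definition null_preserving d (T : measurableType d) (R : realType)
    (mu : set T -> \bar R) (f : T -> T) : Prop :=
  measurable_fun setT f /\
  forall A, measurable A -> mu A = 0%E -> mu (f @^-1` A) = 0%E.

Section null_preserving_product.
Context d1 d2 (T1 : measurableType d1) (T2 : measurableType d2) (R : realType).
Context (P1 : probability T1 R) (P2 : probability T2 R).

Let section_null (B : set (T1 * T2)) : measurable B ->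
  (P1 \x P2)%E B = 0%E <-> P1 [set x | P2 (xsection B x) != 0%E] = 0%E.
Proof.
move=> mB; have mx := measurable_fun_xsection P2 mB.
have mZ : measurable [set x | P2 (xsection B x) != 0%E].
  by rewrite -[X in measurable X]setTI; exact: emeasurable_neq.
have -> : (P1 \x P2)%E B = (\int[P1]_x `|(P2 \o xsection B) x|)%E.
  by apply: eq_integral => x _; rewrite gee0_abs.
split.
  move/ae_eq_integral_abs => /(_ measurableT mx) h.
  apply: measure_negligible => //; apply: negligibleS h => x /= nz /(_ I) /eqP.
  by apply/negP.
move=> Z0; apply/(ae_eq_integral_abs P1 measurableT mx).
exists [set x | P2 (xsection B x) != 0%E]; split => // x /= h.
by apply/eqP => h0; apply: h.
Qed.

(** Fubini for skew products: the section at x of the preimage of A is the preimage under [g x] of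
    the section of A at [f x]. Triangular maps are thus handled one coordinate at a time. *)
Lemma null_preserving_pair (f : T1 -> T1) (g : T1 -> T2 -> T2) :
  null_preserving P1 f -> (forall x, null_preserving P2 (g x)) ->
  measurable_fun setT (fun z : T1 * T2 => g z.1 z.2) ->
  null_preserving (P1 \x P2)%E (fun z => (f z.1, g z.1 z.2)).
Proof.
move=> [mf nf] ng mg.
have mfg : measurable_fun [set: T1 * T2] (fun z => (f z.1, g z.1 z.2)).
  apply: measurable_fun_pair => //; exact: measurableT_comp.
split => // A mA A0.
have mB : measurable ((fun z : T1 * T2 => (f z.1, g z.1 z.2)) @^-1` A).
  by rewrite -[X in measurable X]setTI; exact: mfg.
move/(section_null mA) : A0 => A0; apply/(section_null mB).
have mZ : measurable [set x | P2 (xsection A x) != 0%E].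
  rewrite -[X in measurable X]setTI; apply: emeasurable_neq => //.
  exact: measurable_fun_xsection.
have := nf _ mZ A0; apply: subset_measure0 => //=.
- rewrite -[X in measurable X]setTI; apply: emeasurable_neq => //.
  exact: (measurable_fun_xsection P2 mB).
- by rewrite -[X in measurable X]setTI; exact: mf.
move=> x /=; apply: contra => /eqP h; apply/eqP.
rewrite -[RHS]((ng x).2 _ (measurable_xsection _ mA) h); congr (P2 _).
Qed.

End null_preserving_product.

Section null_preserving_iid.
Context d (T : measurableType d) (R : realType) (P : probability T R).

Lemma null_preserving_tcons n (h : n.+1.-tuple T -> n.+1.-tuple T)
    (g : T * n.-tuple T -> T * n.-tuple T) : measurable_fun setT h ->
  null_preserving (P \x iid P n)%E g -> (forall z, tcons (g z) = h (tcons z)) ->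
  null_preserving (iid P n.+1) h.
Proof.
move=> mh [mg ng] gh; split => // A mA A0.
have mA' : measurable (@tcons _ T n @^-1` A).
  by rewrite -[X in measurable X]setTI; exact: measurable_tcons.
rewrite -[RHS](ng _ mA' A0) /= /distribution /pushforward; congr ((_ \x _)%E _).
by apply/seteqP; split => z; rewrite /preimage/= gh.
Qed.

Lemma null_preserving_map n (f : T -> T) : null_preserving P f ->
  null_preserving (iid P n) (@map_tuple n T T f).
Proof.
move=> nf; have mf := nf.1.
have mmap m : measurable_fun [set: m.-tuple T] (@map_tuple m T T f).
  apply/measurable_fun_tnthP => i.
  rewrite (_ : _ \o _ = f \o (@tnth _ T ^~ i)); last first.
    by apply/funext => x /=; rewrite tnth_map.
  by apply: measurableT_comp => //; exact: measurable_tnth.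
elim: n => [|n IH].
  split; [exact: mmap|move=> A mA A0]; rewrite -[RHS]A0; congr (iid P 0 _).
  by apply/seteqP; split => z; rewrite /preimage/= [map_tuple _ _]tuple0 [z]tuple0.
apply: (@null_preserving_tcons _ _ (fun z => (f z.1, map_tuple f z.2))) => //.
  apply: (null_preserving_pair (g := fun=> @map_tuple n T T f)).
  - exact: nf.
  - by move=> _; exact: IH.
  - exact: (measurableT_comp (mmap n)).
by move=> z; exact: val_inj.
Qed.

End null_preserving_iid.

Section mvnormal_null.
Context (R : realType).

Definition affine_tuple n (A : 'M[R]_n) (b z : n.-tuple R) : n.-tuple R :=
  [tuple \sum_j A i j * tnth z j + tnth b i | i < n].

(** The factor is lower triangular with positive diagonal: the first coordinate undergoes a
    nondegenerate affine map of the line, and the others, given the first, the affine map of the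
    Schur complement. *)
Lemma null_preserving_chol n (S : 'M[R]_n) (b : n.-tuple R) : posdef S ->
  null_preserving (iid (@std_normal R) n) (affine_tuple (chol S) b).
Proof.
have maff m (A : 'M[R]_m) c : measurable_fun setT (affine_tuple A c).
  apply/measurable_fun_tnthP => i.
  rewrite (_ : _ \o _ = fun z => \sum_j A i j * tnth z j + tnth c i); last first.
    by apply/funext => z /=; rewrite tnth_mktuple.
  apply: measurable_funD => //; apply: measurable_sum => j; apply: measurable_funM => //.
  exact: measurable_tnth.
elim: n S b => [|n IH] S b pS.
  split; [exact: maff|move=> A mA A0]; rewrite -[RHS]A0; congr (iid _ 0 _).
  by apply/seteqP; split => z; rewrite /preimage/= [affine_tuple _ _ _]tuple0 [z]tuple0.
change 'M[R]_(1 + n) in S.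
have sS := pS.1; have [a0 pS'] := (posdef_schur sS).1 pS.
pose a := Num.sqrt (S 0 0); pose c (i : 'I_n) := a^-1 * S (rshift 1 i) 0.
(* The first column of the factor times the first coordinate joins the shift of the remaining ones,
   which is why the induction runs over all [b]. *)
pose b' (x : R) : n.-tuple R := [tuple c i * x + tnth b (lift ord0 i) | i < n].
pose g (z : R * n.-tuple R) :=
  (a * z.1 + tnth b ord0, affine_tuple (chol (schur S)) (b' z.1) z.2).
apply: (@null_preserving_tcons _ _ _ _ _ _ g) => //.
- apply: (null_preserving_pair (f := fun x => a * x + tnth b ord0)
    (g := fun x => affine_tuple (chol (schur S)) (b' x))).
  + split; first by apply: measurable_funD => //; exact: measurable_funM.
    move=> A mA A0; apply: (@std_normal_affine_null _ A a _ _ mA A0).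
    by rewrite sqrtr_gt0.
  + by move=> x; exact: IH.
  + apply/measurable_fun_tnthP => i.
    rewrite (_ : _ \o _ = fun z => \sum_j chol (schur S) i j * tnth z.2 j +
      (c i * z.1 + tnth b (lift ord0 i))); last first.
      by apply/funext => z /=; rewrite !tnth_mktuple.
    apply: measurable_funD.
      apply: measurable_sum => j; apply: measurable_funM => //.
      apply: (@measurableT_comp _ _ _ _ _ _ (@tnth _ R ^~ j)) => //.
      exact: measurable_tnth.
    by apply: measurable_funD => //; exact: measurable_funM.
have tcl (z : R * n.-tuple R) (j : 'I_1) : tnth (tcons z) (lshift n j) = z.1.
  by rewrite (tnth_nth 0) /= [j]ord1.
have tcr (z : R * n.-tuple R) (j : 'I_n) : tnth (tcons z) (rshift 1 j) = tnth z.2 j.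
  by rewrite !(tnth_nth 0).
move=> z; apply: eq_from_tnth => i; rewrite tnth_mktuple.
rewrite (@big_split_ord _ _ _ 1 n) /= big_ord1 tcl.
under eq_bigr do rewrite tcr.
pose C := chol (schur S); pose v := a^-1 *: dlsubmx S.
case: (split_ordP (m := 1) i) => i' ->.
  rewrite tcl (_ : chol S _ _ = (a%:M : 'M[R]_1) i' ord0); last first.
    exact: (block_mxEul (a%:M : 'M[R]_1) 0 v C).
  rewrite mxE [i']ord1 eqxx mulr1n big1 ?addr0; last first.
    move=> j _; rewrite (_ : chol S _ _ = (0 : 'M[R]_(1, n)) ord0 j); last first.
      exact: (block_mxEur (a%:M : 'M[R]_1) 0 v C).
    by rewrite mxE mul0r.
  by rewrite /g /=; congr (_ + tnth _ _); exact: val_inj.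
rewrite tcr /g /= !tnth_mktuple (_ : chol S _ _ = v i' ord0); last first.
  exact: (block_mxEdl (a%:M : 'M[R]_1) 0 v C).
rewrite !mxE /c addrCA addrA.
congr (_ + _ + _).
- by rewrite [in RHS](_ : lshift n ord0 = 0 :> 'I_(1 + n))//; exact: val_inj.
- apply: eq_bigr => j _; congr (_ * _).
  by rewrite -[LHS](block_mxEdr (a%:M : 'M[R]_1) 0 v C).
- by congr (tnth _ _); exact: val_inj.
Qed.

Lemma chol1 n : chol (1%:M : 'M[R]_n) = 1%:M.
Proof.
elim: n => [|n IH]; first by rewrite [LHS]flatmx0 [RHS]flatmx0.
have d0 : dlsubmx (1%:M : 'M[R]_(1 + n)) = 0 by rewrite scalar_mx_block block_mxKdl.
have s1 : schur (1%:M : 'M[R]_(1 + n)) = 1%:M.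
  by rewrite /schur d0 mul0mx scaler0 subr0 scalar_mx_block block_mxKdr.
have -> : chol (1%:M : 'M[R]_(1 + n)) =
    block_mx 1%:M 0 0 (1%:M : 'M[R]_n) :> 'M[R]_(1 + n).
  rewrite -IH -s1 -[LHS]/(block_mx _ _ _ _); congr block_mx.
  - by rewrite mxE eqxx sqrtr1.
  - by rewrite d0 scaler0.
by rewrite -scalar_mx_block.
Qed.

Lemma mulmx_tuple1 n (z : n.-tuple R) : mulmx_tuple 1%:M z = z.
Proof.
apply: eq_from_tnth => i; rewrite tnth_mktuple (bigD1 i)//= mxE eqxx mul1r.
by rewrite big1 ?addr0// => j ji; rewrite mxE eq_sym (negbTE ji) mul0r.
Qed.

Lemma iid_mvnormal1 n N A : measurable A ->
  iid (mvnormal (1%:M : 'M[R]_n)) N A = iid (iid (@std_normal R) n) N A.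
Proof.
move=> mA; rewrite /mvnormal iid_distribution//= chol1; congr (iid _ N _).
apply/seteqP; split => z /=; rewrite (_ : map_tuple _ z = z)//;
  by apply: eq_from_tnth => i; rewrite tnth_map mulmx_tuple1.
Qed.

Lemma mvnormal_null n (S : 'M[R]_n) N : posdef S ->
  forall A, measurable A -> iid (mvnormal 1%:M) N A = 0%E ->
  iid (mvnormal S) N A = 0%E.
Proof.
move=> pS A mA; rewrite iid_mvnormal1// => A0; pose zero : n.-tuple R := [tuple 0 | _ < n].
have [m1 n1] := null_preserving_map N (null_preserving_chol zero pS).
have aE (S' : 'M[R]_n) z : affine_tuple S' zero z = mulmx_tuple S' z.
  by apply: eq_from_tnth => i; rewrite !tnth_mktuple addr0.
rewrite /mvnormal iid_distribution//= -[RHS](n1 _ mA A0); congr (iid _ N _).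
apply/seteqP; split => z /=; rewrite (_ : map_tuple _ z =
  map_tuple (affine_tuple (chol S) zero) z)//;
  by apply: eq_from_tnth => i; rewrite !tnth_map aE.
Qed.

End mvnormal_null.

Lemma big_mxvec_index (N m : nat) (V : Type) (idx : V) (op : Monoid.com_law idx)
    (F : 'I_(N * m) -> V) :
  \big[op/idx]_i F i = \big[op/idx]_(u < N) \big[op/idx]_(a < m) F (mxvec_index u a).
Proof.
rewrite pair_bigA/= (reindex (uncurry (@mxvec_index N m))).
  by apply: eq_bigr => -[].
exact: curry_mxvec_bij.
Qed.

Section gaussian_functional.
Context (R : realType) (N m : nat).
Local Notation G := (iid (iid (@std_normal R) m) N).
Local Notation poly := (mpoly (N * m) R).
Implicit Types (p q : poly).

Lemma poly_funE p (z : N.-tuple (m.-tuple R)) :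
  poly_fun p z = meval (mxvec (mx_of_rows z) 0) p.
Proof. by []. Qed.

Let mom (a : nat) : R := \int[@std_normal R]_x (x ^+ a).

Let poly_funX (al : multinom (N * m)) (z : N.-tuple (m.-tuple R)) :
  poly_fun (mpolyX R al) z =
  \prod_(u < N) \prod_(a < m) tnth (tnth z u) a ^+ al (mxvec_index u a).
Proof.
rewrite poly_funE mevalX big_mxvec_index; apply: eq_bigr => u _.
by apply: eq_bigr => a _; rewrite mxvecE mxE.
Qed.

Let monomP (al : multinom (N * m)) :
  G.-integrable setT (EFin \o poly_fun (mpolyX R al)) /\
  \int[G]_z poly_fun (mpolyX R al) z = \prod_i mom (al i).
Proof.
have Hu u := iid_prod (fun a => integrable_std_normal_monom R (al (mxvec_index u a))).
have [H1 H2] := iid_prod (fun u => (Hu u).1).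
split.
  apply: eq_integrable H1 => // z _ /=; by rewrite poly_funX.
under eq_Rintegral do rewrite poly_funX.
rewrite H2 big_mxvec_index.
by apply: eq_bigr => u _; rewrite (Hu u).2.
Qed.

Lemma poly_funD p q z : poly_fun (p + q) z = poly_fun p z + poly_fun q z.
Proof. by rewrite !poly_funE mevalD. Qed.

Lemma poly_funZ (c : R) q z : poly_fun (c *: q) z = c * poly_fun q z.
Proof. by rewrite !poly_funE mevalZ. Qed.

Lemma poly_funM p q z : poly_fun (p * q) z = poly_fun p z * poly_fun q z.
Proof. by rewrite !poly_funE mevalM. Qed.

Lemma measurable_poly_fun p : measurable_fun setT (@poly_fun R m N p).
Proof.
elim/mpolyind: p => [|c al p _ _ mp].
  rewrite (_ : poly_fun 0 = cst 0); first exact: measurable_cst.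
  by apply/funext => z; rewrite poly_funE meval0.
rewrite (_ : poly_fun _ = fun z => c * poly_fun (mpolyX R al) z + poly_fun p z).
  apply: measurable_funD => //; apply: measurable_funM => //.
  rewrite (_ : poly_fun _ = fun z : N.-tuple (m.-tuple R) => \prod_(u < N)
      \prod_(a < m) tnth (tnth z u) a ^+ al (mxvec_index u a)); last first.
    by apply/funext => z; exact: poly_funX.
  apply: measurable_prod => u _; apply: measurable_prod => a _.
  apply: measurable_funX; apply: (@measurableT_comp _ _ _ _ _ _ (@tnth _ R ^~ a)).
    exact: measurable_tnth.
  exact: measurable_tnth.
by apply/funext => z; rewrite poly_funD poly_funZ.
Qed.

Lemma integrable_poly_fun p : G.-integrable setT (EFin \o poly_fun p).
Proof.
elim/mpolyind: p => [|c al p _ _ ip].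
  rewrite (_ : EFin \o _ = cst 0%E); first exact: integrable0.
  by apply/funext => z; rewrite /= poly_funE meval0.
rewrite (_ : EFin \o _ = fun z =>
    (c%:E * (poly_fun (mpolyX R al) z)%:E + (poly_fun p z)%:E)%E).
  by apply: integrableD => //; apply: integrableZl => //; exact: (monomP al).1.
by apply/funext => z; rewrite /= poly_funD poly_funZ.
Qed.

Definition gaussian_functional p : R := \int[G]_z poly_fun p z.

Lemma gaussian_functional_linear : functional gaussian_functional.
Proof.
move=> c p q; rewrite /gaussian_functional.
under eq_Rintegral do rewrite poly_funD poly_funZ.
rewrite RintegralD ?RintegralZl//; try exact: integrable_poly_fun.
rewrite (_ : EFin \o _ = fun z => (c%:E * (poly_fun p z)%:E)%E)//.
by apply: integrableZl => //; exact: integrable_poly_fun.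
Qed.

(** By linearity Stein's identity is checked on monomials, where the product structure isolates
    coordinate i and leaves the one-dimensional recursion. *)
Lemma standard_gaussian_functional : standard_gaussian gaussian_functional.
Proof.
have lin := gaussian_functional_linear.
split => //.
- rewrite /gaussian_functional; under eq_Rintegral do rewrite poly_funE meval1.
  rewrite Rintegral_cst// mul1r -[RHS]/(fine 1%:E); congr fine.
  exact: (@probability_setT _ _ _ G).
- move=> i q; rewrite (bigD1 i)//= mxE eqxx mul1r big1 ?addr0; last first.
    by move=> j ji; rewrite mxE eq_sym (negbTE ji) mul0r.
  elim/mpolyind: q => [|c al q _ _ IH].
    by rewrite mulr0 mderiv0.
  rewrite mulrDr -scalerAr mderivD mderivZ !lin IH; congr (c * _ + _).
  rewrite -mpolyXD mderivX (functionalZ lin) /gaussian_functional !(monomP _).2.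
  rewrite (bigD1 i)//= [in RHS](bigD1 i)//= mulrA; congr (_ * _).
    (* If the exponent of coordinate i is 0, the truncated predecessor is harmless because its
       coefficient is 0. *)
    by rewrite !mnmE eqxx add1n subn1 /mom Rintegral_std_normal_monom.
  by apply: eq_bigr => j ji; rewrite !mnmE eq_sym (negbTE ji) add0n subn0.
- move=> p p0; apply: Rintegral_ge0 => z _; exact: p0.
Qed.

End gaussian_functional.

(** * Block-diagonal operators and Frobenius norms *)

Section row_operator.
Context (R : realFieldType) (N : nat).

(** The block-diagonal matrix with [N] copies of A, obtained from Z -> Z A so that products and
    transposes follow from the action on vectorized matrices. *)
Definition row_op n k (A : 'M[R]_(n, k)) : 'M[R]_(N * n, N * k) := lin_mulmxr A.

Lemma mul_row_op n k (A : 'M[R]_(n, k)) (Z : 'M[R]_(N, n)) :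
  mxvec Z *m row_op A = mxvec (Z *m A).
Proof. exact: mul_vec_lin. Qed.

Lemma row_opE n k (A : 'M[R]_(n, k)) u a v b :
  row_op A (mxvec_index u a) (mxvec_index v b) = (u == v)%:R * A a b.
Proof.
transitivity ((row (mxvec_index u a) (row_op A)) 0 (mxvec_index v b)).
  by rewrite [RHS]mxE.
rewrite rowE -mxvec_delta mul_row_op mxvecE mxE (bigD1 a)//= big1 ?addr0.
  by rewrite mxE eqxx andbT eq_sym.
by move=> j ja; rewrite mxE (negbTE ja) andbF mul0r.
Qed.

Lemma row_opM n k l (A : 'M[R]_(n, k)) (B : 'M[R]_(k, l)) :
  row_op A *m row_op B = row_op (A *m B).
Proof.
apply/row_matrixP => i; case/mxvec_indexP: i => u a.
by rewrite !rowE -mxvec_delta mulmxA !mul_row_op mulmxA.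
Qed.

Lemma row_op_tr n k (A : 'M[R]_(n, k)) : (row_op A)^T = row_op A^T.
Proof.
apply/matrixP => i j; case/mxvec_indexP: i => u a; case/mxvec_indexP: j => v b.
by rewrite mxE !row_opE mxE eq_sym.
Qed.

Lemma row_op1 n : row_op (1%:M : 'M[R]_n) = 1%:M.
Proof.
apply/row_matrixP => i; case/mxvec_indexP: i => u a.
by rewrite !rowE -mxvec_delta mul_row_op !mulmx1.
Qed.

Lemma row_opD n k (A B : 'M[R]_(n, k)) : row_op (A + B) = row_op A + row_op B.
Proof. exact: linearD. Qed.

Lemma row_opZ n k c (A : 'M[R]_(n, k)) : row_op (c *: A) = c *: row_op A.
Proof. exact: linearZ. Qed.

Lemma norm2_row_op n k (A : 'M[R]_(n, k)) : norm2 (row_op A) = N%:R * norm2 A.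
Proof.
rewrite /norm2 big_mxvec_index mulr_natl -[N in RHS]card_ord -sumr_const.
apply: eq_bigr => u _; apply: eq_bigr => a _.
rewrite big_mxvec_index (bigD1 u)//= [X in _ + X]big1 ?addr0.
  by apply: eq_bigr => b _; rewrite row_opE eqxx mul1r.
move=> v vu; rewrite big1// => b _.
by rewrite row_opE eq_sym (negbTE vu) mul0r expr0n.
Qed.

Lemma norm2_mxvec n k (A : 'M[R]_(n, k)) : norm2 (mxvec A) = norm2 A.
Proof.
rewrite /norm2 big_ord1 big_mxvec_index; apply: eq_bigr => i _.
by apply: eq_bigr => j _; rewrite mxvecE.
Qed.

(** Lagrange's identity: twice the defect is a double sum of squares. *)
Lemma cauchy_schwarz (I : finType) (a b : I -> R) :
  (\sum_i a i * b i) ^+ 2 <= (\sum_i a i ^+ 2) * (\sum_i b i ^+ 2).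
Proof.
rewrite -subr_ge0; set A := \sum_i a i ^+ 2; set B := \sum_i b i ^+ 2.
set C := \sum_i a i * b i.
suff : 0 <= \sum_i \sum_j (a i * b j - a j * b i) ^+ 2.
  rewrite (_ : \sum_i _ = (A * B - C ^+ 2) *+ 2) ?pmulrn_lge0//.
  transitivity (\sum_i (a i ^+ 2 * B - (a i * b i) * C *+ 2 + b i ^+ 2 * A)).
    apply: eq_bigr => i _; rewrite /A /B /C !mulr_sumr -sumrMnl -sumrB -big_split.
    by apply: eq_bigr => j _ /=; ring.
  rewrite big_split sumrB/= sumrMnl -!mulr_suml -/A -/B -/C; ring.
by apply: sumr_ge0 => i _; apply: sumr_ge0 => j _; exact: sqr_ge0.
Qed.

Lemma norm2_mul n k l (A : 'M[R]_(n, k)) (B : 'M[R]_(k, l)) :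
  norm2 (A *m B) <= norm2 A * norm2 B.
Proof.
rewrite /norm2 mulr_suml; apply: ler_sum => i _.
rewrite [X in _ * X]exchange_big mulr_sumr; apply: ler_sum => j _ /=.
by rewrite mxE; exact: cauchy_schwarz.
Qed.

Lemma norm2_trmx n k (A : 'M[R]_(n, k)) : norm2 A^T = norm2 A.
Proof.
rewrite /norm2 exchange_big; apply: eq_bigr => i _; apply: eq_bigr => j _.
by rewrite mxE.
Qed.

End row_operator.

(** * The planted distribution *)

Section full_measure.
Context d (T : measurableType d) (R : realType) (P : probability T R).
Context (D : set T) (mD : measurable D) (PD : P D = 1%E).

Let PDc : P (~` D) = 0%E.
Proof. by rewrite probability_setC// PD subee. Qed.

Lemma Rintegral_full (f : T -> R) : P.-integrable setT (EFin \o f) ->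
  \int[P]_x f x = \int[P]_(x in D) f x.
Proof.
move=> fi; rewrite /Rintegral; congr fine.
rewrite [LHS](negligible_integral (measurableC mD) measurableT fi PDc).
by rewrite setTD setCK.
Qed.

Lemma integrable_full (f : T -> R) (C : R) : measurable_fun setT f ->
  (forall x, D x -> `|f x| <= C) -> P.-integrable setT (EFin \o f).
Proof.
move=> mf fC; apply/(negligible_integrable (measurableC mD) measurableT _ PDc).
  exact/measurable_EFinP.
rewrite setTD setCK; apply: measurable_bounded_integrable => //.
- by apply: (le_lt_trans (probability_le1 P mD)); rewrite ltry.
- exact: measurable_funTS.
- by exists C; split; rewrite ?num_real// => r Cr x /fC fx; exact: le_trans (ltW Cr).
Qed.

Lemma le_Rintegral_full (f g : T -> R) :
  P.-integrable setT (EFin \o f) -> P.-integrable setT (EFin \o g) ->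
  (forall x, D x -> f x <= g x) -> \int[P]_x f x <= \int[P]_x g x.
Proof.
move=> fi gi fg; rewrite !Rintegral_full//; apply: le_Rintegral => //.
- exact: integrableS fi.
- exact: integrableS gi.
Qed.

End full_measure.

(** * Integration against mixtures and Radon-Nikodym derivatives *)

Section mixture.
Context d1 d2 (X : measurableType d1) (Y : measurableType d2) (R : realType).
Context (P : probability X R) (K : X -> probability Y R).
Context (mK : forall A, measurable A -> measurable_fun setT (fun x => K x A)).
Context (Q : probability Y R).
Context (QE : forall A, measurable A -> Q A = (\int[P]_x K x A)%E).

(** A dummy parameter of type [unit] presents the mixture as a composition of two probability
    kernels, for which an integration formula is available. *)
Let l (_ : unit) : {measure set X -> \bar R} := P.
Let k (z : unit * X) : {measure set Y -> \bar R} := K z.2.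

Let ml A : measurable A -> measurable_fun [set: unit] (fun x => l x A).
Proof. by move=> _; exact: measurable_cst. Qed.

HB.instance Definition _ := isKernel.Build _ _ _ _ R l ml.

Let l1 x : l x setT = 1%E.
Proof. exact: probability_setT. Qed.

HB.instance Definition _ := Kernel_isProbability.Build _ _ _ _ R l l1.

Let mk A : measurable A -> measurable_fun [set: unit * X] (fun x => k x A).
Proof. by move=> mA; apply: (measurableT_comp (mK mA)). Qed.

HB.instance Definition _ := isKernel.Build _ _ _ _ R k mk.

Let k1 x : k x setT = 1%E.
Proof. exact: probability_setT. Qed.

HB.instance Definition _ := Kernel_isProbability.Build _ _ _ _ R k k1.

Lemma ge0_integral_mixture (f : Y -> \bar R) : (forall y, 0 <= f y)%E ->
  measurable_fun setT f ->
  (\int[Q]_y f y = \int[P]_x \int[K x]_y f y)%E.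
Proof.
move=> f0 mf; rewrite -(integral_kcomp l k tt f0 mf).
by apply: eq_measure_integral => A mA _; exact: QE.
Qed.

Lemma measurable_integral_mixture (f : Y -> R) : measurable_fun setT f ->
  measurable_fun setT (fun x => \int[K x]_y f y).
Proof.
move=> mf; have mEf : measurable_fun setT (EFin \o f) by exact/measurable_EFinP.
apply: (measurableT_comp (fine_measurable measurableT)).
under eq_fun do rewrite integralE.
apply: emeasurable_funB.
- apply: (@measurable_fun_integral_kernel _ _ _ _ _ K) => //.
  exact: measurable_funepos.
- apply: (@measurable_fun_integral_kernel _ _ _ _ _ K) => //.
  exact: measurable_funeneg.
Qed.

Lemma integrable_mixture (f : Y -> R) : measurable_fun setT f ->
  (forall x, (K x).-integrable setT (EFin \o f)) ->
  P.-integrable setT (fun x => (\int[K x]_y `|f y|)%:E) ->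
  Q.-integrable setT (EFin \o f) /\
  \int[Q]_y f y = \int[P]_x \int[K x]_y f y.
Proof.
move=> mf fi Pf; have mEf : measurable_fun setT (EFin \o f) by exact/measurable_EFinP.
have finE (g : Y -> \bar R) : (forall x, (K x).-integrable setT g) ->
    forall x, (\int[K x]_y g y = (fine (\int[K x]_y g y))%:E)%E.
  by move=> gi x; rewrite fineK//; apply: integrable_fin_num => //; exact: gi.
have Qi : Q.-integrable setT (EFin \o f).
  apply/integrableP; split => //; rewrite ge0_integral_mixture//; last first.
    exact: measurableT_comp.
  move/integrableP : Pf => [_]; apply: le_lt_trans.
  rewrite le_eqVlt; apply/orP; left; apply/eqP; apply: eq_integral => x _.
  rewrite gee0_abs ?lee_fin ?Rintegral_ge0// /Rintegral fineK//.
  by apply: integrable_fin_num => //; exact: (integrable_norm (fi x)).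
split=> //; rewrite /Rintegral.
have fpi x : (K x).-integrable setT ((EFin \o f)^\+)%E by apply: integrable_funepos => //; exact: fi.
have fni x : (K x).-integrable setT ((EFin \o f)^\-)%E by apply: integrable_funeneg => //; exact: fi.
have mfp := measurable_funepos mEf; have mfn := measurable_funeneg mEf.
have gi (g : Y -> \bar R) : measurable_fun setT g -> (forall y, 0 <= g y)%E ->
    (forall y, g y <= `|f y|%:E)%E -> P.-integrable setT (fun x => \int[K x]_y g y)%E.
  move=> mg g0 gf; apply: le_integrable Pf => //.
    exact: (@measurable_fun_integral_kernel _ _ _ _ _ K).
  move=> x _; rewrite gee0_abs ?integral_ge0// gee0_abs ?lee_fin ?Rintegral_ge0//.
  rewrite /Rintegral fineK; last first.
    by apply: integrable_fin_num => //; exact: (integrable_norm (fi x)).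
  apply: ge0_le_integral => //.
  by apply/measurable_EFinP; exact: measurableT_comp.
rewrite integralE !ge0_integral_mixture// -integralB//.
- congr fine; apply: eq_integral => x _.
  by rewrite -integralE finE.
- apply: gi => // y; rewrite funeposE /= -EFin_max lee_fin ge_max normr_ge0.
  by rewrite ler_norm.
- apply: gi => // y; rewrite funenegE /= -EFin_max lee_fin ge_max normr_ge0.
  by rewrite -normrN ler_norm.
Qed.

End mixture.

Section radon_nikodym_integral.
Context d (T : measurableType d) (R : realType).
Context (nu : {finite_measure set T -> \bar R}) (mu : {finite_measure set T -> \bar R}).
Context (numu : nu `<< mu).

Let L := Radon_Nikodym (charge_of_finite_measure nu) mu.

(** The derivative of the charge agrees almost everywhere with the nonnegative derivative of the
    measure, so |L f| integrates against [mu] as |f| does against [nu]. *)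
Lemma integrable_Radon_Nikodym (f : T -> R) : nu.-integrable setT (EFin \o f) ->
  mu.-integrable setT (fun x => (L x * (f x)%:E)%E).
Proof.
move=> fi; have mf := measurable_int nu fi.
have mnf : measurable_fun setT (fun x => `|f x|%:E)%E.
  by apply/measurable_EFinP; apply: measurableT_comp => //; exact/measurable_EFinP.
have mL : measurable_fun setT L.
  by apply: (measurable_int mu); exact: Radon_Nikodym_integrable.
have mSF : measurable_fun setT (Radon_Nikodym_SigmaFinite.f nu mu).
  by apply: (measurable_int mu); exact: Radon_Nikodym_SigmaFinite.f_integrable.
apply/integrableP; split; first exact: emeasurable_funM.
rewrite (_ : (\int[mu]_x _ = \int[mu]_x (`|f x|%:E *
    Radon_Nikodym_SigmaFinite.f nu mu x))%E).
  rewrite Radon_Nikodym_SigmaFinite.change_of_variables//.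
  - by case/integrableP: fi.
apply: ae_eq_integral => //.
- by apply: measurableT_comp => //; exact: emeasurable_funM.
- exact: emeasurable_funM.
have := ae_eq_Radon_Nikodym_SigmaFinite numu measurableT.
apply: filterS => x /(_ I) h _; rewrite /L -h muleC abseM.
by rewrite [X in (_ * X)%E]gee0_abs// Radon_Nikodym_SigmaFinite.f_ge0.
Qed.

Lemma integral_Radon_Nikodym (f : T -> R) : nu.-integrable setT (EFin \o f) ->
  (\int[mu]_x (L x * (f x)%:E) = \int[nu]_x (f x)%:E)%E.
Proof.
move=> fi; rewrite -(Radon_Nikodym_change_of_variables numu measurableT fi).
by apply: eq_integral => x _; rewrite muleC.
Qed.

End radon_nikodym_integral.

Section mvnormal_functional.
Context (R : realType) (N n : nat).
Local Notation poly := (mpoly (N * n) R).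
Implicit Types (S : 'M[R]_n) (q : poly).

Definition mv_functional S q : R := \int[iid (mvnormal S) N]_y poly_fun q y.

Let measurable_map_mulmx (A : 'M[R]_n) :
  measurable_fun [set: N.-tuple (n.-tuple R)] (@map_tuple N _ _ (mulmx_tuple A)).
Proof.
apply/measurable_fun_tnthP => u.
rewrite (_ : _ \o _ = mulmx_tuple A \o (@tnth _ _ ^~ u)); last first.
  by apply/funext => x /=; rewrite tnth_map.
by apply: measurableT_comp => //; exact: measurable_tnth.
Qed.

Lemma poly_fun_mulmx (A : 'M[R]_n) q (z : N.-tuple (n.-tuple R)) :
  poly_fun q (map_tuple (mulmx_tuple A) z) =
  poly_fun (linear_subst (row_op N A^T) q) z.
Proof.
rewrite !poly_funE meval_linear_subst mul_row_op; apply: meval_eq => i.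
congr (mxvec _ _ _); apply/matrixP => u a.
rewrite !mxE tnth_map tnth_mktuple; apply: eq_bigr => j _.
by rewrite !mxE mulrC.
Qed.

Lemma integrable_mvnormal S q :
  (iid (mvnormal S) N).-integrable setT (EFin \o poly_fun q) /\
  mv_functional S q = gaussian_functional (linear_subst (row_op N (chol S)^T) q).
Proof.
pose G := iid (iid (@std_normal R) n) N.
pose phi : N.-tuple (n.-tuple R) -> N.-tuple (n.-tuple R) :=
  map_tuple (mulmx_tuple (chol S)).
have mphi : measurable_fun setT phi by exact: measurable_map_mulmx.
have mq : measurable_fun setT (EFin \o @poly_fun R n N q).
  by apply/measurable_EFinP; exact: measurable_poly_fun.
have E : (EFin \o poly_fun q) \o phi =
    EFin \o poly_fun (linear_subst (row_op N (chol S)^T) q).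
  by apply/funext => z; rewrite /= poly_fun_mulmx.
have qi : G.-integrable (phi @^-1` setT) ((EFin \o poly_fun q) \o phi).
  by rewrite E; exact: integrable_poly_fun.
have mE A : measurable A -> iid (mvnormal S) N A = pushforward G phi A.
  by move=> mA; rewrite /mvnormal iid_distribution.
split.
  have /integrableP[_ h] := integrable_pushforward mphi mq qi measurableT.
  apply/integrableP; split => //; rewrite (eq_measure_integral (pushforward G phi))//.
  by move=> A mA _; exact: mE.
rewrite /mv_functional /gaussian_functional /Rintegral; congr fine.
rewrite (eq_measure_integral (pushforward G phi)); last by move=> A mA _; exact: mE.
rewrite (integral_pushforward mphi mq qi measurableT).
by apply: eq_integral => z _; rewrite E.
Qed.

Lemma mv_functional_linear S : functional (mv_functional S).
Proof.
move=> a p q; rewrite !(integrable_mvnormal _ _).2.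
exact: (functional_linear_subst (gaussian_functional_linear (R:=R) (N:=N) (m:=n))).
Qed.

Lemma mv_functional1 S : mv_functional S 1 = 1.
Proof.
rewrite (integrable_mvnormal _ _).2 linear_subst1.
by case: (standard_gaussian_functional R N n).
Qed.

Lemma mv_functional_stein S : posdef S -> stein (row_op N S) (mv_functional S).
Proof.
move=> pS i q; rewrite !(integrable_mvnormal _ _).2.
have [lin _ st _] := standard_gaussian_functional R N n.
have -> : row_op N S = (row_op N (chol S)^T)^T *m row_op N (chol S)^T.
  by rewrite row_op_tr trmxK row_opM cholK.
rewrite [LHS](stein_linear_subst lin st); apply: eq_bigr => j _.
by rewrite (integrable_mvnormal _ _).2.
Qed.

End mvnormal_functional.

Section stein_bound.
Context (R : realFieldType) (K : nat).

Lemma size_rem_words_le (j : 'I_K) c : (size (rem_words j c) <= size c)%N.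
Proof.
elim: c => [//|i c IH] /=; rewrite size_cat size_map.
by case: ifP => _ /=; rewrite ?add1n ?add0n ?ltnS// ltnW.
Qed.

(** The bound is uniform over all covariances with entries at most [b], so that Gaussian moments
    stay bounded while the spike ranges over the support of the prior. *)
Lemma stein_monom_bound (b : R) m : exists2 B, 0 <= B &
  forall c W S, size c = m -> functional W -> W 1 = 1 -> stein S W ->
  (forall i j : 'I_K, `|S i j| <= b) -> `|W (monom R c)| <= B.
Proof.
(* Stein's identity removes two letters, so the induction carries two consecutive lengths. *)
suff : (exists2 B, 0 <= B & forall c W S, size c = m -> functional W -> W 1 = 1 ->
    stein S W -> (forall i j : 'I_K, `|S i j| <= b) -> `|W (monom R c)| <= B) /\
  (exists2 B, 0 <= B & forall c W S, size c = m.+1 -> functional W -> W 1 = 1 ->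
    stein S W -> (forall i j : 'I_K, `|S i j| <= b) -> `|W (monom R c)| <= B) by case.
elim: m => [|m [[B B0 HB] [B' B'0 HB']]].
  split.
    by exists 1 => // -[|i c]//= W S _ _ -> _ _; rewrite normr1.
  exists 0 => // -[|i [|j c]]//= W S _ linW _ stW _.
  rewrite stW big1 ?normr0// => j _; rewrite mderiv1.
  by rewrite functional0// mulr0.
split; first by exists B'.
(* The factor m + 1 bounds the number of ways to delete a letter from the remaining word. *)
exists (\sum_(j < K) `|b| * (m.+1%:R * B)).
  by apply: sumr_ge0 => j _; rewrite mulr_ge0// mulr_ge0.
move=> [|i c]//= W S [sc] linW W1 stW bS; rewrite stW.
apply: (le_trans (ler_norm_sum _ _ _)); apply: ler_sum => j _.
rewrite normrM ler_pM//; first exact: le_trans (bS i j) (ler_norm b).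
rewrite mderiv_monom functional_sum// (le_trans (ler_norm_sum _ _ _))//.
apply: (@le_trans _ _ (\sum_(d <- rem_words j c) B)).
  rewrite big_seq [leRHS]big_seq; apply: ler_sum => d /size_rem_words; rewrite sc => -[sd].
  exact: (HB _ W S).
rewrite big_const_seq count_predT iter_addr_0 -[B *+ _]mulr_natl ler_wpM2r// ler_nat.
by rewrite -sc size_rem_words_le.
Qed.

Lemma stein_bound (b : R) (q : mpoly K R) : exists B,
  forall W S, functional W -> W 1 = 1 -> stein S W ->
  (forall i j : 'I_K, `|S i j| <= b) -> `|W q| <= B.
Proof.
(* A prefix monomial is carried along because [mpoly_ind_alg] peels off variables, which then
   accumulate in [c]. *)
suff : forall c, exists B, forall W S, functional W -> W 1 = 1 -> stein S W ->
  (forall i j : 'I_K, `|S i j| <= b) -> `|W (monom R c * q)| <= B.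
  by move=> /(_ [::])/=; rewrite mul1r.
elim/mpoly_ind_alg: q => [c|a p q IHp IHq c|i q IH c].
- have [B _ HB] := stein_monom_bound b (size c); exists B => W S linW W1 stW bS.
  by rewrite mulr1; exact: (HB _ W S).
- have [B HB] := IHp c; have [B' HB'] := IHq c.
  exists (`|a| * B + B') => W S linW W1 stW bS.
  rewrite mulrDr -scalerAr linW (le_trans (ler_normD _ _))// lerD//.
    by rewrite normrM ler_wpM2l//; exact: (HB W S).
  exact: (HB' W S).
- have [B HB] := IH (i :: c); exists B => W S linW W1 stW bS.
  by rewrite mulrCA mulrA; exact: (HB W S).
Qed.

End stein_bound.

Lemma iid_full d (T : measurableType d) (R : realType) (P : probability T R) n
    (B : set T) : measurable B -> P B = 1%E ->
  let D := [set t : n.-tuple T | forall i, B (tnth t i)] in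
  measurable D /\ iid P n D = 1%E.
Proof.
move=> mB PB D.
have DE : D = \bigcap_(i in [set: 'I_n]) ((@tnth n T ^~ i) @^-1` B).
  by apply/seteqP; split => [t Dt i _|t Dt i]; [exact: Dt|exact: (Dt i I)].
have mD : measurable D.
  rewrite DE; apply: fin_bigcap_measurable => // i _.
  by rewrite -[X in measurable X]setTI; exact: measurable_tnth.
split=> //.
have iB : P.-integrable setT (EFin \o (\1_B : T -> R)).
  exact: integrable_indic.
have [Hi HE] := iid_prod (fun _ : 'I_n => iB).
have indD : (fun t : n.-tuple T => \prod_i (\1_B (tnth t i) : R)) = \1_D.
  apply/funext => t; rewrite indicE; case: (asboolP (D t)) => Dt.
    by rewrite mem_set// big1// => i _; rewrite indicE mem_set.
  rewrite memNset//; have /existsNP[i nB] := Dt.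
  by rewrite (bigD1 i)//= indicE memNset ?mul0r.
have RE d' (T' : measurableType d') (P' : probability T' R) (B' : set T') :
    measurable B' -> \int[P']_x (\1_B' x : R) = fine (P' B').
  by move=> mB'; rewrite /Rintegral integral_indic// setIT.
move: HE; rewrite indD (RE _ _ (iid P n) D mD) big1 => [fD|i _].
  rewrite -[LHS]fineK; first by congr (_%:E); exact: fD.
  exact: fin_num_measure.
by rewrite RE// PB.
Qed.

(** * Factorization of the spike and sums over words for two replicas *)

Section spiked_factor.
Context (R : realType) (k n N : nat) (beta : R).
Implicit Types U : n.-tuple (k.-tuple R).

Definition clipped_spike U : 'M[R]_n :=
  if `[< posdef (beta *: spike U + 1%:M) >] then spike U else 0.

(** The clipped spike is only positive semidefinite, so a k-dimensional Gram factor takes the place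
    of a Cholesky factor: w is a k-dimensional standard Gaussian vector times this matrix. *)
Definition spike_factor U : 'M[R]_(k, n) :=
  if `[< posdef (beta *: spike U + 1%:M) >]
  then Num.sqrt n%:R^-1 *: (mx_of_rows U)^T else 0.

Lemma spike_factorK U : (spike_factor U)^T *m spike_factor U = clipped_spike U.
Proof.
rewrite /spike_factor /clipped_spike; case: ifP => _; last by rewrite mulmx0.
rewrite [(_ *: _)^T]linearZ/= trmxK -scalemxAl -scalemxAr scalerA -expr2 sqr_sqrtr//.
Qed.

Lemma posdef1 m : posdef (1%:M : 'M[R]_m).
Proof.
split; first by rewrite tr_scalar_mx.
move=> v v0; rewrite mulmx1 mxE lt_neqAle; apply/andP; split.
  rewrite eq_sym; apply: contra v0 => /eqP.
  under eq_bigr do rewrite mxE -expr2.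
  move=> /eqP; rewrite psumr_eq0; last by move=> *; exact: sqr_ge0.
  move=> /allP h; apply/eqP/colP => i; rewrite mxE; apply/eqP.
  by rewrite -sqrf_eq0; exact: (h i (mem_index_enum _)).
by apply: sumr_ge0 => i _; rewrite mxE -expr2 sqr_ge0.
Qed.

Lemma posdef_spiked_cov U : posdef (spiked_cov beta U).
Proof.
rewrite /spiked_cov; case: ifP => [/asboolP|_]; first by rewrite addrC.
by rewrite scaler0 addr0; exact: posdef1.
Qed.

Lemma mv_functional_herm U (c : seq 'I_(N * n)) :
  mv_functional (spiked_cov beta U) (herm R c) = half_power beta (size c) *
    gaussian_functional (linear_subst (row_op N (spike_factor U)) (monom R c)).
Proof.
have [lin g1 st _] := standard_gaussian_functional R N k.
apply: (@functional_herm R (N * n) beta (row_op N (spiked_cov beta U))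
  (row_op N (clipped_spike U)) (mv_functional (N := N) (spiked_cov beta U))
  (gaussian_functional (N := N) (m := k) \o linear_subst (row_op N (spike_factor U)))).
- exact: mv_functional_linear.
- exact: mv_functional1.
- exact/mv_functional_stein/posdef_spiked_cov.
- exact: functional_linear_subst.
- by rewrite /= linear_subst1.
- rewrite -spike_factorK -row_opM -row_op_tr; exact: stein_linear_subst.
- by rewrite -row_op1 -row_opZ -row_opD /spiked_cov.
Qed.

(** Already a squared norm: its d-th power is the moment of order 2 d. *)
Definition overlap U U' : R := norm2 ((mx_of_rows U)^T *m mx_of_rows U').

Lemma overlap_ge0 U U' : 0 <= overlap U U'.
Proof. exact: norm2_ge0. Qed.

Lemma norm2Z m1 m2 (a : R) (A : 'M[R]_(m1, m2)) : norm2 (a *: A) = a ^+ 2 * norm2 A.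
Proof.
rewrite /norm2 mulr_sumr; apply: eq_bigr => i _; rewrite mulr_sumr.
by apply: eq_bigr => j _; rewrite mxE exprMn.
Qed.

(** If either spike is clipped the left side is 0, so no estimate of the probability of clipping
    enters. *)
Lemma norm2_spike_factor U U' :
  norm2 (spike_factor U *m (spike_factor U')^T) <= n%:R ^- 2 * overlap U U'.
Proof.
have h0 : 0 <= n%:R ^- 2 * overlap U U'.
  by rewrite mulr_ge0 ?overlap_ge0// invr_ge0 exprn_ge0.
rewrite /spike_factor; case: ifP => _; last first.
  by rewrite mul0mx /norm2 big1// => i _; rewrite big1// => j _; rewrite mxE expr0n.
case: ifP => _; last first.
  by rewrite trmx0 mulmx0 /norm2 big1// => i _; rewrite big1// => j _; rewrite mxE expr0n.
rewrite [(_ *: _)^T]linearZ/= trmxK -scalemxAl -scalemxAr scalerA -expr2 sqr_sqrtr ?invr_ge0//.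
by rewrite norm2Z exprVn.
Qed.

Lemma words_bound U U' d :
  sum_words (2 * d) (fun c : seq 'I_(N * n) =>
    mv_functional (spiked_cov beta U) (herm R c) *
    mv_functional (spiked_cov beta U') (herm R c)) <=
  beta ^+ (2 * d) * ((odd_fact d)%:R * ((\prod_(j < d) (N + 2 * j))%:R *
    (n%:R ^- 2 * overlap U U') ^+ d)).
Proof.
pose W := gaussian_functional (R:=R) (N:=N) (m:=k).
pose A := row_op N (spike_factor U); pose A' := row_op N (spike_factor U').
rewrite (@eq_sum_words _ _ _ _ (fun c => beta ^+ (2 * d) *
    (W (linear_subst A (monom R c)) * W (linear_subst A' (monom R c))))); last first.
  move=> c sc; rewrite !mv_functional_herm sc /half_power mul2n odd_double doubleK.
  by rewrite mulrACA -exprD addnn.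
rewrite -(@sum_words_morph _ _ _ (fun x => beta ^+ (2 * d) * x)) ?mulr0//; last first.
  by move=> x y; rewrite mulrDr.
rewrite ler_wpM2l//; first by rewrite exprM exprn_ge0 ?sqr_ge0.
set M := spike_factor U *m (spike_factor U')^T.
have BE : A *m A'^T = row_op N M by rewrite row_op_tr row_opM.
have nM : norm2 M <= n%:R ^- 2 * overlap U U' by exact: norm2_spike_factor.
apply: (gaussian_words (standard_gaussian_functional R N k)).
- by rewrite BE norm2_row_op ler_wpM2l.
(* The Frobenius norm of one block bounds its operator norm, which does not grow with the number of
   blocks. *)
- move=> v; rewrite BE; set w := v *m row_op N M.
  rewrite -[v]vec_mxK in w *; rewrite /w mul_row_op row_op_tr mul_row_op !norm2_mxvec.
  rewrite (le_trans (norm2_mul _ _))// norm2_trmx mulrC ler_wpM2r// ?norm2_ge0//.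
- by apply: le_trans nM; exact: norm2_ge0.
Qed.

Lemma words_odd U U' m : odd m -> sum_words m (fun c : seq 'I_(N * n) =>
    mv_functional (spiked_cov beta U) (herm R c) *
    mv_functional (spiked_cov beta U') (herm R c)) = 0.
Proof.
move=> om; rewrite (@eq_sum_words _ _ _ _ (fun=> 0 : R)); last first.
  move=> c sc; rewrite [X in X * _]mv_functional_herm sc /half_power om mul0r.
  exact: mul0r.
by elim: m {om} => //= m IH; rewrite big1.
Qed.

Lemma spiked_cov_bound (M : R) : exists b, forall U,
  (forall i a, `|tnth (tnth U i) a| <= M) ->
  forall i j, `|row_op N (spiked_cov beta U) i j| <= b.
Proof.
exists (1 + `|beta| * (n%:R^-1 * (k%:R * (M * M)))) => U UM i j.
have b0 : 0 <= n%:R^-1 * (k%:R * (M * M)).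
  by rewrite mulr_ge0 ?invr_ge0// mulr_ge0// -expr2 sqr_ge0.
case/mxvec_indexP: i => u i; case/mxvec_indexP: j => v j; rewrite row_opE.
rewrite normrM (@le_trans _ _ (1 * `|spiked_cov beta U i j|))//.
  by rewrite ler_wpM2r//; case: (u == v); rewrite ?normr1 ?normr0.
have -> : spiked_cov beta U i j = (1%:M : 'M[R]_n) i j + beta * clipped_spike U i j.
  by rewrite /spiked_cov mxE [X in _ + X]mxE.
rewrite mul1r (le_trans (ler_normD _ _))// lerD//.
  by rewrite mxE; case: (i == j); rewrite ?normr1 ?normr0.
rewrite normrM ler_wpM2l// /clipped_spike; case: ifP => _; last by rewrite mxE normr0.
rewrite mxE normrM ger0_norm ?invr_ge0// ler_wpM2l ?invr_ge0// mxE.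
apply: (le_trans (ler_norm_sum _ _ _)).
rewrite mulr_natl -[k in leRHS]card_ord -sumr_const; apply: ler_sum => a _.
by rewrite !mxE normrM ler_pM.
Qed.

End spiked_factor.

Section Rintegral_sums.
Context d (T : measurableType d) (R : realType) (mu : {measure set T -> \bar R}).

Lemma Rintegral_sum (I : Type) (r : seq I) (f : I -> T -> R) :
  (forall i, mu.-integrable setT (EFin \o f i)) ->
  mu.-integrable setT (fun x => (\sum_(i <- r) f i x)%:E) /\
  \int[mu]_x (\sum_(i <- r) f i x) = \sum_(i <- r) \int[mu]_x f i x.
Proof.
move=> fi; elim: r => [|i r [IH1 IH2]].
  rewrite big_nil; split.
    by under eq_fun do rewrite big_nil; exact: integrable0.
  under eq_Rintegral do rewrite big_nil.
  by rewrite /Rintegral integral0.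
split.
  under eq_fun do rewrite big_cons EFinD.
  by apply: integrableD => //; exact: fi.
under eq_Rintegral do rewrite big_cons.
by rewrite RintegralD// big_cons IH2.
Qed.

Lemma Rintegral_sum_words (I : finType) m (f : seq I -> T -> R) :
  (forall c, mu.-integrable setT (EFin \o f c)) ->
  mu.-integrable setT (fun x => (sum_words m (f ^~ x))%:E) /\
  \int[mu]_x (sum_words m (f ^~ x)) = sum_words m (fun c => \int[mu]_x f c x).
Proof.
elim: m f => [|m IH] f fi; first by split => //; exact: fi.
have IH' i := IH (fun c => f (i :: c)) (fun c => fi _).
have [h1 h2] := Rintegral_sum (index_enum I)
  (f := fun i x => sum_words m (fun c => f (i :: c) x)) (fun i => (IH' i).1).
split => //=; rewrite h2; apply: eq_bigr => i _; exact: (IH' i).2.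
Qed.

End Rintegral_sums.

Section planted.
Context (R : realType) (k n N : nat) (beta M : R) (prior : probability (k.-tuple R) R).
Local Notation B := [set u : k.-tuple R | forall i, `|tnth u i| <= M].
Context (priorB : prior B = 1%E).
Local Notation mu := (iid prior n).
Local Notation D := [set U : n.-tuple (k.-tuple R) | forall i, B (tnth U i)].
Local Notation kernel U := (iid (mvnormal (spiked_cov beta U)) N).
Local Notation planted := (wishart_planted prior beta n N).
Local Notation poly := (mpoly (N * n) R).

Lemma measurable_box : measurable B.
Proof.
rewrite (_ : B = \bigcap_(i in [set: 'I_k]) [set u : k.-tuple R | `|tnth u i| <= M]).
  apply: fin_bigcap_measurable => // i _.
  rewrite -[X in measurable X]setTI.
  apply: (@measurable_fun_le _ _ _ setT (fun u : k.-tuple R => `|tnth u i|) (cst M)) => //.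
  by apply: measurableT_comp => //; exact: measurable_tnth.
by apply/seteqP; split => [t Dt i _|t Dt i]; [exact: Dt|exact: (Dt i I)].
Qed.

Let mD : measurable D. Proof. exact: (iid_full n measurable_box priorB).1. Qed.

Let muD : mu D = 1%E. Proof. exact: (iid_full n measurable_box priorB).2. Qed.

Let mK (A : set (N.-tuple (n.-tuple R))) : measurable A ->
  measurable_fun setT (fun U : n.-tuple (k.-tuple R) => kernel U A).
Proof. exact: measurable_iid_spiked_cov. Qed.

Let mv (U : n.-tuple (k.-tuple R)) (q : poly) : R := mv_functional (spiked_cov beta U) q.

Let mv_bound (q : poly) : exists C, forall U, D U -> `|mv U q| <= C.
Proof.
have [b Hb] := @spiked_cov_bound R k n N beta M.
have [C HC] := stein_bound b q; exists C => U DU.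
apply: (HC _ (row_op N (spiked_cov beta U))).
- exact: mv_functional_linear.
- exact: mv_functional1.
- exact/mv_functional_stein/posdef_spiked_cov.
- exact: Hb.
Qed.

Let measurable_mv (q : poly) : measurable_fun setT (mv ^~ q).
Proof.
apply: (measurable_integral_mixture mK).
exact: measurable_poly_fun.
Qed.

Let integrable_mv (q : poly) : mu.-integrable setT (EFin \o mv ^~ q).
Proof.
have [C HC] := mv_bound q.
exact: (integrable_full mD muD (measurable_mv q) HC).
Qed.

Definition planted_functional (q : poly) : R := \int[planted]_y poly_fun q y.

Lemma planted_functionalE (q : poly) :
  planted.-integrable setT (EFin \o poly_fun q) /\
  planted_functional q = \int[mu]_U mv_functional (spiked_cov beta U) q.
Proof.
apply: (integrable_mixture mK) => //.
- exact: measurable_poly_fun.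
- by move=> U; exact: (integrable_mvnormal _ _).1.
(* The uniform bound concerns polynomials and |q| is not one, so it is dominated by 1 + q^2. *)
have [C HC] := mv_bound (1 + q * q).
have mabs : measurable_fun setT (fun y : N.-tuple (n.-tuple R) => `|poly_fun q y|).
  by apply: measurableT_comp => //; exact: measurable_poly_fun.
apply: (integrable_full mD muD (C := C)).
  exact: (measurable_integral_mixture mK mabs).
move=> U DU; apply: le_trans (HC U DU); apply: (le_trans _ (ler_norm _)).
rewrite ger0_norm ?Rintegral_ge0//; apply: le_Rintegral => //.
- exact: (integrable_norm (integrable_mvnormal _ _).1).
- exact: (integrable_mvnormal _ _).1.
move=> y _; rewrite poly_funD poly_funM (poly_funE 1) meval1.
rewrite -[poly_fun q y * _]expr2 -[in leRHS]real_normK ?num_real//.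
set a := `|_|; have : 0 <= (a - 2^-1) ^+ 2 by exact: sqr_ge0.
by lra.
Qed.

Lemma planted_functional_linear : functional planted_functional.
Proof.
move=> a p q; rewrite !(planted_functionalE _).2.
under eq_Rintegral do rewrite mv_functional_linear.
rewrite RintegralD ?RintegralZl//; try exact: integrable_mv.
rewrite (_ : EFin \o _ = fun U => (a%:E * (mv U p)%:E)%E)//.
by apply: integrableZl => //; exact: integrable_mv.
Qed.

Lemma planted_functional1 : planted_functional 1 = 1.
Proof.
rewrite (planted_functionalE _).2; under eq_Rintegral do rewrite mv_functional1.
rewrite Rintegral_cst// mul1r -[RHS]/(fine 1%:E); congr fine.
exact: (@probability_setT _ _ _ mu).
Qed.

Lemma planted_dominates : planted `<< wishart_null R n N.
Proof.
apply/null_content_dominatesP => A mA A0.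
rewrite /wishart_planted integral0_eq// => U _.
by apply: mvnormal_null => //; exact: posdef_spiked_cov.
Qed.

(** One factor of each square is opened as an average over a replica U; [word_cov] then opens the
    other over U'. *)
Let integral_words m :
  sum_words m (fun c : seq 'I_(N * n) => planted_functional (herm R c) ^+ 2) =
  \int[mu]_U sum_words m (fun c => mv U (herm R c) * planted_functional (herm R c)) /\
  mu.-integrable setT (fun U =>
    (sum_words m (fun c => mv U (herm R c) * planted_functional (herm R c)))%:E).
Proof.
have Hc (c : seq 'I_(N * n)) : mu.-integrable setT
    (EFin \o fun U => mv U (herm R c) * planted_functional (herm R c)).
  rewrite (_ : EFin \o _ =
    fun U => ((mv U (herm R c))%:E * (planted_functional (herm R c))%:E)%E)//.
  by apply: integrableZr => //; exact: integrable_mv.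
have [h1 h2] := Rintegral_sum_words m Hc; split => //.
rewrite h2; apply: eq_sum_words => c _.
by rewrite RintegralZr// (planted_functionalE _).2.
Qed.

Let word_cov U m :
  sum_words m (fun c : seq 'I_(N * n) => mv U (herm R c) * planted_functional (herm R c)) =
  \int[mu]_U' sum_words m (fun c => mv U (herm R c) * mv U' (herm R c)) /\
  mu.-integrable setT (fun U' =>
    (sum_words m (fun c : seq 'I_(N * n) => mv U (herm R c) * mv U' (herm R c)))%:E).
Proof.
have Hc (c : seq 'I_(N * n)) : mu.-integrable setT
    (EFin \o fun U' => mv U (herm R c) * mv U' (herm R c)).
  rewrite (_ : EFin \o _ =
    fun U' => ((mv U (herm R c))%:E * (mv U' (herm R c))%:E)%E)//.
  by apply: integrableZl => //; exact: integrable_mv.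
have [h1 h2] := Rintegral_sum_words m Hc; split => //.
rewrite h2; apply: eq_sum_words => c _.
by rewrite RintegralZl// (planted_functionalE _).2.
Qed.

Lemma planted_words_odd m : odd m ->
  sum_words m (fun c : seq 'I_(N * n) => planted_functional (herm R c) ^+ 2) = 0.
Proof.
move=> om; rewrite (integral_words m).1.
under eq_Rintegral => U _.
  rewrite (word_cov U m).1; under eq_Rintegral do rewrite (words_odd _ _ _ _ om).
  rewrite /Rintegral integral0 /=; over.
by rewrite /Rintegral integral0.
Qed.

(** The majorant [Phi] of the inner average keeps the two replicas apart, so that each is integrated
    with its own exponential moment. *)
Lemma planted_words_even d (Phi : n.-tuple (k.-tuple R) -> R) :
  mu.-integrable setT (EFin \o Phi) ->
  (forall U, D U -> mu.-integrable setT (fun U' => (overlap U U' ^+ d)%:E)) ->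
  (forall U, D U -> \int[mu]_U' (overlap U U' ^+ d) <= Phi U) ->
  sum_words (2 * d) (fun c : seq 'I_(N * n) => planted_functional (herm R c) ^+ 2) <=
  beta ^+ (2 * d) * ((odd_fact d)%:R * ((\prod_(j < d) (N + 2 * j))%:R *
    n%:R ^- (2 * d))) * \int[mu]_U Phi U.
Proof.
move=> iPhi iov ovPhi; set C := _ * (_ * (_ * _)).
have C0 : 0 <= C.
  have b0 : 0 <= beta ^+ (2 * d) by rewrite exprM exprn_ge0 ?sqr_ge0.
  by rewrite /C mulr_ge0// mulr_ge0// mulr_ge0// invr_ge0 exprn_ge0.
have [-> iw] := integral_words (2 * d).
rewrite -RintegralZl//; apply: (le_Rintegral_full mD muD iw).
  by rewrite (_ : EFin \o _ = fun U => (C%:E * (Phi U)%:E)%E)//; exact: integrableZl.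
move=> U DU; have [-> iU] := word_cov U (2 * d).
apply: (le_trans _ (ler_wpM2l C0 (ovPhi U DU))).
rewrite -RintegralZl//; last exact: iov.
apply: le_Rintegral => //.
  rewrite (_ : EFin \o _ = fun U' => (C%:E * (overlap U U' ^+ d)%:E)%E)//.
  by apply: integrableZl => //; exact: iov.
move=> U' _; apply: (le_trans (words_bound _ _ _ _ _)).
rewrite le_eqVlt; apply/orP; left; apply/eqP; rewrite /C exprMn exprVn -exprM.
by rewrite !mulrA.
Qed.

End planted.

Lemma integrable_scale d (T : measurableType d) (R : realType)
    (mu : {measure set T -> \bar R}) (c : R) (f : T -> R) :
  mu.-integrable setT (EFin \o f) -> mu.-integrable setT (EFin \o (fun x => c * f x)).
Proof.
move=> fi; rewrite (_ : EFin \o _ = fun x => (c%:E * (EFin \o f) x)%E)//.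
exact: integrableZl.
Qed.

Lemma integrable_add d (T : measurableType d) (R : realType)
    (mu : {measure set T -> \bar R}) (f g : T -> R) :
  mu.-integrable setT (EFin \o f) -> mu.-integrable setT (EFin \o g) ->
  mu.-integrable setT (EFin \o (fun x => f x + g x)).
Proof.
move=> fi gi; rewrite (_ : EFin \o _ = fun x => ((EFin \o f) x + (EFin \o g) x)%E)//.
exact: integrableD.
Qed.

Lemma Rintegral_prob_cst d (T : measurableType d) (R : realType)
    (P : probability T R) (c : R) : \int[P]_x (cst c x) = c.
Proof.
rewrite Rintegral_cst// -[RHS]mulr1 -[X in _ * X = _]/(fine (P setT)).
by congr (_ * _); rewrite probability_setT.
Qed.

(** * Moments of the overlap of two replicas *)

Section expR_bounds.
Context (R : realType).
Implicit Types x : R.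

(** From order 2 on, |x|^(i+2) / (i+2)! is at most x^2 / 2 times |x|^i / i!. The linear term stays
    exact so that centering can cancel it. *)
Lemma expR_le_quadratic x : expR x <= 1 + x + x ^+ 2 / 2 * expR `|x|.
Proof.
have part n : series (exp_coeff `|x|) n <= expR `|x|.
  apply: nondecreasing_cvgn_le; last exact: is_cvg_series_exp_coeff.
  by apply: nondecreasing_series => m _ _; rewrite /exp_coeff /= divr_ge0// exprn_ge0.
rewrite {1}/expR; apply: limr_le; first exact: is_cvg_series_exp_coeff.
near=> n; have [m ->] : exists m, n = m.+2.
  exists n.-2; rewrite -subn2 -addn2 subnK//; near: n; exact: nbhs_infty_ge.
rewrite /series /= big_nat_recl// big_nat_recl//= /exp_coeff /= expr0 fact0 divr1.
rewrite expr1 divr1 addrA lerD2l.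
apply: (le_trans _ (ler_wpM2l _ (part m))); last by rewrite divr_ge0// sqr_ge0.
rewrite /series /= mulr_sumr; apply: ler_sum => i _; rewrite /exp_coeff /=.
apply: (le_trans (ler_norm _)).
have -> : `|x ^+ i.+2 / i.+2`!%:R| = x ^+ 2 * `|x| ^+ i * (i.+2`!%:R)^-1.
  rewrite normrM normfV normr_nat normrX -addn2 exprD real_normK ?num_real//.
  by rewrite [`|x| ^+ i * _]mulrC.
rewrite mulrACA -invfM (ler_wpM2l (mulr_ge0 (sqr_ge0 x) (exprn_ge0 i (normr_ge0 x))))//.
rewrite lef_pV2 ?posrE ?mulr_gt0 ?ltr0n ?fact_gt0//.
by rewrite -natrM ler_nat !factS mulnA leq_mul// (@leq_trans i.+2)// leq_pmulr.
Unshelve. all: by end_near. Qed.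

Lemma expR_le_linear x : 0 <= x -> expR x <= 1 + x * expR x.
Proof.
move=> x0; rewrite -lerBlDr -[X in X - _]mul1r -mulrBl.
have := expR_ge1Dx (- x); rewrite expRN => h.
by rewrite -(ler_pM2r (expR_gt0 x)) mulVf ?gt_eqF ?expR_gt0// in h.
Qed.

Lemma pow_le_expR_pm x d : x ^+ (2 * d) <= (2 * d)`!%:R * (expR x + expR (- x)).
Proof.
have x0 : 0 <= x ^+ (2 * d) by rewrite exprM exprn_ge0 ?sqr_ge0.
rewrite -(ger0_norm x0) normrX.
exact: normr_pow_le_expR.
Qed.

End expR_bounds.

Section prior_moments.
Context (R : realType) (k : nat) (prior : probability (k.-tuple R) R) (M : R).
Local Notation B := [set u : k.-tuple R | forall i, `|tnth u i| <= M].
Context (priorB : prior B = 1%E) (cprior : centered prior).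
Context (opn : opnorm (cov_mx prior) = 1).
Implicit Types (v : 'I_k -> R) (u : k.-tuple R).

Let mB : measurable B. Proof. exact: measurable_box. Qed.

Definition dot v u : R := \sum_a v a * tnth u a.

Let mtnth a : measurable_fun setT (fun u : k.-tuple R => tnth u a).
Proof. exact: measurable_tnth. Qed.

Lemma measurable_dot v : measurable_fun setT (dot v).
Proof. by apply: measurable_sum => a; apply: measurable_funM => //; exact: mtnth. Qed.

Let int_tnth a : prior.-integrable setT (EFin \o fun u : k.-tuple R => tnth u a).
Proof. by apply: (integrable_full mB priorB (mtnth a) (C := M)) => u; exact. Qed.

Let int_tnth2 a b :
  prior.-integrable setT (EFin \o fun u : k.-tuple R => tnth u a * tnth u b).
Proof.
apply: (integrable_full mB priorB (C := M * M)).
  by apply: measurable_funM; exact: mtnth.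
by move=> u Bu; rewrite normrM ler_pM.
Qed.

Lemma Rintegral_dot v : \int[prior]_u dot v u = 0.
Proof.
have h a : prior.-integrable setT (EFin \o fun u : k.-tuple R => v a * tnth u a).
  exact: integrable_scale (int_tnth a).
rewrite (Rintegral_sum _ h).2 big1// => a _.
rewrite (RintegralZl (v a) measurableT (int_tnth a)).
have := cprior a; rewrite unlock /Rintegral => ->.
by rewrite mulr0.
Qed.

Let cov_mxE a b : cov_mx prior a b = \int[prior]_u (tnth u a * tnth u b).
Proof.
rewrite mxE unlock !cprior unlock /Rintegral; congr fine.
by apply: eq_integral => u _; rewrite mulrfctE /= !subr0.
Qed.

Let dot2E v : \int[prior]_u (dot v u ^+ 2) = \sum_a v a * \sum_b cov_mx prior a b * v b.
Proof.
have h a b : prior.-integrable setT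
    (EFin \o fun u : k.-tuple R => v a * v b * (tnth u a * tnth u b)).
  exact: integrable_scale (int_tnth2 a b).
transitivity (\int[prior]_u \sum_a \sum_b v a * v b * (tnth u a * tnth u b)).
  apply: eq_Rintegral => u _; rewrite expr2 /dot mulr_suml; apply: eq_bigr => a _.
  by rewrite mulr_sumr; apply: eq_bigr => b _; rewrite mulrACA.
have h' a := Rintegral_sum (index_enum 'I_k) (h a).
rewrite (Rintegral_sum _ (fun a => (h' a).1)).2; apply: eq_bigr => a _.
rewrite (h' a).2 mulr_sumr; apply: eq_bigr => b _.
by rewrite (RintegralZl _ measurableT (int_tnth2 a b)) cov_mxE -mulrA; congr (_ * _); rewrite mulrC.
Qed.

Let opnorm_le (w : 'cV[R]_k) : l2norm w <= 1 -> l2norm (cov_mx prior *m w) <= 1.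
Proof.
move=> w1; rewrite -opn /opnorm; set A := [set _ | _ in _].
(* By convention the supremum of a set without one is 0, which contradicts operator norm 1. *)
have hA : has_sup A.
  have [//|nA] := pselect (has_sup A).
  by have := opn; rewrite /opnorm -/A sup_out// => /esym/eqP; rewrite oner_eq0.
by apply: sup_ubound; [case: hA|exists w].
Qed.

Let sumsq_l2 (w : 'cV[R]_k) : \sum_i w i 0 ^+ 2 = l2norm w ^+ 2.
Proof. by rewrite /l2norm sqr_sqrtr// sumr_ge0// => i _; exact: sqr_ge0. Qed.

Lemma Rintegral_dot2 v : \int[prior]_u (dot v u ^+ 2) <= \sum_a v a ^+ 2.
Proof.
rewrite dot2E; set r := \sum_a v a ^+ 2.
have r0 : 0 <= r by apply: sumr_ge0 => a _; exact: sqr_ge0.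
have [rz|rnz] := eqVneq r 0.
  have vz a : v a = 0.
    apply/eqP; rewrite -sqrf_eq0; move/eqP: rz; rewrite psumr_eq0.
      by move=> /allP/(_ a (mem_index_enum _)).
    by move=> i _; exact: sqr_ge0.
  by rewrite rz big1// => a _; rewrite vz mul0r.
pose c := Num.sqrt r; have c0 : 0 < c by rewrite sqrtr_gt0 lt_neqAle eq_sym rnz.
have cc : c ^+ 2 = r by rewrite sqr_sqrtr.
pose w : 'cV[R]_k := \col_a (v a / c).
have w2 : \sum_i w i 0 ^+ 2 = 1.
  under eq_bigr do rewrite mxE expr_div_n; rewrite -mulr_suml -/r cc divff//.
have w1 : l2norm w <= 1 by rewrite /l2norm w2 sqrtr1.
have := opnorm_le w1; set y := cov_mx prior *m w => y1.
have y2 : \sum_i y i 0 ^+ 2 <= 1.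
  by rewrite sumsq_l2 exprn_ile1// /l2norm sqrtr_ge0.
have -> : \sum_a v a * \sum_b cov_mx prior a b * v b = r * \sum_a w a 0 * y a 0.
  have wE b : w b 0 = v b / c by rewrite mxE.
  have yE a : y a 0 = (\sum_b cov_mx prior a b * v b) / c.
    by rewrite [LHS]mxE mulr_suml; apply: eq_bigr => b _; rewrite wE mulrA.
  rewrite mulr_sumr; apply: eq_bigr => a _; rewrite wE yE -cc.
  set z := \sum_b _; field; exact: lt0r_neq0.
rewrite -[leRHS]mulr1 ler_wpM2l//.
have : (\sum_a w a 0 * y a 0) ^+ 2 <= 1.
  apply: (le_trans (cauchy_schwarz _ _)); rewrite w2 mul1r//.
by apply: contraTT; rewrite -!ltNge => x1; rewrite exprn_egt1.
Qed.

End prior_moments.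

Section mgf.
Context (R : realType) (k : nat) (prior : probability (k.-tuple R) R) (M : R).
Local Notation B := [set u : k.-tuple R | forall i, `|tnth u i| <= M].
Context (priorB : prior B = 1%E) (cprior : centered prior).
Context (opn : opnorm (cov_mx prior) = 1).
Implicit Types (v : 'I_k -> R) (u : k.-tuple R) (G : 'M[R]_k).

Let mB : measurable B. Proof. exact: measurable_box. Qed.

Let dot_bound v u : B u -> `|dot v u| <= (\sum_b `|v b|) * M.
Proof.
move=> Bu; rewrite (le_trans (ler_norm_sum _ _ _))// mulr_suml.
by apply: ler_sum => b _; rewrite normrM ler_wpM2l.
Qed.

Let int_dot v : prior.-integrable setT (EFin \o dot v).
Proof. exact: (integrable_full mB priorB (measurable_dot v) (dot_bound v)). Qed.

Let int_dot2 v : prior.-integrable setT (EFin \o fun u => dot v u ^+ 2).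
Proof.
apply: (integrable_full mB priorB (C := ((\sum_b `|v b|) * M) ^+ 2)).
  by apply: measurable_funX; exact: measurable_dot.
move=> u Bu; rewrite normrX ler_pXn2r ?nnegrE//; first exact: dot_bound.
exact: le_trans (normr_ge0 _) (dot_bound v Bu).
Qed.

Lemma integrable_expR_dot v s : prior.-integrable setT (EFin \o fun u => expR (s * dot v u)).
Proof.
apply: (integrable_full mB priorB (C := expR (`|s| * ((\sum_b `|v b|) * M)))).
  apply: measurableT_comp => //; apply: measurable_funM => //.
  exact: measurable_dot.
move=> u Bu; rewrite ger0_norm ?expR_ge0// ler_expR (le_trans (ler_norm _))//.
by rewrite normrM ler_wpM2l//; exact: dot_bound.
Qed.

(** Centering removes the linear term of [expR_le_quadratic], and the covariance norm bounds the
    quadratic one. Compared with a Gaussian, only the factor [expR b], close to 1 for small [s], is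
    lost. *)
Lemma mgf_dot v s b : (forall u, B u -> `|s * dot v u| <= b) ->
  \int[prior]_u expR (s * dot v u) <= expR (s ^+ 2 / 2 * expR b * \sum_a v a ^+ 2).
Proof.
move=> sb; set K := s ^+ 2 / 2 * expR b.
have K0 : 0 <= K by rewrite mulr_ge0 ?expR_ge0// divr_ge0// sqr_ge0.
have i0 : prior.-integrable setT (EFin \o (cst 1 : k.-tuple R -> R)).
  exact: finite_measure_integrable_cst.
have i1 := integrable_scale s (int_dot v).
have i2 := integrable_scale K (int_dot2 v).
have i01 := integrable_add i0 i1.
have int_rhs := integrable_add i01 i2.
apply: (@le_trans _ _ (\int[prior]_u ((1 + s * dot v u) + K * dot v u ^+ 2))).
  apply: (le_Rintegral_full mB priorB _ int_rhs); first exact: integrable_expR_dot.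
  move=> u Bu; apply: (le_trans (expR_le_quadratic _)); rewrite lerD2l.
  rewrite [leLHS](_ : _ = s ^+ 2 / 2 * dot v u ^+ 2 * expR `|s * dot v u|); last by ring.
  rewrite [leRHS](_ : _ = s ^+ 2 / 2 * dot v u ^+ 2 * expR b); last by rewrite /K; ring.
  rewrite (ler_wpM2l (mulr_ge0 (divr_ge0 (sqr_ge0 s) (ler0n _ 2)) (sqr_ge0 (dot v u))))//.
  by rewrite ler_expR; exact: sb.
rewrite (RintegralD measurableT i01 i2) (RintegralD measurableT i0 i1).
rewrite (RintegralZl s measurableT (int_dot v)).
rewrite (RintegralZl K measurableT (int_dot2 v)) (Rintegral_dot priorB cprior) mulr0 addr0.
rewrite Rintegral_prob_cst.
apply: (le_trans _ (expR_ge1Dx _)); rewrite lerD2l ler_wpM2l//.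
exact: (Rintegral_dot2 priorB cprior opn).
Qed.

Definition row_image G u (b : 'I_k) : R := dot (G ^~ b) u.

Definition image_norm2 G u : R := \sum_b row_image G u b ^+ 2.

Lemma image_norm2_ge0 G u : 0 <= image_norm2 G u.
Proof. by apply: sumr_ge0 => b _; exact: sqr_ge0. Qed.

Lemma entry_le1 G a b : norm2 G <= 1 -> `|G a b| <= 1.
Proof.
move=> G1; have : `|G a b| ^+ 2 <= 1.
  apply: le_trans G1; rewrite real_normK ?num_real// /norm2 (bigD1 a)//= (bigD1 b)//=.
  rewrite -addrA lerDl addr_ge0//; apply: sumr_ge0 => i _; first exact: sqr_ge0.
  by apply: sumr_ge0 => j _; exact: sqr_ge0.
by apply: contraTT; rewrite -!ltNge => x1; rewrite exprn_egt1.
Qed.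

(** A common bound for |u G|^2 and |<u G, u'>| when u and u' lie in the box and G has Frobenius norm
    at most 1. *)
Definition box_bound : R := k%:R ^+ 3 * M ^+ 2.

Let row_image_bound G u b : norm2 G <= 1 -> B u -> `|row_image G u b| <= k%:R * M.
Proof.
move=> G1 Bu; apply: (le_trans (dot_bound _ Bu)).
have M0 : 0 <= M by apply: le_trans (Bu b); exact: normr_ge0.
rewrite ler_wpM2r// -[X in X%:R]card_ord -sumr_const.
by apply: ler_sum => a _; exact: entry_le1.
Qed.

Let image_norm2_bound G u : norm2 G <= 1 -> B u -> image_norm2 G u <= box_bound.
Proof.
move=> G1 Bu; rewrite /box_bound exprS -mulrA -exprMn (mulr_natl ((k%:R * M) ^+ 2)).
rewrite -[X in _ *+ X]card_ord -sumr_const; apply: ler_sum => b _.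
have h := row_image_bound b G1 Bu.
have kM : 0 <= k%:R * M by apply: le_trans h.
by rewrite -real_normK ?num_real// ler_pXn2r ?nnegrE.
Qed.

Let bil_bound G u u' : norm2 G <= 1 -> B u -> B u' ->
  `|dot (row_image G u) u'| <= box_bound.
Proof.
move=> G1 Bu Bu'; rewrite (le_trans (ler_norm_sum _ _ _))//.
apply: (@le_trans _ _ (\sum_(b < k) (k%:R * M) * M)).
  by apply: ler_sum => b _; have h := row_image_bound b G1 Bu; rewrite normrM ler_pM.
rewrite sumr_const card_ord -[leLHS]mulr_natl /box_bound.
rewrite (_ : k%:R * (k%:R * M * M) = k%:R ^+ 2 * M ^+ 2); last by ring.
rewrite ler_wpM2r ?sqr_ge0// -!natrX ler_nat.
by case: (posnP k) => [->//|k0]; rewrite leq_pexp2l.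
Qed.

Let measurable_image_norm2 G : measurable_fun setT (image_norm2 G).
Proof.
by apply: measurable_sum => b; apply: measurable_funX; exact: measurable_dot.
Qed.

Lemma integrable_expR_image G K : norm2 G <= 1 ->
  prior.-integrable setT (EFin \o fun u => expR (K * image_norm2 G u)).
Proof.
move=> G1; apply: (integrable_full mB priorB (C := expR (`|K| * box_bound))).
  by apply: measurableT_comp => //; apply: measurable_funM.
move=> u Bu; rewrite ger0_norm ?expR_ge0// ler_expR (le_trans (ler_norm _))//.
rewrite normrM ler_wpM2l// ger0_norm ?image_norm2_ge0//.
exact: image_norm2_bound.
Qed.

(** On a bounded range the exponential is at most affine, and E |u G|^2 <= |G|^2 <= 1 follows column
    by column from [Rintegral_dot2]. *)
Lemma mgf_image G K : norm2 G <= 1 -> 0 <= K ->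
  \int[prior]_u expR (K * image_norm2 G u) <= expR (K * expR (K * box_bound)).
Proof.
move=> G1 K0; set L := K * expR _.
have L0 : 0 <= L by rewrite mulr_ge0 ?expR_ge0.
have iq : prior.-integrable setT (EFin \o image_norm2 G).
  apply: (integrable_full mB priorB (C := box_bound)) => // u Bu.
  by rewrite ger0_norm ?image_norm2_ge0//; exact: image_norm2_bound.
have i0 : prior.-integrable setT (EFin \o (cst 1 : k.-tuple R -> R)).
  exact: finite_measure_integrable_cst.
have iLq := integrable_scale L iq.
have int_rhs := integrable_add i0 iLq.
apply: (@le_trans _ _ (\int[prior]_u (1 + L * image_norm2 G u))).
  apply: (le_Rintegral_full mB priorB _ int_rhs); first exact: integrable_expR_image.
  move=> u Bu; have q0 := image_norm2_ge0 G u.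
  apply: (le_trans (expR_le_linear (mulr_ge0 K0 q0))); rewrite lerD2l /L [leRHS]mulrAC.
  rewrite (ler_wpM2l (mulr_ge0 K0 q0))// ler_expR ler_wpM2l//.
  exact: image_norm2_bound.
rewrite (RintegralD measurableT i0 iLq) (RintegralZl L measurableT iq) Rintegral_prob_cst.
apply: (le_trans _ (expR_ge1Dx _)); rewrite lerD2l -[leRHS]mulr1 ler_wpM2l//.
apply: (le_trans _ G1).
rewrite [leLHS](Rintegral_sum (index_enum 'I_k) (fun b => int_dot2 (G ^~ b))).2.
rewrite /norm2 exchange_big; apply: ler_sum => b _; exact: (Rintegral_dot2 priorB cprior opn).
Qed.

Section iid_mgf.
Context (n : nat) (G : 'M[R]_k) (G1 : norm2 G <= 1).
Local Notation mu := (iid prior n).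
Local Notation D := [set U : n.-tuple (k.-tuple R) | forall i, B (tnth U i)].
Implicit Types U : n.-tuple (k.-tuple R).

Definition pairing U U' : R := \sum_i dot (row_image G (tnth U i)) (tnth U' i).

Definition tuple_image_norm2 U : R := \sum_i image_norm2 G (tnth U i).

Lemma mgf_pairing s U : D U ->
  mu.-integrable setT (EFin \o fun U' => expR (s * pairing U U')) /\
  \int[mu]_U' expR (s * pairing U U') <=
    expR (s ^+ 2 / 2 * expR (`|s| * box_bound) * tuple_image_norm2 U).
Proof.
move=> DU; have E U' : expR (s * pairing U U') =
    \prod_i expR (s * dot (row_image G (tnth U i)) (tnth U' i)).
  by rewrite /pairing mulr_sumr expR_sum.
have [h1 h2] := iid_prod (fun i => integrable_expR_dot (row_image G (tnth U i)) s).
split; first by apply: eq_integrable h1 => // U' _; rewrite /= E.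
under eq_Rintegral do rewrite E.
rewrite h2 /tuple_image_norm2 mulr_sumr expR_sum; apply: ler_prod => i _.
rewrite Rintegral_ge0/=; last by move=> u _; exact: expR_ge0.
apply: mgf_dot => u Bu; rewrite normrM ler_wpM2l//.
by apply: bil_bound => //; exact: DU.
Qed.

Lemma mgf_tuple_image K : 0 <= K ->
  mu.-integrable setT (EFin \o fun U => expR (K * tuple_image_norm2 U)) /\
  \int[mu]_U expR (K * tuple_image_norm2 U) <= expR (n%:R * (K * expR (K * box_bound))).
Proof.
move=> K0; have E U : expR (K * tuple_image_norm2 U) =
    \prod_i expR (K * image_norm2 G (tnth U i)).
  by rewrite /tuple_image_norm2 mulr_sumr expR_sum.
have [h1 h2] := iid_prod (fun _ : 'I_n => integrable_expR_image K G1).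
split; first by apply: eq_integrable h1 => // U' _; rewrite /= E.
under eq_Rintegral do rewrite E.
rewrite h2 expRM_natl -[n in leRHS]card_ord -prodr_const; apply: ler_prod => i _.
rewrite Rintegral_ge0/=; last by move=> u _; exact: expR_ge0.
exact: mgf_image.
Qed.

End iid_mgf.

End mgf.

(** * A finite net of matrices of norm at most 1 *)

Section net.
Context (R : realType) (k m : nat).
Local Notation net := {ffun 'I_k * 'I_k -> bool * 'I_m.+1}.

Definition grid_mx (f : net) : 'M[R]_k :=
  \matrix_(a, b) ((-1) ^+ (f (a, b)).1 * ((f (a, b)).2%:R / m%:R)).

(** Grid points outside the unit ball are sent to 0, so that the exponential bounds hold for every
    index. *)
Definition net_mx (f : net) : 'M[R]_k := if norm2 (grid_mx f) <= 1 then grid_mx f else 0.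

Lemma norm2_net_mx f : norm2 (net_mx f) <= 1.
Proof.
rewrite /net_mx; case: ifP => // _; rewrite /norm2 big1 ?ler01// => i _.
by rewrite big1// => j _; rewrite mxE expr0n.
Qed.

(* Rounding the unit vector X / |X| towards 0 on the grid keeps its norm at most 1. *)
Lemma net_approx (X : 'M[R]_k) d : (k ^ 2 < m)%N -> exists f : net,
  (1 - (k ^ 2)%:R / m%:R) ^+ (2 * d) * norm2 X ^+ d <=
  (\sum_a \sum_b net_mx f a b * X a b) ^+ (2 * d).
Proof.
move=> km; set c := 1 - _; have m0 : 0 < m%:R :> R by rewrite ltr0n (leq_trans _ km).
have c0 : 0 <= c by rewrite subr_ge0 ler_pdivrMr// mul1r ler_nat ltnW.
have [X0|Xn0] := eqVneq (norm2 X) 0.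
  exists [ffun=> (false, ord0)]; rewrite X0.
  case: d => [|d]; first by rewrite muln0 !expr0 mulr1.
  by rewrite expr0n mulr0 exprM exprn_ge0// sqr_ge0.
pose r := Num.sqrt (norm2 X).
have r0 : 0 < r by rewrite sqrtr_gt0 lt_neqAle eq_sym Xn0 norm2_ge0.
have rr : r ^+ 2 = norm2 X by rewrite sqr_sqrtr// norm2_ge0.
pose x a b := X a b / r.
have x2 : \sum_a \sum_b x a b ^+ 2 = 1.
  rewrite /x; under eq_bigr do under eq_bigr do rewrite expr_div_n.
  under eq_bigr do rewrite -mulr_suml; rewrite -mulr_suml rr divff//.
have x1 a b : `|x a b| <= 1.
  have : `|x a b| ^+ 2 <= 1.
    rewrite -x2 real_normK ?num_real// (bigD1 a)//= (bigD1 b)//=.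
    rewrite -addrA lerDl addr_ge0//; apply: sumr_ge0 => i _; first exact: sqr_ge0.
    by apply: sumr_ge0 => j _; exact: sqr_ge0.
  by apply: contraTT; rewrite -!ltNge => h; rewrite exprn_egt1.
pose t a b := Num.truncn (m%:R * `|x a b|).
have mx0 a b : 0 <= m%:R * `|x a b| by rewrite mulr_ge0.
have tm a b : (t a b < m.+1)%N.
  rewrite ltnS -(ler_nat R); apply: (@le_trans _ _ (m%:R * `|x a b|)).
    by have /andP[] := truncn_itv (mx0 a b).
  by rewrite -[leRHS]mulr1 ler_wpM2l.
pose f : net := [ffun p => (x p.1 p.2 < 0, Ordinal (tm p.1 p.2))].
have gE a b : grid_mx f a b = (-1) ^+ (x a b < 0)%R * ((t a b)%:R / m%:R).
  by rewrite mxE ffunE.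
have tle a b : (t a b)%:R / m%:R <= `|x a b|.
  by rewrite ler_pdivrMr// mulrC; have /andP[] := truncn_itv (mx0 a b).
have tge a b : `|x a b| - m%:R^-1 <= (t a b)%:R / m%:R.
  rewrite lerBlDr -[X in _ + X]mul1r -mulrDl ler_pdivlMr// natr1 mulrC.
  by have /andP[_ /ltW] := truncn_itv (mx0 a b).
have t0 a b : 0 <= (t a b)%:R / m%:R :> R by rewrite divr_ge0.
have g1 : norm2 (grid_mx f) <= 1.
  rewrite -x2; apply: ler_sum => a _; apply: ler_sum => b _.
  rewrite gE exprMn -exprM mulnC exprM sqrrN expr1n expr1n mul1r.
  by rewrite -[leRHS]real_normK ?num_real// ler_pXn2r ?nnegrE.
exists f; rewrite /net_mx g1.
(* Rounding loses at most 1 / m in each of the k^2 entries, and each entry of the unit vector has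
   absolute value at most 1. *)
have gx : c <= \sum_a \sum_b grid_mx f a b * x a b.
  rewrite /c -[X in X - _]x2 (_ : (k ^ 2)%:R / m%:R =
    \sum_(a < k) \sum_(b < k) m%:R^-1); last first.
    rewrite !sumr_const !card_ord -mulrnA mulnn mulr_natl//.
  rewrite -sumrB; apply: ler_sum => a _; rewrite -sumrB; apply: ler_sum => b _.
  have -> : grid_mx f a b * x a b = (t a b)%:R / m%:R * `|x a b|.
    rewrite gE mulrAC mulrC; congr (_ * _).
    case: (ltP (x a b) 0) => h; first by rewrite expr1 mulN1r ltr0_norm.
    by rewrite expr0 mul1r ger0_norm.
  apply: (le_trans _ (ler_wpM2r (normr_ge0 (x a b)) (tge a b))).
  rewrite mulrBl -expr2 real_normK ?num_real// lerD2l lerN2.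
  by rewrite ler_piMr// invr_ge0 ltW.
have -> : \sum_a \sum_b grid_mx f a b * X a b = r * \sum_a \sum_b grid_mx f a b * x a b.
  rewrite mulr_sumr; apply: eq_bigr => a _; rewrite mulr_sumr; apply: eq_bigr => b _.
  by rewrite /x; field; exact: lt0r_neq0.
rewrite exprMn [r ^+ _]exprM rr mulrC ler_wpM2l ?exprn_ge0 ?norm2_ge0//.
by apply: lerXn2r => //; rewrite nnegrE (le_trans c0 gx).
Qed.

End net.

Section overlap_moment.
Context (R : realType) (k : nat) (prior : probability (k.-tuple R) R) (M : R).
Local Notation B := [set u : k.-tuple R | forall i, `|tnth u i| <= M].
Context (priorB : prior B = 1%E) (cprior : centered prior).
Context (opn : opnorm (cov_mx prior) = 1).

Lemma pairingE n (G : 'M[R]_k) (U U' : n.-tuple (k.-tuple R)) : pairing G U U' =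
  \sum_a \sum_b G a b * ((mx_of_rows U)^T *m mx_of_rows U') a b.
Proof.
rewrite /pairing /dot /row_image.
transitivity (\sum_(i < n) \sum_b \sum_a
    G a b * (tnth (tnth U i) a * tnth (tnth U' i) b)).
  apply: eq_bigr => i _; apply: eq_bigr => b _; rewrite /dot mulr_suml.
  by apply: eq_bigr => a _; rewrite mulrA.
rewrite [RHS]exchange_big /= [LHS]exchange_big /=; apply: eq_bigr => b _.
rewrite exchange_big /=; apply: eq_bigr => a _; rewrite mxE mulr_sumr.
by apply: eq_bigr => i _; rewrite !mxE.
Qed.

(** The exponent of [mgf_dot] per unit of |u G|^2: the Gaussian value s^2 / 2 times a correction
    that tends to 1 as [s] tends to 0. *)
Definition tilt (s : R) : R := s ^+ 2 / 2 * expR (`|s| * box_bound k M).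

Lemma tilt_ge0 s : 0 <= tilt s.
Proof. by rewrite mulr_ge0 ?expR_ge0// divr_ge0// sqr_ge0. Qed.

Lemma overlap_moment (n m d : nat) (s : R) : (k ^ 2 < m)%N -> s != 0 ->
  let mu := iid prior n in
  exists Phi : n.-tuple (k.-tuple R) -> R,
  [/\ mu.-integrable setT (EFin \o Phi),
   forall U, (forall i, B (tnth U i)) ->
     mu.-integrable setT (fun U' => (overlap U U' ^+ d)%:E) /\
     \int[mu]_U' (overlap U U' ^+ d) <= Phi U &
   \int[mu]_U Phi U <= (1 - (k ^ 2)%:R / m%:R) ^- (2 * d) * (2 * d)`!%:R *
     s ^- (2 * d) * (#|{ffun 'I_k * 'I_k -> bool * 'I_m.+1}| * 2)%:R *
     expR (n%:R * (tilt s * expR (tilt s * box_bound k M)))].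
Proof.
move=> km s0 mu; set c := 1 - _; pose net := {ffun 'I_k * 'I_k -> bool * 'I_m.+1}.
have m0 : 0 < m%:R :> R by rewrite ltr0n (leq_trans _ km).
have c0 : 0 < c by rewrite subr_gt0 ltr_pdivrMr// mul1r ltr_nat.
have G1 (f : net) := norm2_net_mx R f.
pose A := c ^- (2 * d) * (2 * d)`!%:R * s ^- (2 * d).
have s2 : 0 < s ^+ (2 * d) by rewrite exprM exprn_gt0// exprn_even_gt0.
have A0 : 0 <= A.
  by rewrite !mulr_ge0// ?invr_ge0 ?(ltW s2)// exprn_ge0// ltW.
pose chi (f : net) U := expR (tilt s * tuple_image_norm2 (n := n) (net_mx R f) U).
have chiP f := mgf_tuple_image priorB cprior opn n (G1 f) (tilt_ge0 s).
have ichi : mu.-integrable setT (EFin \o fun U => \sum_(f : net) chi f U).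
  exact: (Rintegral_sum _ (fun f => (chiP f).1)).1.
(* The factor 2 accounts for the exponentials at s and -s, which obey the same bound because [tilt]
   is even. *)
exists (fun U => A * 2 * \sum_(f : net) chi f U); split.
- exact: integrable_scale ichi.
- move=> U DU.
  have step U' : overlap U U' ^+ d <=
      A * \sum_(f : net) (expR (s * pairing (net_mx R f) U U') +
                          expR (- s * pairing (net_mx R f) U U')).
    have [f] := net_approx ((mx_of_rows U)^T *m mx_of_rows U') d km.
    rewrite -pairingE -/(overlap U U') -/c => h.
    have h' : overlap U U' ^+ d <= c ^- (2 * d) * pairing (net_mx R f) U U' ^+ (2 * d).
      by rewrite mulrC ler_pdivlMr ?exprn_gt0// mulrC.
    have ci : 0 <= c ^- (2 * d) by rewrite invr_ge0 exprn_ge0// ltW.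
    apply: (le_trans h'); rewrite /A -!mulrA (ler_wpM2l ci)//.
    set p := pairing _ U U'.
    have h2 : p ^+ (2 * d) <=
        s ^- (2 * d) * ((2 * d)`!%:R * (expR (s * p) + expR (- (s * p)))).
      by rewrite mulrC ler_pdivlMr// mulrC -exprMn; exact: pow_le_expR_pm.
    apply: (le_trans h2); rewrite mulrCA ler_wpM2l// ler_wpM2l ?invr_ge0 ?(ltW s2)//.
    rewrite (bigD1 f)//= mulNr lerDl; apply: sumr_ge0 => g _.
    by rewrite addr_ge0// expR_ge0.
  have ip f := mgf_pairing priorB cprior opn (G1 f) s DU.
  have im f := mgf_pairing priorB cprior opn (G1 f) (- s) DU.
  have ipm f := integrable_add (ip f).1 (im f).1.
  have [isum Esum] := Rintegral_sum (index_enum net) ipm.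
  have iov : mu.-integrable setT (fun U' => (overlap U U' ^+ d)%:E).
    apply: le_integrable (integrable_scale A isum) => //.
      apply/measurable_EFinP; apply: measurable_funX.
      apply: measurable_sum => a; apply: measurable_sum => b; apply: measurable_funX.
      rewrite (_ : (fun _ => _) = fun U' : n.-tuple (k.-tuple R) =>
          \sum_i tnth (tnth U i) a * tnth (tnth U' i) b); last first.
        by apply/funext => U'; rewrite mxE; apply: eq_bigr => i _; rewrite !mxE.
      apply: measurable_sum => i; apply: measurable_funM => //.
      apply: (@measurableT_comp _ _ _ _ _ _ (@tnth _ R ^~ b)).
        exact: measurable_tnth.
      exact: measurable_tnth.
    move=> U' _; rewrite lee_fin ger0_norm ?exprn_ge0 ?overlap_ge0//.
    by apply: le_trans (ler_norm _); exact: step.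
  split=> //; apply: (@le_trans _ _ (A * \sum_(f : net)
      (\int[mu]_U' expR (s * pairing (net_mx R f) U U') +
       \int[mu]_U' expR (- s * pairing (net_mx R f) U U')))).
    apply: (@le_trans _ _ (\int[mu]_U' (A * \sum_(f : net)
        (expR (s * pairing (net_mx R f) U U') +
         expR (- s * pairing (net_mx R f) U U'))))).
      apply: le_Rintegral => //; exact: integrable_scale isum.
    rewrite (RintegralZl A measurableT isum) Esum ler_wpM2l//; apply: ler_sum => f _.
    by rewrite (RintegralD measurableT (ip f).1 (im f).1).
  rewrite -mulrA ler_wpM2l// mulr_sumr; apply: ler_sum => f _.
  rewrite mulr_natl mulr2n; apply: lerD; first exact: (ip f).2.
  by apply: (le_trans (im f).2); rewrite /chi /tilt sqrrN normrN.
rewrite (RintegralZl _ measurableT ichi) (Rintegral_sum _ (fun f => (chiP f).1)).2.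
rewrite -/A natrM; set K := #|_|%:R; set e := expR (n%:R * _).
rewrite [leRHS](_ : _ = A * 2 * (K * e)); last by ring.
apply: (ler_wpM2l (mulr_ge0 A0 (ler0n _ 2))); rewrite /K /e.
rewrite mulr_natl -sumr_const; apply: ler_sum => f _; exact: (chiP f).2.
Qed.

End overlap_moment.

(** * Summing the degrees *)

Section numeric_bounds.
Context (R : realType).

(** The (d + 2)-th power of the inequality 1 - 1 / (d + 2) <= e^(-1 / (d + 2)). *)
Lemma expR1_le_pow (d : nat) : expR 1 * d.+1%:R ^+ d.+2 <= d.+2%:R ^+ d.+2 :> R.
Proof.
have d1 : 0 < d.+1%:R :> R by [].
have d2 : 0 < d.+2%:R :> R by [].
have h : expR (d.+2%:R^-1) * d.+1%:R <= d.+2%:R :> R.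
  have := expR_ge1Dx (- (d.+2%:R^-1 : R)); rewrite expRN => h.
  have : (d.+1%:R / d.+2%:R : R) <= (expR d.+2%:R^-1)^-1.
    apply: le_trans h; rewrite le_eqVlt; apply/orP; left; apply/eqP.
    apply: (mulIf (lt0r_neq0 d2)); rewrite divfK ?lt0r_neq0// mulrDl mul1r mulNr.
    by rewrite mulVf ?lt0r_neq0// -(natr1 d.+1) addrK.
  by rewrite ler_pdivrMr// mulrC ler_pdivlMr ?expR_gt0// mulrC.
have -> : expR 1 = expR (d.+2%:R^-1 : R) ^+ d.+2.
  by rewrite -expRM_natl divff// pnatr_eq0.
by rewrite -exprMn; apply: lerXn2r => //; rewrite nnegrE ?mulr_ge0 ?expR_ge0.
Qed.

(** A crude Stirling bound with the exact exponential rate. The constant e / 2 gives equality at d =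
    1, and the extra factor d is absorbed by the geometric decay. *)
Lemma odd_fact_bound d : (0 < d)%N ->
  (odd_fact d)%:R * expR 1 ^+ d <= expR 1 / 2 * d%:R * (2 * d)%:R ^+ d :> R.
Proof.
case: d => // d _; elim: d => [|d IH].
  rewrite /odd_fact big_ord1 muln0 muln1 mul1r !expr1.
  by rewrite le_eqVlt; apply/orP; left; apply/eqP; field.
rewrite /odd_fact big_ord_recr/= -/(odd_fact d.+1) natrM exprS.
rewrite [leLHS](_ : _ = (2 * d.+1).+1%:R * expR 1 *
  ((odd_fact d.+1)%:R * expR 1 ^+ d.+1)); last by ring.
apply: (le_trans (ler_wpM2l _ IH)); first by rewrite mulr_ge0 ?expR_ge0.
rewrite !natrM !exprMn.
rewrite [leLHS](_ : _ = expR 1 / 2 * 2 ^+ d.+1 * (2 * d.+1).+1%:R *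
  (expR 1 * d.+1%:R ^+ d.+2)); last by rewrite (exprS _ d.+1); ring.
rewrite [leRHS](_ : _ = expR 1 / 2 * 2 ^+ d.+1 * (2 * d.+2%:R) *
  d.+2%:R ^+ d.+2); last by rewrite (exprS 2 d.+1); ring.
apply: ler_pM.
- by rewrite !mulr_ge0 ?divr_ge0 ?expR_ge0 ?exprn_ge0.
- by rewrite mulr_ge0 ?expR_ge0 ?exprn_ge0.
- apply: ler_wpM2l; first by rewrite mulr_ge0 ?divr_ge0 ?expR_ge0 ?exprn_ge0.
  by rewrite -natrM ler_nat; lia.
- exact: expR1_le_pow.
Qed.

Lemma sum_arith_geom (r : R) n : 0 <= r -> r < 1 ->
  \sum_(m < n) m%:R * r ^+ m <= r / (1 - r) ^+ 2.
Proof.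
move=> r0 r1; have q0 : 0 < 1 - r by rewrite subr_gt0.
rewrite ler_pdivlMr ?exprn_gt0//.
have -> : (\sum_(m < n) m%:R * r ^+ m) * (1 - r) ^+ 2 =
    r - (n%:R * (1 - r) * r ^+ n + r * r ^+ n).
  elim: n => [|n IH]; first by rewrite big_ord0 expr0; ring.
  by rewrite big_ord_recr/= mulrDl IH -natr1 (exprS r n); ring.
rewrite lerBlDr lerDl addr_ge0// ?mulr_ge0 ?exprn_ge0// ?ltW//.
Qed.

Lemma prod_shift_le (N D d : nat) : (2 * d <= D)%N ->
  (\prod_(j < d) (N + 2 * j))%:R <= (N + D)%:R ^+ d :> R.
Proof.
move=> dD; rewrite -natrX ler_nat -[d in X in (_ <= X)%N]card_ord -prod_nat_const.
apply: leq_prod => j _; rewrite leq_add2l (leq_trans _ dD)// leq_mul2l/= ltnW//.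
Qed.

(** The factorials (2 d)! cancel, s^(-2 d) is (n / 2 d)^d, and the exponential is about e^d. By
    [odd_fact_bound] the product of e^d and (2 d - 1)!! cancels (2 d)^d up to a factor linear in
    d. *)
Lemma degree_part_bound (d n N D : nat) (beta c tau y C0 : R) (k : nat) (M : R) :
  let s := Num.sqrt ((2 * d)%:R / n%:R) in
  (0 < d)%N -> (0 < n)%N -> (2 * d <= D)%N -> 0 < c -> 0 < tau -> tau < 1 -> 0 <= C0 ->
  beta ^+ 2 * (N + D)%:R / n%:R <= y ->
  expR (`|s| * box_bound k M) * expR (tilt k M s * box_bound k M) <= 1 + tau ->
  (2 * d)`!%:R^-1 * (beta ^+ (2 * d) * ((odd_fact d)%:R *
    ((\prod_(j < d) (N + 2 * j))%:R * n%:R ^- (2 * d))) *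
    (c ^- (2 * d) * (2 * d)`!%:R * s ^- (2 * d) * C0 *
     expR (n%:R * (tilt k M s * expR (tilt k M s * box_bound k M))))) <=
  C0 * (expR 1 / 2) * (d%:R * (y / (c ^+ 2 * (1 - tau))) ^+ d).
Proof.
move=> s d0 n0 dD c0 tau0 tau1 C00 hy hg.
have dR : 0 < d%:R :> R by rewrite ltr0n.
have nR : 0 < n%:R :> R by rewrite ltr0n.
have q0 : 0 < 1 - tau by rewrite subr_gt0.
have ss : s ^+ 2 = (2 * d)%:R / n%:R by rewrite sqr_sqrtr// divr_ge0.
have f0 : (2 * d)`!%:R != 0 :> R by rewrite pnatr_eq0 -lt0n fact_gt0.
set E := expR (n%:R * _).
(* Since n s^2 / 2 = d, the exponent is at most d (1 + tau); then e^tau <= 1 / (1 - tau). *)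
have EB : E <= (expR 1 / (1 - tau)) ^+ d.
  rewrite (_ : (expR 1 / (1 - tau)) ^+ d = expR 1 ^+ d * (1 - tau) ^- d); last first.
    by rewrite exprMn exprVn.
  have -> : E = expR (d%:R * (expR (`|s| * box_bound k M) *
      expR (tilt k M s * box_bound k M))).
    rewrite /E; congr expR; rewrite {1}/tilt ss natrM; field; exact: lt0r_neq0.
  apply: (@le_trans _ _ (expR (d%:R * (1 + tau)))); first by rewrite ler_expR ler_wpM2l.
  rewrite mulrDr expRD mulr1 -[X in expR X * _]mulr1 expRM_natl expRM_natl.
  rewrite ler_wpM2l ?exprn_ge0 ?expR_ge0// -exprVn.
  have h : expR tau <= (1 - tau)^-1.
    rewrite -[leRHS]mul1r ler_pdivlMr// mulrC -ler_pdivlMr ?expR_gt0// mul1r -expRN.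
    exact: expR_ge1Dx.
  by apply: lerXn2r => //; rewrite nnegrE ?invr_ge0 ?expR_ge0// ltW.
have PB := prod_shift_le N dD.
set P := (\prod_(j < d) (N + 2 * j))%:R in PB *.
have -> : (2 * d)`!%:R^-1 * (beta ^+ (2 * d) * ((odd_fact d)%:R * (P * n%:R ^- (2 * d))) *
    (c ^- (2 * d) * (2 * d)`!%:R * s ^- (2 * d) * C0 * E)) =
    C0 * ((odd_fact d)%:R * (P * E) *
    (beta ^+ 2 / (n%:R * c ^+ 2 * (2 * d)%:R)) ^+ d).
  rewrite [s ^+ _]exprM ss ![_ ^+ (2 * d)]exprM -!exprVn.
  rewrite (_ : beta ^+ 2 / _ = beta ^+ 2 * n%:R^-1 ^+ 2 * c^-1 ^+ 2 *
     ((2 * d)%:R / n%:R)^-1); last first.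
    by rewrite natrM; field; rewrite !lt0r_neq0.
  rewrite [in RHS]exprMn [in RHS]exprMn [in RHS]exprMn.
  set x1 := (n%:R^-1 ^+ 2) ^+ d; set x2 := (c^-1 ^+ 2) ^+ d.
  set x3 := ((2 * d)%:R / n%:R)^-1 ^+ d; set x4 := (beta ^+ 2) ^+ d.
  move: x1 x2 x3 x4 f0 => x1 x2 x3 x4; set F := (2 * d)`!%:R => f0.
  by field.
rewrite -[leRHS]mulrA; apply: ler_wpM2l => //.
apply: (@le_trans _ _ ((odd_fact d)%:R * ((N + D)%:R ^+ d * (expR 1 / (1 - tau)) ^+ d) *
    (beta ^+ 2 / (n%:R * c ^+ 2 * (2 * d)%:R)) ^+ d)).
  apply: ler_wpM2r.
    by rewrite exprn_ge0// divr_ge0 ?sqr_ge0// !mulr_ge0 ?sqr_ge0// ltW.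
  by apply: ler_wpM2l => //; apply: ler_pM => //; rewrite expR_ge0.
have -> : (odd_fact d)%:R * ((N + D)%:R ^+ d * (expR 1 / (1 - tau)) ^+ d) *
    (beta ^+ 2 / (n%:R * c ^+ 2 * (2 * d)%:R)) ^+ d =
    ((odd_fact d)%:R * expR 1 ^+ d / (2 * d)%:R ^+ d) *
    (beta ^+ 2 * (N + D)%:R / n%:R / (c ^+ 2 * (1 - tau))) ^+ d.
  have Z : (N + D)%:R * (expR 1 / (1 - tau)) * (beta ^+ 2 / (n%:R * c ^+ 2 * (2 * d)%:R)) =
      expR 1 / (2 * d)%:R * (beta ^+ 2 * (N + D)%:R / n%:R / (c ^+ 2 * (1 - tau))).
    by rewrite natrM; field; rewrite !lt0r_neq0.
  rewrite -mulrA -[X in _ * (X * _)]exprMn -[X in _ * X]exprMn Z [X in _ * X]exprMn.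
  by rewrite [X in _ * (X * _)]expr_div_n !mulrA.
have z0 : 0 < c ^+ 2 * (1 - tau) by rewrite mulr_gt0 ?exprn_gt0.
have w0 : 0 <= beta ^+ 2 * (N + D)%:R / n%:R.
  by apply: divr_ge0 => //; apply: mulr_ge0 => //; exact: sqr_ge0.
have e0 : 0 <= expR 1 ^+ d :> R by rewrite exprn_ge0 ?expR_ge0.
rewrite mulrA; apply: ler_pM.
- by apply: divr_ge0; [apply: mulr_ge0|exact: exprn_ge0].
- by apply: exprn_ge0; apply: divr_ge0 => //; exact: ltW.
- by rewrite ler_pdivrMr ?exprn_gt0 ?ltr0n ?muln_gt0// odd_fact_bound.
apply: lerXn2r; rewrite ?nnegrE.
- by apply: divr_ge0 => //; exact: ltW.
- by apply: divr_ge0; [exact: le_trans hy|exact: ltW].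
by rewrite ler_pM2r ?invr_gt0.
Qed.

End numeric_bounds.

(** * The projection of the likelihood ratio and its norm *)

Section low_degree_projection.
Context (R : realType) (k n N : nat) (beta M : R) (prior : probability (k.-tuple R) R).
Context (priorB : prior [set u | forall i, `|tnth u i| <= M] = 1%E).
Implicit Types p q : mpoly (N * n) R.
Local Notation planted := (planted_functional beta prior).

Lemma mv_functional1_stein : stein 1%:M (@mv_functional R N n 1%:M).
Proof. by rewrite -row_op1; exact/mv_functional_stein/posdef1. Qed.

(** Absolute continuity gives E_Q[L q] = E_P[q], and [low_degree_partP] gives E_Q[p q] the same
    value. *)
Lemma is_low_degree_projection_planted D :
  is_low_degree_projection (wishart_null R n N) (likelihood_ratio prior beta n N) D
    (low_degree_part planted D).
Proof.
set p := low_degree_part _ D; split; first exact: msize_low_degree_part.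
move=> q qD f.
have dom := @planted_dominates R k n N beta prior.
have qi := (planted_functionalE beta priorB q).1.
have pqi := (integrable_mvnormal 1%:M (p * q)).1.
have fE : f = fun y => (likelihood_ratio prior beta n N y * (poly_fun q y)%:E -
    (EFin \o poly_fun (p * q)%R) y)%E.
  apply/funext => y; rewrite /f /comp poly_funM EFinM muleBl//.
  exact/fin_num_adde_defl.
have Lqi := integrable_Radon_Nikodym dom qi.
rewrite fE; split; first exact: integrableB.
rewrite integralB// (integral_Radon_Nikodym dom qi).
have -> : (\int[wishart_planted prior beta n N]_x (poly_fun q x)%:E = (planted q)%:E)%E.
  by rewrite fineK//; exact: integrable_fin_num.
have -> : (\int[wishart_null R n N]_x (EFin \o poly_fun (p * q)%R) x =
    (mv_functional 1%:M (p * q))%:E)%E.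
  by rewrite fineK//; exact: integrable_fin_num.
rewrite (low_degree_partP (mv_functional_linear _) (mv_functional1 _ _)
  mv_functional1_stein (planted_functional_linear beta priorB) qD).
by rewrite -EFinB subrr.
Qed.

Lemma Lnorm2_poly_fun p :
  ('N[wishart_null R n N]_2[EFin \o poly_fun p] =
   (Num.sqrt (mv_functional 1%:M (p * p)%R))%:E)%E.
Proof.
have pp := (integrable_mvnormal 1%:M (p * p)).1.
have E : (\int[wishart_null R n N]_y (`|(EFin \o poly_fun p) y| `^ 2) =
    (mv_functional 1%:M (p * p)%R)%:E)%E.
  rewrite fineK; last exact: integrable_fin_num.
  apply: eq_integral => y _; rewrite /= poly_funM.
  by rewrite powR_mulrn// real_normK ?num_real// expr2.
rewrite unlock E /= powR12_sqrt//; apply: Rintegral_ge0 => y _.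
by rewrite poly_funM -expr2 sqr_ge0.
Qed.
End low_degree_projection.

Section norm_bound.
Context (R : realType) (k : nat) (prior : probability (k.-tuple R) R) (M : R).
Context (priorB : prior [set u | forall i, `|tnth u i| <= M] = 1%E).
Context (cprior : centered prior) (opn : opnorm (cov_mx prior) = 1).

Lemma low_degree_norm_bound (n N D m : nat) (beta tau y r eta : R) :
  let c := 1 - (k ^ 2)%:R / m%:R in
  let C0 := (#|{ffun 'I_k * 'I_k -> bool * 'I_m.+1}| * 2)%:R in
  let p : mpoly (N * n) R := low_degree_part (planted_functional beta prior) D in
  (0 < n)%N -> (k ^ 2 < m)%N -> 0 < tau -> tau < 1 -> 0 <= r -> r < 1 ->
  beta ^+ 2 * (N + D)%:R / n%:R <= y -> y / (c ^+ 2 * (1 - tau)) <= r ^+ 2 ->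
  0 <= eta -> D%:R / n%:R <= eta ^+ 2 ->
  (forall s : R, `|s| <= eta ->
    expR (`|s| * box_bound k M) * expR (tilt k M s * box_bound k M) <= 1 + tau) ->
  mv_functional 1%:M (p * p) <= 1 + C0 * (expR 1 / 2) * (r / (1 - r) ^+ 2).
Proof.
move=> c C0 p n0 km tau0 tau1 r0 r1 hy yr eta0 Deta heta.
have c0 : 0 < c.
  by rewrite /c subr_gt0 ltr_pdivrMr ?mul1r ?ltr_nat// ltr0n (leq_ltn_trans _ km).
have C10 : 0 <= C0 * (expR 1 / 2) by rewrite mulr_ge0// divr_ge0// expR_ge0.
have nR : 0 < n%:R :> R by rewrite ltr0n.
rewrite (low_degree_part_sqr (mv_functional_linear _) (mv_functional1 _ _)
  (@mv_functional1_stein R n N) _ (planted_functional_linear beta priorB)).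
(* Degree 0 contributes exactly 1 and odd degrees vanish. In degree j = 2 d the ratio is at most
   r^2, so d r^(2 d) <= j r^j. *)
apply: (@le_trans _ _ (\sum_(j < D.+1)
    ((j == 0%N :> nat)%:R + C0 * (expR 1 / 2) * (j%:R * r ^+ j)))); last first.
  rewrite big_split/= -mulr_sumr; apply: lerD.
    by rewrite big_ord_recl/= big1 ?addr0.
  by apply: ler_wpM2l => //; exact: sum_arith_geom.
apply: ler_sum => -[j jD] _ /=; rewrite ltnS in jD.
have bnd0 : 0 <= C0 * (expR 1 / 2) * (j%:R * r ^+ j).
  by apply: mulr_ge0 => //; apply: mulr_ge0 => //; exact: exprn_ge0.
have [jo|je] := boolP (odd j).
  by rewrite (planted_words_odd _ _ beta priorB)// mulr0 addr_ge0.
have {je} jE : j = (2 * j./2)%N by rewrite mul2n even_halfK.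
have [j0|j0] := eqVneq j 0%N.
  rewrite j0 /= (planted_functional1 _ _ beta priorB) expr1n.
  by rewrite fact0 invr1 mulr1 mul0r mulr0 addr0.
rewrite add0r; move: (j./2) jE j0 jD bnd0 => d -> d0 dD bnd0.
have {}d0 : (0 < d)%N by move: d0; case: (d).
pose s : R := Num.sqrt ((2 * d)%:R / n%:R).
have s0 : s != 0 by rewrite gt_eqF// sqrtr_gt0 divr_gt0// ltr0n muln_gt0.
have sm : `|s| <= eta.
  rewrite ger0_norm ?sqrtr_ge0// -[eta]ger0_norm// -sqrtr_sqr ler_wsqrtr//.
  by apply: le_trans Deta; rewrite ler_pM2r ?invr_gt0// ler_nat.
have [Phi [iPhi ovPhi intPhi]] := overlap_moment priorB cprior opn n d km s0.
have hw := planted_words_even N beta priorB iPhi (fun U DU => (ovPhi U DU).1)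
  (fun U DU => (ovPhi U DU).2).
have A0 : 0 <= beta ^+ (2 * d) * ((odd_fact d)%:R *
    ((\prod_(i < d) (N + 2 * i))%:R * n%:R ^- (2 * d))).
  have b0 : 0 <= beta ^+ (2 * d) by rewrite exprM exprn_ge0 ?sqr_ge0.
  by rewrite mulr_ge0// mulr_ge0// mulr_ge0// invr_ge0 exprn_ge0.
have f0 : 0 <= (2 * d)`!%:R^-1 :> R by rewrite invr_ge0.
apply: (le_trans (ler_wpM2l f0 (le_trans hw (ler_wpM2l A0 intPhi)))).
have tb := degree_part_bound d0 n0 dD c0 tau0 tau1 (ler0n R _ : 0 <= C0) hy (heta s sm).
apply: (le_trans tb); apply: (ler_wpM2l C10).
apply: ler_pM => //.
- apply: exprn_ge0; apply: divr_ge0.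
    by apply: (le_trans _ hy); rewrite divr_ge0// mulr_ge0// sqr_ge0.
  by rewrite mulr_ge0 ?sqr_ge0// subr_ge0 ltW.
- by rewrite ler_nat leq_pmull.
- rewrite exprM; apply: lerXn2r => //; rewrite nnegrE ?sqr_ge0//.
  apply: divr_ge0; last by rewrite mulr_ge0 ?sqr_ge0// subr_ge0 ltW.
  by apply: (le_trans _ hy); rewrite divr_ge0// mulr_ge0// sqr_ge0.
Qed.

End norm_bound.

Section parameters.
Context (R : realType).

Lemma tilt_near0 (k : nat) (M tau : R) : 0 < tau ->
  exists2 eta : R, 0 < eta & forall s : R, `|s| <= eta ->
    expR (`|s| * box_bound k M) * expR (tilt k M s * box_bound k M) <= 1 + tau.
Proof.
move=> tau0.
pose f (s : R) := expR (`|s| * box_bound k M) * expR (tilt k M s * box_bound k M).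
have cabs : {for 0, continuous (fun s : R => expR (`|s| * box_bound k M))}.
  apply: continuous_comp; last exact: continuous_expR.
  by apply: continuousM; [exact: norm_continuous|exact: cst_continuous].
have cf : {for 0, continuous f}.
  apply: continuousM; first exact: cabs.
  apply: continuous_comp; last exact: continuous_expR.
  apply: continuousM; last exact: cst_continuous.
  apply: continuousM; last exact: cabs.
  apply: continuousM; last exact: cst_continuous.
  exact: exprn_continuous.
have f0 : f 0 = 1 by rewrite /f /tilt normr0 expr0n /= !mul0r expR0 mulr1.
have /cvgrPdist_le/(_ _ tau0) := cf; rewrite f0 => /nbhs_ballP[e /= e0 he].
exists (e / 2); first by rewrite divr_gt0.
move=> s se; have : ball 0 e s.
  by rewrite -ball_normE /= sub0r normrN (le_lt_trans se)// ltr_pdivrMr// ltr_pMr// ltr1n.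
by move=> /he; rewrite distrC => /(le_trans (ler_norm _)); rewrite lerBlDl.
Qed.

Lemma size_ratio_bound (beta gamma tau : R) (N D : nat -> nat) (eta : R) :
  0 < gamma -> 0 < tau -> 0 < eta ->
  (n%:R / (N n)%:R : R) @[n --> \oo] --> gamma ->
  (fun n => (D n)%:R : R) =o_\oo (fun n => n%:R / ln n%:R : R) ->
  \forall n \near \oo, [/\ (0 < n)%N,
    beta ^+ 2 * (N n + D n)%:R / n%:R <= beta ^+ 2 / gamma + tau &
    (D n)%:R / n%:R <= eta].
Proof.
move=> gamma0 tau0 eta0 hN /eqoP hD.
have b1 : 0 < beta ^+ 2 + 1 by rewrite ltr_wpDl ?sqr_ge0.
(* N / n and D / n each receive an error of half of tau / (beta^2 + 1), so that multiplying by
   beta^2 leaves at most tau. *)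
pose e := Num.min eta (tau / (2 * (beta ^+ 2 + 1))).
have e0 : 0 < e by rewrite lt_min eta0 divr_gt0// mulr_gt0.
have hNi : ((n%:R / (N n)%:R)^-1 : R) @[n --> \oo] --> gamma^-1.
  by apply: cvgV => //; rewrite gt_eqF.
have t2 : 0 < tau / (2 * (beta ^+ 2 + 1)) by rewrite divr_gt0// mulr_gt0.
have /cvgrPdist_le/(_ _ t2) hNe := hNi.
near=> n.
have n0 : (0 < n)%N by near: n; exact: nbhs_infty_gt.
have nR : 0 < n%:R :> R by rewrite ltr0n.
have Dn : (D n)%:R / n%:R <= e.
  rewrite ler_pdivrMr//; have : `|(D n)%:R : R| <= e * `|n%:R / ln n%:R : R|.
    by near: n; exact: hD.
  rewrite ger0_norm// => /le_trans; apply; apply: ler_wpM2l; first exact: ltW.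
  (* For n at least e, n / ln n is at most n. *)
  have ln1 : 1 <= ln n%:R :> R.
    rewrite -[leLHS]expRK ler_ln ?posrE ?expR_gt0//.
    near: n; exact: nbhs_infty_ger.
  rewrite ger0_norm; last by rewrite divr_ge0// (le_trans _ ln1).
  by rewrite ler_pdivrMr ?(lt_le_trans _ ln1)// ler_peMr.
have Nn : (N n)%:R / n%:R <= gamma^-1 + tau / (2 * (beta ^+ 2 + 1)).
  have : `|gamma^-1 - (n%:R / (N n)%:R)^-1| <= tau / (2 * (beta ^+ 2 + 1)).
    by near: n; exact: hNe.
  by rewrite invf_div distrC => /(le_trans (ler_norm _)); rewrite lerBlDl.
split=> //; last by apply: (le_trans Dn); rewrite ge_min lexx.
have De : (D n)%:R / n%:R <= tau / (2 * (beta ^+ 2 + 1)).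
  by apply: (le_trans Dn); rewrite ge_min lexx orbT.
rewrite -mulrA natrD mulrDl; apply: (le_trans (ler_wpM2l (sqr_ge0 _) (lerD Nn De))).
have -> : gamma^-1 + tau / (2 * (beta ^+ 2 + 1)) + tau / (2 * (beta ^+ 2 + 1)) =
    gamma^-1 + tau / (beta ^+ 2 + 1) by field; rewrite !gt_eqF.
rewrite mulrDr lerD2l.
by rewrite mulrA ler_pdivrMr// mulrC ler_pM2l// lerDl.
Unshelve. all: by end_near.
Qed.

End parameters.

Theorem theorem2p17 (R : realType) (k : nat) (beta gamma : R)
    (prior : probability (k.-tuple R) R) (N : nat -> nat) :
  (1 <= k)%N -> -1 < beta -> 0 < gamma ->
  bounded_support prior -> centered prior -> opnorm (cov_mx prior) = 1 ->
  (n%:R / (N n)%:R : R) @[n --> \oo] --> gamma ->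
  beta ^+ 2 < gamma ->
  forall D : nat -> nat,
    (fun n => (D n)%:R : R) =o_\oo (fun n => n%:R / ln n%:R : R) ->
  exists C : R, \forall n \near \oo,
    exists2 p : mpoly (N n * n) R,
      is_low_degree_projection (wishart_null R n (N n))
        (likelihood_ratio prior beta n (N n)) (D n) p &
      ('N[wishart_null R n (N n)]_2[EFin \o poly_fun p] <= C%:E)%E.
Proof.
move=> _ _ gamma0 [M priorB] cprior opn hN bg D hD.
pose q0 := beta ^+ 2 / gamma.
have q00 : 0 <= q0 by rewrite divr_ge0 ?sqr_ge0// ltW.
have q01 : q0 < 1 by rewrite ltr_pdivrMr// mul1r.
(* With c >= 1 - tau, the ratio [rho] is below 1 as soon as q0 + tau < (1 - tau)^3; this holds
   because q0 + tau = 1 - 7 tau. *)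
pose tau := (1 - q0) / 8.
have tau0 : 0 < tau by rewrite divr_gt0// subr_gt0.
have tau8 : 8 * tau <= 1 by rewrite mulrC divfK// gerBl.
have q0E : q0 = 1 - 8 * tau by rewrite /tau; field.
have tau1 : tau < 1 by lra.
have [m km mtau] : exists2 m, (k ^ 2 < m)%N & (k ^ 2)%:R / m%:R <= tau.
  pose m := (maxn (k ^ 2) (Num.truncn ((k ^ 2)%:R / tau))).+1.
  exists m; first by rewrite ltnS leq_maxl.
  rewrite ler_pdivrMr// mulrC -ler_pdivrMr//; apply: ltW.
  by apply: (lt_le_trans (truncnS_gt _)); rewrite ler_nat ltnS leq_maxr.
have [eta eta0 heta] := tilt_near0 k M tau0.
pose c : R := 1 - (k ^ 2)%:R / m%:R.
have c1 : 1 - tau <= c by rewrite lerD2l lerN2.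
have z0 : 0 < 1 - tau by rewrite subr_gt0.
pose rho := (q0 + tau) / (c ^+ 2 * (1 - tau)).
have den0 : 0 < c ^+ 2 * (1 - tau) by rewrite mulr_gt0// exprn_gt0// (lt_le_trans z0).
have rho0 : 0 <= rho by apply: divr_ge0; [apply: addr_ge0 => //; exact: ltW|exact: ltW].
have rho1 : rho < 1.
  rewrite ltr_pdivrMr// mul1r; apply: (@lt_le_trans _ _ ((1 - tau) ^+ 2 * (1 - tau))).
    by rewrite q0E; nra.
  by rewrite ler_pM2r// lerXn2r// nnegrE ?ltW// (lt_le_trans z0).
have r1 : Num.sqrt rho < 1 by rewrite -[ltRHS]sqrtr1 ltr_sqrt.
exists (Num.sqrt (1 + (#|{ffun 'I_k * 'I_k -> bool * 'I_m.+1}| * 2)%:R * (expR 1 / 2) *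
  (Num.sqrt rho / (1 - Num.sqrt rho) ^+ 2))).
have e20 : 0 < eta ^+ 2 by rewrite exprn_gt0.
have := size_ratio_bound beta gamma0 tau0 e20 hN hD.
apply: filterS => n [n0 hy Deta].
exists (low_degree_part (planted_functional beta prior) (D n)).
  exact: (is_low_degree_projection_planted _ _ beta priorB).
rewrite Lnorm2_poly_fun lee_fin ler_wsqrtr//.
apply: (low_degree_norm_bound priorB cprior opn n0 km tau0 tau1 (sqrtr_ge0 _) r1 hy
  _ (ltW eta0) Deta heta).
by rewrite sqr_sqrtr.
Qed.
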